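(* Let $\Psi_1:\mathbb R\to\mathbb R$ be given by $\Psi_1(z)=\big(-\frac z2+(\frac1{27}+\frac{z^2}4)^{1/2}\big)^{1/3}+\big(-\frac z2-(\frac1{27}+\frac{z^2}4)^{1/2}\big)^{1/3}$. The mapping $\Phi':(a,b)\mapsto(\mathcal X,\mathcal Y)$ defined by $$\Phi'(a,b)=\left(a+a^3+\frac{b^2a}4\ ,\ 2\int_{-\infty}^{b/2}\frac{d\tilde b}{(1+\tilde b^2)\left(1+3\Psi_1^2\left(\frac{a+a^3+\frac{b^2a}4}{(1+\tilde b^2)^{3/2}}\right)\right)}\right)$$ satisfies the following properties. (i) It is an analytic volume preserving diffeomorphism between $\mathbb R^2$ and the subset of the upper half plane $\{0<\mathcal Y<2\mathcal Y'^*(\mathcal X)\}$, where $$\mathcal Y'^*(\mathcal X)=\int_{-\infty}^\infty\frac{d\tilde b}{(1+\tilde b^2)\left(1+3\Psi_1^2\left(\frac{\mathcal X}{(1+\tilde b^2)^{3/2}}\right)\right)}$$ is an analytic curve with $$\mathcal Y'^*(\mathcal X)\underset{\mathcal X\to0}=\pi-\frac{15}{16}\pi\mathcal X^2+O(\mathcal X^4),\qquad \mathcal Y'^*(\mathcal X)\underset{\mathcal X\to\pm\infty}=\frac{B(\frac16,\frac12)}3|\mathcal X|^{-\frac13}+O(|\mathcal X|^{-1}).$$ (ii) Let $\Theta'(\mathcal X,\mathcal Y)=-a$ if $0<\mathcal Y<2\mathcal Y'^*(\mathcal X)$, where $(a,b)=\Phi'^{-1}(\mathcal X,\mathcal Y)$,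 and $\Theta'(\mathcal X,\mathcal Y)=0$ if $\mathcal Y=0$ or $\mathcal Y\ge2\mathcal Y'^*(\mathcal X)$. Then $\Theta'$ is a self-similar profile, namely $$u(t,x,y)=(T-t)^{\frac12}\,\Theta'\!\left(\frac x{(T-t)^{3/2}},\frac y{(T-t)^{-1/2}}\right)$$ is a solution of the homogeneous inviscid Prandtl system $u_t+uu_x+vu_y=0$, $u_x+v_y=0$, $v|_{y=0}=0$. (iii) $\Theta'\in C^1(\mathcal H)$. Moreover $\Theta'$ restricted to $\{0\le\mathcal Y\le2\mathcal Y'^*(\mathcal X)\}$ is analytic, including at the boundaries $\{\mathcal Y=0\}\cup\{\mathcal Y=2\mathcal Y'^*(\mathcal X)\}$. The extension $$\overline\Theta'(\mathcal X,\mathcal Y):=\Theta'\big(\mathcal X,\ \mathcal Y\bmod2\mathcal Y'^*(\mathcal X)\big)$$ is analytic on the whole upper half space and is also a self-similar profile, in the sense that $\overline u(t,x,y)=(T-t)^{1/2}\,\overline\Theta'(x/(T-t)^{3/2},y/(T-t)^{-1/2})$ is a solution of the homogeneous inviscid Prandtl system. (iv) $\Theta'$ is odd in $\mathcal X$, and $\Theta'(\mathcal X,\mathcal Y'^*(\mathcal X)+\mathcal Y)=\Theta'(\mathcal X,\mathcal Y'^*(\mathcal X)-\mathcal Y)$ for all $|\mathcal Y|<\mathcal Y'^*(\mathcal X)$. $\Theta'$ is positive on $\{\mathcal X<0,\ 0<\mathcal Y<2\mathcal Y'^*(\mathcal X)\}$ and negative on $\{\mathcal X>0,\ 0<\mathcal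 Y<2\mathcal Y'^*(\mathcal X)\}$. (v) The set $S=\{\partial_{\mathcal Y}\Theta'=0\}$ equals $S_1\cup S_2$, where $S_1=\{\mathcal X=0\}\cup\{\mathcal Y=\mathcal Y'^*(\mathcal X)\}$, with $\Theta'(\mathcal X,\mathcal Y'^*(\mathcal X))=\Psi_1(\mathcal X)$, and $S_2=\{\mathcal Y=0\}\cup\{\mathcal Y\ge2\mathcal Y'^*(\mathcal X)\}$. The minimum of $\partial_{\mathcal X}\Theta'$ on $S$ is attained at $(0,\pi)$, where one has the expansion $$\Theta'(\mathcal X,\pi+\mathcal Y)=-\mathcal X+\mathcal X^3+\frac{\mathcal Y^2}4\mathcal X+O(|\mathcal X|^5+|\mathcal Y|^4|\mathcal X|)\qquad\text{as }(\mathcal X,\mathcal Y)\to(0,0).$$ (vi) The trace of the first order tangential derivative on the vertical axis is given by $\partial_{\mathcal X}\Theta'(0,\mathcal Y)=-\sin^2\big(\frac{\mathcal Y}2\big)\mathbf 1_{0\le\mathcal Y\le2\pi}$. (vii) The trace of the third order derivative on the vertical axis is given by $$\partial_{\mathcal X}^3\Theta'(0,\mathcal Y)=\frac1{576}\left[\frac{96\sin^8(\frac{\mathcal Y}2)}{\cos^2(\frac{\mathcal Y}2)+\frac16}-\sin(\mathcal Y)\left(270\mathcal Y-80\sin(\mathcal Y)+3\sin(2\mathcal Y)-\frac{686\sin(\mathcal Y)}{3\cos^2(\frac{\mathcal Y}2)+\frac12}\right)\right]\mathbf 1_{0\le\mathcal Y\le2\pi}.$$ This function is positive on $(0,2\pi)$.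 It admits the expansions, as $\mathcal Y\to0$: $\partial_{\mathcal X}^3\Theta'(0,\mathcal Y)=c\mathcal Y^8+O(\mathcal Y^{10})$ and $\partial_{\mathcal X}^3\Theta'(0,2\pi-\mathcal Y)=c'\mathcal Y+O(\mathcal Y^2)$, with $c,c'>0$.
   Context: $\mathcal H=\mathbb R\times[0,\infty)$. Primes in $\Phi',\Theta',\mathcal Y'^*$ are part of the names, not derivatives. Cube roots are real; $\Psi_1$ is the inverse function of $z\mapsto-z-z^3$. $B$ is the Euler integral of the first kind (Beta function). ''Volume preserving'' means Jacobian determinant of absolute value $1$. For the Prandtl system, $v(t,x,y)=-\int_0^yu_x(t,x,\tilde y)\,d\tilde y$; $T\in\mathbb R$ is arbitrary and $t<T$. For $z\ge0$ and $z'>0$, $z\bmod z'\in[0,z')$ is defined by $z=kz'+(z\bmod z')$ with $k\in\mathbb N$ (including $0$). $\mathbf 1$ denotes an indicator function.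
   Formalization: In (v) the term (15π/32)X³Y is added to the expansion of Θ'(X,π+Y), as the printed remainder fails along Y=X→0; in (vii) the printed formula for ∂_X³Θ'(0,Y) is multiplied by 6, as at Y=π it gives 1 while (v) forces 6. *)

(* Defs.v *)
From Stdlib Require Import Reals ClassicalEpsilon.
From Coquelicot Require Import Coquelicot.
Open Scope R_scope.

Definition bigO {T : Type} (F : (T -> Prop) -> Prop) (f g : T -> R) : Prop :=
  exists C : R, F (fun x => Rabs (f x) <= C * Rabs (g x)).

Definition indicator (a b y : R) : R :=
  if Rle_dec a y then if Rle_dec y b then 1 else 0 else 0.

(* [Rpower 0 y] is 1 in the library; the factor [sign z] makes [cbrt 0 = 0]. *)
Definition cbrt (z : R) : R := sign z * Rpower (Rabs z) (1 / 3).

Definition Beta (p q : R) : R :=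
  RInt_gen (fun t => Rpower t (p - 1) * Rpower (1 - t) (q - 1))
    (at_right 0) (at_left 1).

(* [Int_part] is the floor function. *)
Definition rmod (z z' : R) : R := z - IZR (Int_part (z / z')) * z'.

Definition has_derive_n (f : R -> R) (n : nat) (x l : R) : Prop :=
  locally x (fun z => forall k, (k < n)%nat -> ex_derive_n f k z) /\
  is_derive_n f n x l.

(* At the boundary point [y = 0] this is the right derivative. *)
Definition is_derive_half (f : R -> R) (y l : R) : Prop :=
  filterdiff f (within (fun z => 0 <= z) (locally y)) (fun h => scal h l).

Definition analytic (f : R -> R) : Prop :=
  forall x0 : R, exists (c : nat -> R) (r : posreal),
    forall x, Rabs (x - x0) < r -> is_pseries c (x - x0) (f x).

Definition abs_summable2 (c : nat -> nat -> R) (r : R) : Prop :=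
  (forall i, ex_series (fun j => Rabs (c i j) * r ^ (i + j))) /\
  ex_series (fun i => Series (fun j => Rabs (c i j) * r ^ (i + j))).

(* When [A] is not open, [f] restricted to [A] is required to be given, near
   each point of [A] (boundary points included), by a power series converging in
   a full neighbourhood of that point. *)
Definition analytic2_on (A : R * R -> Prop) (f : R * R -> R) : Prop :=
  forall x0 y0 : R, A (x0, y0) ->
  exists (c : nat -> nat -> R) (r : posreal),
    abs_summable2 c r /\
    forall x y : R, A (x, y) -> Rabs (x - x0) < r -> Rabs (y - y0) < r ->
      f (x, y) =
      Series (fun i => Series (fun j => c i j * (x - x0) ^ i * (y - y0) ^ j)).

Definition analytic2_map_on (A : R * R -> Prop) (F : R * R -> R * R) : Prop :=
  analytic2_on A (fun p => fst (F p)) /\ analytic2_on A (fun p => snd (F p)).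

Definition plane (p : R * R) : Prop := True.

Definition half_plane (p : R * R) : Prop := 0 <= snd p.

Definition analytic_diffeo_onto (D : R * R -> Prop) (F G : R * R -> R * R)
    : Prop :=
  (forall p, D (F p)) /\
  (forall p, G (F p) = p) /\
  (forall q, D q -> F (G q) = q) /\
  analytic2_map_on plane F /\
  analytic2_map_on D G.

Definition volume_preserving (F : R * R -> R * R) : Prop :=
  forall a b : R, exists Xa Xb Ya Yb : R,
    is_derive (fun a' => fst (F (a', b))) a Xa /\
    is_derive (fun b' => fst (F (a, b'))) b Xb /\
    is_derive (fun a' => snd (F (a', b))) a Ya /\
    is_derive (fun b' => snd (F (a, b'))) b Yb /\
    Rabs (Xa * Yb - Xb * Ya) = 1.

Definition is_dX (f : R * R -> R) (p : R * R) (l : R) : Prop :=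
  is_derive (fun x => f (x, snd p)) (fst p) l.

Definition is_dY (f : R * R -> R) (p : R * R) (l : R) : Prop :=
  is_derive_half (fun y => f (fst p, y)) (snd p) l.

Definition continuous_within (A : R * R -> Prop) (g : R * R -> R) : Prop :=
  forall p, A p -> filterlim g (within A (locally p)) (locally (g p)).

Definition C1_half_plane (f : R * R -> R) : Prop :=
  exists fX fY : R * R -> R,
    (forall p, half_plane p -> is_dX f p (fX p) /\ is_dY f p (fY p)) /\
    continuous_within half_plane fX /\
    continuous_within half_plane fY.

Definition continuous_before (T : R) (g : R -> R -> R -> R) : Prop :=
  forall t x y : R, t < T -> 0 <= y ->
    filterlim (fun q : R * (R * R) => g (fst q) (fst (snd q)) (snd (snd q)))
      (within (fun q : R * (R * R) => 0 <= snd (snd q)) (locally (t, (x, y))))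
      (locally (g t x y)).

(* Classical solution on {t < T} x R x [0, oo): [u] is of class C^1 up to the
   boundary [y = 0], and [v] is recovered from [u_x]. *)
Definition prandtl_solution (T : R) (u : R -> R -> R -> R) : Prop :=
  exists ut ux uy vy : R -> R -> R -> R,
    let v t x y := - RInt (fun y' => ux t x y') 0 y in
    continuous_before T ut /\
    continuous_before T ux /\
    continuous_before T uy /\
    forall t x y : R, t < T -> 0 <= y ->
      is_derive (fun t' => u t' x y) t (ut t x y) /\
      is_derive (fun x' => u t x' y) x (ux t x y) /\
      is_derive_half (fun y' => u t x y') y (uy t x y) /\
      ex_RInt (fun y' => ux t x y') 0 y /\
      is_derive_half (fun y' => v t x y') y (vy t x y) /\
      ut t x y + u t x y * ux t x y + v t x y * uy t x y = 0 /\
      ux t x y + vy t x y = 0 /\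
      v t x 0 = 0.

Definition self_similar (T : R) (P : R * R -> R) (t x y : R) : R :=
  Rpower (T - t) (1 / 2) *
  P (x / Rpower (T - t) (3 / 2), y / Rpower (T - t) (- (1 / 2))).

Definition Psi1 (z : R) : R :=
  cbrt (- (z / 2) + sqrt (1 / 27 + z ^ 2 / 4)) +
  cbrt (- (z / 2) - sqrt (1 / 27 + z ^ 2 / 4)).

Definition density (X b : R) : R :=
  1 / ((1 + b ^ 2) * (1 + 3 * Psi1 (X / Rpower (1 + b ^ 2) (3 / 2)) ^ 2)).

Definition Phi' (p : R * R) : R * R :=
  let (a, b) := p in
  let X := a + a ^ 3 + b ^ 2 * a / 4 in
  (X, 2 * RInt_gen (density X) (Rbar_locally m_infty) (at_point (b / 2))).

Definition Ystar' (X : R) : R :=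
  RInt_gen (density X) (Rbar_locally m_infty) (Rbar_locally p_infty).

Definition strip (p : R * R) : Prop := 0 < snd p < 2 * Ystar' (fst p).

Definition closed_strip (p : R * R) : Prop :=
  0 <= snd p <= 2 * Ystar' (fst p).

(* Meaningful on the range of [Phi']. *)
Definition Phi'_inv (q : R * R) : R * R :=
  epsilon (inhabits (0, 0)) (fun p => Phi' p = q).

Definition Theta' (q : R * R) : R :=
  if Rlt_dec 0 (snd q) then
    if Rlt_dec (snd q) (2 * Ystar' (fst q)) then - fst (Phi'_inv q) else 0
  else 0.

Definition Theta'_bar (q : R * R) : R :=
  Theta' (fst q, rmod (snd q) (2 * Ystar' (fst q))).

Definition critical_set (q : R * R) : Prop :=
  half_plane q /\ is_dY Theta' q 0.

Definition S1 (q : R * R) : Prop :=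
  half_plane q /\ (fst q = 0 \/ snd q = Ystar' (fst q)).

Definition S2 (q : R * R) : Prop :=
  half_plane q /\ (snd q = 0 \/ 2 * Ystar' (fst q) <= snd q).

(* Third derivative in X, on the axis X = 0, of the profile.  With
   J(s) = int_0^s sin^6, expanding the parametrisation in powers of X gives
   Theta' = - X sin^2(Y/2) + X^3 (sin^8(Y/2) - 3 sin(Y) J(Y/2)) + O(X^5),
   and the bracket over 576 is the coefficient of X^3; the factor 6 = 3! turns
   this Taylor coefficient into the derivative. *)
Definition trace3 (Y : R) : R :=
  6 * (1 / 576 *
    (96 * sin (Y / 2) ^ 8 / (cos (Y / 2) ^ 2 + 1 / 6)
     - sin Y * (270 * Y - 80 * sin Y + 3 * sin (2 * Y)
                - 686 * sin Y / (3 * cos (Y / 2) ^ 2 + 1 / 2)))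
    * indicator 0 (2 * PI) Y).

(* Taylor polynomial of Theta' (X, PI + Y).  The crest is at
   Ystar' X = PI - 15/16 PI X^2 + O(X^4), not at PI, so the quadratic term is
   X (Y + 15/16 PI X^2)^2 / 4, whose cross term 15/32 PI X^3 Y is not
   O(|X|^5 + |Y|^4 |X|) (take Y = X). *)
Definition crest_expansion (X Y : R) : R :=
  - X + X ^ 3 + Y ^ 2 / 4 * X + 15 / 32 * PI * X ^ 3 * Y.

(* Main.v *)
(* In the Lagrangian variables [(a, b)] the function [X = a + a^3 + b^2 a / 4] is a
   Hamiltonian, and [Y] is the time spent on its level sets, whence the unit
   Jacobian.  Put [b = 2 tan p] and [a = X cos^2 p w]; then [w] is the root of
   [w + Z w^3 = 1] with [Z = X^2 cos^6 p], and
     [Y = K (X, p) = 2 int_(-pi/2)^p dp' / (1 + 3 Z w^2)].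
   For each [X] this is an increasing bijection of the whole line, so its inverse
   [p = phi (X, Y)] and [A (X, Y) = a (X, phi (X, Y))] are analytic on the plane,
   and [A] is periodic in [Y] because the integrand has period [pi] in [p].  The
   extended profile is [-A]; it vanishes to second order on [Y = 0] and on
   [Y = 2 Ystar' X], which is why [Theta'] is of class C^1.  The Prandtl equation
   reduces to [w + Z w^3 = 1] once the primitive of [A_X] in [Y] is written in
   closed form.

   Analyticity of integrals, composites and inverses is obtained from one
   device: a graded family of functions in which each derivative of an element
   of weight [N] and bound [K] lies in weight [N + d] with bound [C N K]. *)

Require Import Defs.
From Stdlib Require Import Reals ZArith Lra Lia Factorial.
From Stdlib Require Import Classical ClassicalEpsilon FunctionalExtensionality.
From Coquelicot Require Import Coquelicot.
Open Scope R_scope.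

(** * Graded families and analyticity *)

(** The angle p is the right variable because the singular features of the statement disappear in
    it. The improper integrals become integrals over a bounded interval, the cube roots survive only
    through the root of q + Z q^3 = 1, which is differentiable up to Z = 0, and both boundary curves
    of the strip become the interior values p = -PI/2 and p = PI/2, where cos p = 0. The functions
    X, cos, sin, w and 1 / (1 + 3 Z w^2) have partial derivatives that are polynomials in
    themselves, and so has the inverse of the last one: implicit differentiation of K never leaves
    this algebra. The obstacle in the Prandtl equation is the nonlocal term, the primitive of A_X.
    Its closed form comes from the Lagrangian picture: the profile equation says that A decays at
    rate 1/2 along a certain vector field, and one looks for the primitive that makes this field the
    linear contraction (- a/2, - b/2). The expansions near X = 0 rest on bounds for the cubic root
    with explicit constants; those at infinity compare the rescaled density with its limit,
    uniformly in the range of integration. *)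

Lemma Rderive_const (c x : R) : is_derive (fun _ : R => c) x 0.
Proof. apply (is_derive_const (V := R_NormedModule)). Qed.

Lemma Rderive_opp (f : R -> R) (x l : R) :
  is_derive f x l -> is_derive (fun t => - f t) x (- l).
Proof. apply (is_derive_opp (V := R_NormedModule)). Qed.

Lemma Rderive_plus (f g : R -> R) (x l m : R) :
  is_derive f x l -> is_derive g x m -> is_derive (fun t => f t + g t) x (l + m).
Proof. apply (is_derive_plus (V := R_NormedModule)). Qed.

Lemma Rderive_minus (f g : R -> R) (x l m : R) :
  is_derive f x l -> is_derive g x m -> is_derive (fun t => f t - g t) x (l - m).
Proof. apply (is_derive_minus (V := R_NormedModule)). Qed.

Lemma continuous_of_derive (f : R -> R) (x l : R) : is_derive f x l -> continuous f x.
Proof. intros H; apply (ex_derive_continuous (V := R_NormedModule)); exists l; exact H. Qed.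

Definition open2 (U : R -> R -> Prop) : Prop :=
  forall x y, U x y -> exists e : posreal, forall x' y',
    Rabs (x' - x) < e -> Rabs (y' - y) < e -> U x' y'.

Definition box (x1 x2 y1 y2 x y : R) : Prop := x1 < x < x2 /\ y1 < y < y2.

Lemma open2_box x1 x2 y1 y2 : open2 (box x1 x2 y1 y2).
Proof.
  intros x y [[H1 H2] [H3 H4]].
  assert (He : 0 < Rmin (Rmin (x - x1) (x2 - x)) (Rmin (y - y1) (y2 - y))).
  { repeat apply Rmin_pos; lra. }
  exists (mkposreal _ He); simpl; intros x' y' Hx Hy.
  apply Rmin_Rgt_l in Hx; apply Rmin_Rgt_l in Hy.
  destruct Hx as [Hx _]; destruct Hy as [_ Hy].
  apply Rmin_Rgt_l in Hx; apply Rmin_Rgt_l in Hy.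
  destruct Hx as [Hx1 Hx2]; destruct Hy as [Hy1 Hy2].
  apply Rgt_lt, Rabs_def2 in Hx1; apply Rgt_lt, Rabs_def2 in Hx2.
  apply Rgt_lt, Rabs_def2 in Hy1; apply Rgt_lt, Rabs_def2 in Hy2.
  unfold box; lra.
Qed.

Definition partials (U : R -> R -> Prop) (f fx fy : R -> R -> R) : Prop :=
  forall x y, U x y ->
    is_derive (fun t => f t y) x (fx x y) /\
    is_derive (fun t => f x t) y (fy x y).

Lemma open2_locally_x U x y : open2 U -> U x y -> locally x (fun t => U t y).
Proof.
  intros HU H; destruct (HU x y H) as [e He]; exists e; intros t Ht.
  apply He; [exact Ht|]. rewrite Rminus_diag, Rabs_R0; apply cond_pos.
Qed.

Lemma open2_locally_y U x y : open2 U -> U x y -> locally y (fun t => U x t).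
Proof.
  intros HU H; destruct (HU x y H) as [e He]; exists e; intros t Ht.
  apply He; [|exact Ht]. rewrite Rminus_diag, Rabs_R0; apply cond_pos.
Qed.

Lemma partials_ext U f g fx fy :
  open2 U -> (forall x y, U x y -> f x y = g x y) ->
  partials U f fx fy -> partials U g fx fy.
Proof.
  intros HU E H x y Hxy; destruct (H x y Hxy) as [H1 H2]; split.
  - apply is_derive_ext_loc with (2 := H1).
    apply filter_imp with (2 := open2_locally_x U x y HU Hxy); auto.
  - apply is_derive_ext_loc with (2 := H2).
    apply filter_imp with (2 := open2_locally_y U x y HU Hxy); auto.
Qed.

(* A graded family [S]: [S N K f] says that [f] is bounded by [K] and has weight
   [N].  Each derivation multiplies the bound by [A * N] and adds [d] to the
   weight, so that [n] derivations cost a factor [C ^ n * n!]: this is exactly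
   analyticity.  Composites, primitives and solutions of differential systems
   are treated by exhibiting a family closed under this single rule, which
   replaces all the combinatorics of higher chain rules. *)
Definition graded := nat -> R -> (R -> R -> R) -> Prop.

(** Weights add under products because the Leibniz rule then costs exactly
    [A * INR (N1 + N2) * (K1 * K2)]. Weakening also absorbs equality on [U], so that a member counts
    only through its values there. *)
Inductive cl (U : R -> R -> Prop) (S : graded) : graded :=
| cl_gen N K f : S N K f -> cl U S N K f
| cl_const N c : cl U S N (Rabs c) (fun _ _ => c)
| cl_plus N K1 K2 f g : cl U S N K1 f -> cl U S N K2 g ->
    cl U S N (K1 + K2) (fun x y => f x y + g x y)
| cl_mult N1 N2 K1 K2 f g : cl U S N1 K1 f -> cl U S N2 K2 g ->
    cl U S (N1 + N2)%nat (K1 * K2) (fun x y => f x y * g x y)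
| cl_weaken N N' K K' f g : (N <= N')%nat -> K <= K' ->
    (forall x y, U x y -> f x y = g x y) -> cl U S N K f -> cl U S N' K' g.

Definition step (U : R -> R -> Prop) (S T : graded) (A : R) (d : nat) : Prop :=
  forall N K f, S N K f ->
    0 <= K /\ (forall x y, U x y -> Rabs (f x y) <= K) /\
    exists fx fy, partials U f fx fy /\
      T (N + d)%nat (A * INR N * K) fx /\ T (N + d)%nat (A * INR N * K) fy.

Definition valid (U : R -> R -> Prop) (S : graded) (A : R) (d : nat) : Prop :=
  0 <= A /\ step U S (cl U S) A d.

Lemma cl_mono U S S' N K f :
  (forall N K f, S N K f -> cl U S' N K f) -> cl U S N K f -> cl U S' N K f.
Proof.
  intros HS H; induction H.
  - auto.
  - apply cl_const.
  - apply cl_plus; auto.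
  - apply cl_mult; auto.
  - eapply cl_weaken; eauto.
Qed.

Lemma cl_step U S A d : open2 U -> valid U S A d ->
  step U (cl U S) (cl U S) A d.
Proof.
  intros HU [HA HS] N K f H; induction H as
    [N K f H | N c | N K1 K2 f g Hf IHf Hg IHg | N1 N2 K1 K2 f g Hf IHf Hg IHg
    | N N' K K' f g HN HK E Hf IHf].
  - exact (HS _ _ _ H).
  - split; [apply Rabs_pos|]; split; [intros; apply Rle_refl|].
    exists (fun _ _ => 0), (fun _ _ => 0); split.
    { intros x y _; split; apply Rderive_const. }
    assert (C : cl U S (N + d)%nat (A * INR N * Rabs c) (fun _ _ => 0)).
    { apply cl_weaken with (4 := cl_const U S 0 0); auto with arith.
      rewrite Rabs_R0; repeat apply Rmult_le_pos; auto using pos_INR, Rabs_pos. }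
    auto.
  - destruct IHf as (a1 & b1 & fx & fy & p1 & cx1 & cy1).
    destruct IHg as (a2 & b2 & gx & gy & p2 & cx2 & cy2).
    split; [lra|]; split.
    { intros x y Hxy; eapply Rle_trans; [apply Rabs_triang|].
      apply Rplus_le_compat; auto. }
    exists (fun x y => fx x y + gx x y), (fun x y => fy x y + gy x y); split.
    { intros x y Hxy; destruct (p1 x y Hxy), (p2 x y Hxy).
      split; apply Rderive_plus; assumption. }
    rewrite Rmult_plus_distr_l; split; apply cl_plus; assumption.
  - destruct IHf as (a1 & b1 & fx & fy & p1 & cx1 & cy1).
    destruct IHg as (a2 & b2 & gx & gy & p2 & cx2 & cy2).
    split; [apply Rmult_le_pos; assumption|]; split.
    { intros x y Hxy; rewrite Rabs_mult.
      apply Rmult_le_compat; auto using Rabs_pos. }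
    exists (fun x y => fx x y * g x y + f x y * gx x y),
      (fun x y => fy x y * g x y + f x y * gy x y); split.
    { intros x y Hxy; destruct (p1 x y Hxy) as [q1 q2], (p2 x y Hxy) as [q3 q4].
      split.
      - apply (is_derive_mult (fun t => f t y) (fun t => g t y)); auto.
        intros; apply Rmult_comm.
      - apply (is_derive_mult (f x) (g x)); auto. intros; apply Rmult_comm. }
    replace (A * INR (N1 + N2) * (K1 * K2)) with
      (A * INR N1 * K1 * K2 + K1 * (A * INR N2 * K2)) by (rewrite plus_INR; ring).
    split; apply cl_plus;
      (eapply cl_weaken with (N := (N1 + d + N2)%nat);
        [lia | apply Rle_refl | reflexivity | apply cl_mult; assumption]) ||
      (eapply cl_weaken with (N := (N1 + (N2 + d))%nat);
        [lia | apply Rle_refl | reflexivity | apply cl_mult; assumption]).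
  - destruct IHf as (a1 & b1 & fx & fy & p1 & cx1 & cy1).
    split; [lra|]; split.
    { intros x y Hxy; rewrite <- E by assumption.
      apply Rle_trans with K; auto. }
    exists fx, fy; split; [apply partials_ext with f; assumption|].
    assert (B : A * INR N * K <= A * INR N' * K').
    { apply Rmult_le_compat; auto.
      - apply Rmult_le_pos; auto using pos_INR.
      - apply Rmult_le_compat_l; [assumption|]; apply le_INR; assumption. }
    split; [apply cl_weaken with (4 := cx1) | apply cl_weaken with (4 := cy1)];
      auto with arith.
Qed.

(** Analyticity with constants uniform on [U], a bound of the function included; it is therefore
    asserted on boxes rather than on the whole plane. *)
Definition AN (U : R -> R -> Prop) (f : R -> R -> R) : Prop :=
  exists S A d N K, valid U S A d /\ cl U S N K f.

Lemma valid_mono U S A d A' d' :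
  A <= A' -> (d <= d')%nat -> valid U S A d -> valid U S A' d'.
Proof.
  intros HA Hd [H0 H]; split; [lra|]; intros N K f Hf.
  destruct (H N K f Hf) as (a & b & fx & fy & p & c1 & c2).
  split; [assumption|]; split; [assumption|]; exists fx, fy; split; [assumption|].
  split; [apply cl_weaken with (4 := c1) | apply cl_weaken with (4 := c2)];
    try lia; auto; apply Rmult_le_compat_r; auto;
    apply Rmult_le_compat_r; auto using pos_INR.
Qed.

Definition fam_or (S S' : graded) : graded := fun N K f => S N K f \/ S' N K f.

Lemma valid_or U S S' A d :
  valid U S A d -> valid U S' A d -> valid U (fam_or S S') A d.
Proof.
  intros [HA H] [_ H']; split; [assumption|]; intros N K f [Hf|Hf].
  - destruct (H N K f Hf) as (a & b & fx & fy & p & c1 & c2).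
    split; [assumption|]; split; [assumption|]; exists fx, fy; split; [assumption|].
    split; eapply cl_mono; try eassumption; intros; apply cl_gen; left; assumption.
  - destruct (H' N K f Hf) as (a & b & fx & fy & p & c1 & c2).
    split; [assumption|]; split; [assumption|]; exists fx, fy; split; [assumption|].
    split; eapply cl_mono; try eassumption; intros; apply cl_gen; right; assumption.
Qed.

Lemma AN_common U f g : AN U f -> AN U g ->
  exists S A d N K N' K', valid U S A d /\ cl U S N K f /\ cl U S N' K' g.
Proof.
  intros (S & A & d & N & K & HS & Hf) (S' & A' & d' & N' & K' & HS' & Hg).
  exists (fam_or S S'), (Rmax A A'), (max d d'), N, K, N', K'; split.
  - apply valid_or; eapply valid_mono; try eassumption;
      auto using Rmax_l, Rmax_r; lia.
  - split; eapply cl_mono; try eassumption; intros; apply cl_gen;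
      [left | right]; assumption.
Qed.

Lemma AN_const U c : AN U (fun _ _ => c).
Proof.
  exists (fun _ _ _ => False), 0, 0%nat, 0%nat, (Rabs c); split.
  - split; [lra|]; intros N K f [].
  - apply cl_const.
Qed.

Lemma AN_plus U f g : AN U f -> AN U g -> AN U (fun x y => f x y + g x y).
Proof.
  intros Hf Hg; destruct (AN_common U f g Hf Hg)
    as (S & A & d & N & K & N' & K' & HS & H1 & H2).
  exists S, A, d, (max N N'), (K + K'); split; [assumption|].
  apply cl_plus; [apply cl_weaken with (4 := H1) | apply cl_weaken with (4 := H2)];
    auto using Rle_refl with arith.
Qed.

Lemma AN_mult U f g : AN U f -> AN U g -> AN U (fun x y => f x y * g x y).
Proof.
  intros Hf Hg; destruct (AN_common U f g Hf Hg)
    as (S & A & d & N & K & N' & K' & HS & H1 & H2).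
  exists S, A, d, (N + N')%nat, (K * K'); split; [assumption|].
  apply cl_mult; assumption.
Qed.

Lemma AN_ext U f g :
  (forall x y, U x y -> f x y = g x y) -> AN U f -> AN U g.
Proof.
  intros E (S & A & d & N & K & HS & H1).
  exists S, A, d, N, K; split; [assumption|].
  apply cl_weaken with (4 := H1); auto; apply Rle_refl.
Qed.

Lemma AN_opp U f : AN U f -> AN U (fun x y => - f x y).
Proof.
  intros H; apply AN_ext with (fun x y => -1 * f x y); [intros; ring|].
  apply AN_mult; [apply AN_const | assumption].
Qed.

Lemma AN_minus U f g : AN U f -> AN U g -> AN U (fun x y => f x y - g x y).
Proof. intros; apply AN_plus; [|apply AN_opp]; assumption. Qed.

Lemma AN_pow U f n : AN U f -> AN U (fun x y => f x y ^ n).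
Proof.
  intros H; induction n as [|n IH]; [apply (AN_const U 1)|].
  apply (AN_mult U f (fun x y => f x y ^ n)); assumption.
Qed.

Lemma AN_partials U f : open2 U -> AN U f ->
  exists fx fy, partials U f fx fy /\ AN U fx /\ AN U fy.
Proof.
  intros HU (S & A & d & N & K & HS & H1).
  destruct (cl_step U S A d HU HS N K f H1) as (_ & _ & fx & fy & p & c1 & c2).
  exists fx, fy; split; [assumption|].
  split; exists S, A, d, (N + d)%nat, (A * INR N * K); auto.
Qed.

Lemma AN_bounded U f : open2 U -> AN U f ->
  exists K, 0 <= K /\ forall x y, U x y -> Rabs (f x y) <= K.
Proof.
  intros HU (S & A & d & N & K & HS & H1).
  destruct (cl_step U S A d HU HS N K f H1) as (a & b & _).
  exists K; auto.
Qed.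

Lemma AN_sub (U U' : R -> R -> Prop) f :
  (forall x y, U' x y -> U x y) -> AN U f -> AN U' f.
Proof.
  intros Hs (S & A & d & N & K & [HA HS] & H1).
  assert (M : forall N K f, cl U S N K f -> cl U' S N K f).
  { intros N' K' f' H; induction H.
    - apply cl_gen; assumption.
    - apply cl_const.
    - apply cl_plus; assumption.
    - apply cl_mult; assumption.
    - eapply cl_weaken; [eassumption | eassumption | | eassumption]; auto. }
  exists S, A, d, N, K; split; [|auto]. split; [assumption|].
  intros N' K' f' Hf; destruct (HS _ _ _ Hf) as (a & b & fx & fy & p & c1 & c2).
  split; [assumption|]; split; [auto|]; exists fx, fy; split; [|auto].
  intros x y Hxy; auto.
Qed.

Lemma Rabs_between a b c e :
  Rmin a b <= c <= Rmax a b -> Rabs (b - a) < e -> Rabs (c - a) < e.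
Proof.
  intros H1 H2. apply Rabs_def2 in H2.
  apply Rabs_def1; unfold Rmin, Rmax in H1; destruct (Rle_dec a b); lra.
Qed.

Lemma MVT_derive (f df : R -> R) a b :
  (forall t, Rmin a b <= t <= Rmax a b -> is_derive f t (df t)) ->
  exists c, Rmin a b <= c <= Rmax a b /\ f b - f a = df c * (b - a).
Proof.
  intros H; apply MVT_gen; intros t Ht.
  - apply H; lra.
  - apply derivable_continuous_pt; exists (df t); apply is_derive_Reals; auto.
Qed.

(** Bounded partial derivatives make [f] Lipschitz along each axis; an increment is split into a
    horizontal one at height [v] and a vertical one at abscissa [x]. *)
Lemma partials_continuity U f fx fy K : open2 U -> partials U f fx fy ->
  (forall x y, U x y -> Rabs (fx x y) <= K /\ Rabs (fy x y) <= K) ->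
  forall x y, U x y -> continuity_2d_pt f x y.
Proof.
  intros HU Hp Hb x y Hxy eps.
  destruct (HU x y Hxy) as [e He].
  assert (HK : 0 <= K).
  { apply Rle_trans with (1 := Rabs_pos (fx x y)); apply Hb; assumption. }
  assert (Hd : 0 < Rmin e (eps / (2 * (K + 1)))).
  { apply Rmin_pos; [apply cond_pos|]; apply Rdiv_lt_0_compat; [apply cond_pos|lra]. }
  exists (mkposreal _ Hd); simpl; intros u v Hu Hv.
  apply Rmin_Rgt_l in Hu; apply Rmin_Rgt_l in Hv.
  destruct Hu as [Hu Hu'], Hv as [Hv Hv']; unfold Rgt in *.
  destruct (MVT_derive (fun t => f t v) (fun t => fx t v) x u) as (c & Hc & E1).
  { intros t Ht; apply Hp; apply He; auto. apply Rabs_between with u; auto. }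
  destruct (MVT_derive (fun t => f x t) (fun t => fy x t) y v) as (d & Hd' & E2).
  { intros t Ht; apply Hp; apply He.
    - rewrite Rminus_diag, Rabs_R0; apply cond_pos.
    - apply Rabs_between with v; auto. }
  replace (f u v - f x y) with ((f u v - f x v) + (f x v - f x y)) by ring.
  simpl in E1, E2; rewrite E1, E2.
  eapply Rle_lt_trans; [apply Rabs_triang|]; rewrite !Rabs_mult.
  assert (B1 : Rabs (fx c v) <= K).
  { apply Hb, He; auto. apply Rabs_between with u; auto. }
  assert (B2 : Rabs (fy x d) <= K).
  { apply Hb, He; auto.
    - rewrite Rminus_diag, Rabs_R0; apply cond_pos.
    - apply Rabs_between with v; auto. }
  pose proof (Rabs_pos (u - x)); pose proof (Rabs_pos (v - y)).
  assert (E : eps / (2 * (K + 1)) * (2 * (K + 1)) = eps) by (field; lra).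
  assert (0 < eps) by apply cond_pos.
  assert (0 < eps / (2 * (K + 1))) by (apply Rdiv_lt_0_compat; lra).
  assert (Rabs (fx c v) * Rabs (u - x) <= K * (eps / (2 * (K + 1)))).
  { apply Rmult_le_compat; auto using Rabs_pos; lra. }
  assert (Rabs (fy x d) * Rabs (v - y) <= K * (eps / (2 * (K + 1)))).
  { apply Rmult_le_compat; auto using Rabs_pos; lra. }
  nra.
Qed.

Lemma AN_continuity U f : open2 U -> AN U f ->
  forall x y, U x y -> continuity_2d_pt f x y.
Proof.
  intros HU Hf; destruct (AN_partials U f HU Hf) as (fx & fy & p & Hx & Hy).
  destruct (AN_bounded U fx HU Hx) as (K1 & _ & B1).
  destruct (AN_bounded U fy HU Hy) as (K2 & _ & B2).
  apply partials_continuity with fx fy (Rmax K1 K2); auto.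
  intros x y Hxy; split;
    [eapply Rle_trans, Rmax_l | eapply Rle_trans, Rmax_r]; auto.
Qed.

Lemma partials_differentiable U f fx fy x y : open2 U -> partials U f fx fy ->
  U x y -> continuity_2d_pt fx x y ->
  differentiable_pt_lim f x y (fx x y) (fy x y).
Proof.
  intros HU Hp Hxy Hc. apply filterdiff_differentiable_pt_lim.
  apply (is_derive_filterdiff f x y fx (fy x y)).
  - destruct (HU x y Hxy) as [e He]; exists e; intros [x' y'] [H1 H2].
    apply Hp; apply He; assumption.
  - apply Hp; assumption.
  - apply continuity_2d_pt_filterlim in Hc; exact Hc.
Qed.

Lemma partials_comp U V H H1 H2 u ux uy v vx vy :
  open2 U -> open2 V -> (forall x y, U x y -> V (u x y) (v x y)) ->
  partials V H H1 H2 -> (forall x y, V x y -> continuity_2d_pt H1 x y) ->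
  partials U u ux uy -> partials U v vx vy ->
  partials U (fun x y => H (u x y) (v x y))
    (fun x y => H1 (u x y) (v x y) * ux x y + H2 (u x y) (v x y) * vx x y)
    (fun x y => H1 (u x y) (v x y) * uy x y + H2 (u x y) (v x y) * vy x y).
Proof.
  intros HU HV M HH HC Hu Hv x y Hxy.
  assert (D := partials_differentiable V H H1 H2 _ _ HV HH (M x y Hxy)
    (HC _ _ (M x y Hxy))).
  destruct (Hu x y Hxy), (Hv x y Hxy); split; apply is_derive_Reals.
  - apply (derivable_pt_lim_comp_2d H (fun t => u t y) (fun t => v t y));
      [exact D | apply is_derive_Reals; assumption ..].
  - apply (derivable_pt_lim_comp_2d H (u x) (v x));
      [exact D | apply is_derive_Reals; assumption ..].
Qed.

Definition fam_comp (V : R -> R -> Prop) (T : graded) (u v : R -> R -> R)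
    (N : nat) (K : R) (f : R -> R -> R) : Prop :=
  exists H, cl V T N K H /\ f = (fun x y => H (u x y) (v x y)).

(* The derivatives of the inner maps may themselves involve composites [H (u, v)]:
   this covers both composition and systems such as [v_x = G (x, v)]. *)
Lemma valid_comp U V S T A d B e u v ux uy vx vy N1 K1 :
  open2 U -> open2 V -> valid U S A d -> valid V T B e ->
  (forall x y, U x y -> V (u x y) (v x y)) ->
  partials U u ux uy -> partials U v vx vy ->
  (forall g, g = ux \/ g = uy \/ g = vx \/ g = vy ->
     cl U (fam_or S (fam_comp V T u v)) N1 K1 g) ->
  exists A' d', valid U (fam_or S (fam_comp V T u v)) A' d'.
Proof.
  intros HU HV HS HT M Hu Hv Hg.
  set (W := fam_or S (fam_comp V T u v)) in *.
  (* The chain rule yields two products, each of bound [B * INR N * K * K1] and weight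
     [N + e + N1]. *)
  exists (Rmax A (2 * B * K1)), (max d (e + N1)); split.
  { apply Rle_trans with A; [apply HS | apply Rmax_l]. }
  intros N K f [Hf | (H & HH & E)].
  - destruct (valid_mono U S A d (Rmax A (2 * B * K1)) (max d (e + N1)))
      as [_ HS']; auto using Rmax_l; [lia|].
    destruct (HS' N K f Hf) as (a & b & fx & fy & p & c1 & c2).
    split; [assumption|]; split; [assumption|]; exists fx, fy; split; [assumption|].
    split; eapply cl_mono; try eassumption; intros; apply cl_gen; left; assumption.
  - subst f. destruct (cl_step V T B e HV HT N K H HH)
      as (a & b & H1 & H2 & p & c1 & c2).
    split; [assumption|]; split; [intros; apply b; auto|].
    assert (HC : forall x y, V x y -> continuity_2d_pt H1 x y).
    { apply AN_continuity; [assumption|]; exists T, B, e, (N + e)%nat, (B * INR N * K).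
      auto. }
    do 2 eexists; split; [eapply partials_comp with (H := H); eassumption|].
    assert (C : forall g1 g2, cl U W N1 K1 g1 -> cl U W N1 K1 g2 ->
      cl U W (N + max d (e + N1))%nat (Rmax A (2 * B * K1) * INR N * K)
        (fun x y => H1 (u x y) (v x y) * g1 x y + H2 (u x y) (v x y) * g2 x y)).
    { intros g1 g2 C1 C2.
      apply cl_weaken with (N := (N + e + N1)%nat)
        (K := B * INR N * K * K1 + B * INR N * K * K1) (f :=
        (fun x y => H1 (u x y) (v x y) * g1 x y + H2 (u x y) (v x y) * g2 x y)).
      - lia.
      - replace (B * INR N * K * K1 + B * INR N * K * K1) with
          (2 * B * K1 * INR N * K) by ring.
        apply Rmult_le_compat_r; [assumption|].
        apply Rmult_le_compat_r; [apply pos_INR | apply Rmax_r].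
      - reflexivity.
      - apply cl_plus; apply cl_mult; try assumption; apply cl_gen; right.
        + exists H1; auto.
        + exists H2; auto. }
    split; apply C; apply Hg; auto.
Qed.

Lemma AN_comp U V H u v : open2 U -> open2 V ->
  (forall x y, U x y -> V (u x y) (v x y)) ->
  AN V H -> AN U u -> AN U v -> AN U (fun x y => H (u x y) (v x y)).
Proof.
  intros HU HV M (T & B & e & N & K & HT & HH) Hu Hv.
  destruct (AN_common U u v Hu Hv) as (S & A & d & Nu & Ku & Nv & Kv & HS & Cu & Cv).
  destruct (cl_step U S A d HU HS _ _ _ Cu) as (_ & _ & ux & uy & pu & cux & cuy).
  destruct (cl_step U S A d HU HS _ _ _ Cv) as (_ & _ & vx & vy & pv & cvx & cvy).
  destruct (valid_comp U V S T A d B e u v ux uy vx vy (max (Nu + d) (Nv + d))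
    (Rmax (A * INR Nu * Ku) (A * INR Nv * Kv))) as (A' & d' & HV'); auto.
  - intros g Hg; apply cl_mono with S; [intros; apply cl_gen; left; assumption|].
    destruct Hg as [-> | [-> | [-> | ->]]];
    [ apply cl_weaken with (4 := cux) | apply cl_weaken with (4 := cuy)
    | apply cl_weaken with (4 := cvx) | apply cl_weaken with (4 := cvy)];
    auto using Rmax_l, Rmax_r; lia.
  - eexists; exists A', d', N, K; split; [exact HV'|].
    apply cl_gen; right; exists H; auto.
Qed.

(** Nothing is known of [v] beyond its differential system. Differentiating [H x (v x y)] gives a
    polynomial in functions of the same shape, so these composites form a family closed under the
    rule, and the regularity of [v] follows from that of [G] and [F]. *)
Lemma AN_flow U V G F v : open2 U -> open2 V ->
  (forall x y, U x y -> V x (v x y)) -> AN V G -> AN V F ->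
  partials U v (fun x y => G x (v x y)) (fun x y => F x (v x y)) ->
  forall H, AN V H -> AN U (fun x y => H x (v x y)).
Proof.
  intros HU HV M HG HF Hv H HH.
  assert (Com : exists T B e N K N' K', valid V T B e /\ cl V T N K H /\
    cl V T N' K' G /\ cl V T N' K' F).
  { destruct HH as (T & B & e & N & K & HT & HH).
    destruct (AN_common V G F HG HF) as (S & A & d & Nu & Ku & Nv & Kv & HS & Cu & Cv).
    exists (fam_or S T), (Rmax A B), (max d e), N, K, (max Nu Nv), (Rmax Ku Kv).
    split; [|split; [|split]].
    - apply valid_or; eapply valid_mono; try eassumption;
        auto using Rmax_l, Rmax_r; lia.
    - eapply cl_mono; try eassumption; intros; apply cl_gen; right; assumption.
    - apply cl_weaken with (N := Nu) (K := Ku) (f := G); auto using Rmax_l; [lia|].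
      eapply cl_mono; try eassumption; intros; apply cl_gen; left; assumption.
    - apply cl_weaken with (N := Nv) (K := Kv) (f := F); auto using Rmax_r; [lia|].
      eapply cl_mono; try eassumption; intros; apply cl_gen; left; assumption. }
  destruct Com as (T & B & e & N & K & N' & K' & HT & CH & CG & CF).
  destruct (valid_comp U V (fun _ _ _ => False) T 0 0%nat B e (fun x _ => x) v
    (fun _ _ => 1) (fun _ _ => 0) (fun x y => G x (v x y)) (fun x y => F x (v x y))
    N' (Rmax 1 K')) as (A' & d' & HV'); auto.
  - split; [lra|]; intros ? ? ? [].
  - intros x y _; split.
    + apply (is_derive_id (K := R_AbsRing)).
    + apply Rderive_const.
  - assert (C : forall J, cl V T N' K' J ->
      cl U (fam_or (fun _ _ _ => False) (fam_comp V T (fun x _ => x) v)) N' (Rmax 1 K')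
        (fun x y => J x (v x y))).
    { intros J HJ; apply cl_weaken with (N := N') (K := K') (f := fun x y => J x (v x y));
        auto using Rmax_r.
      apply cl_gen; right; exists J; auto. }
    intros g [-> | [-> | [-> | ->]]]; [ | | apply C; assumption ..].
    + apply cl_weaken with (4 := cl_const _ _ 0%nat 1); auto with arith.
      rewrite Rabs_R1; apply Rmax_l.
    + apply cl_weaken with (4 := cl_const _ _ 0%nat 0); auto with arith.
      rewrite Rabs_R0; apply Rle_trans with 1; [lra | apply Rmax_l].
  - eexists; exists A', d', N, K; split; [exact HV'|].
    apply cl_gen; right; exists H; auto.
Qed.

(** * Finitely generated algebras stable under differentiation *)

Inductive gen_alg (U : R -> R -> Prop) (l : list (R -> R -> R)) :
    (R -> R -> R) -> Prop :=
| ga_in f : List.In f l -> gen_alg U l f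
| ga_const c : gen_alg U l (fun _ _ => c)
| ga_plus f g : gen_alg U l f -> gen_alg U l g ->
    gen_alg U l (fun x y => f x y + g x y)
| ga_mult f g : gen_alg U l f -> gen_alg U l g ->
    gen_alg U l (fun x y => f x y * g x y)
| ga_ext f g : (forall x y, U x y -> f x y = g x y) -> gen_alg U l f ->
    gen_alg U l g.

Lemma ga_opp U l f : gen_alg U l f -> gen_alg U l (fun x y => - f x y).
Proof.
  intros H; apply ga_ext with (fun x y => -1 * f x y); [intros; ring|].
  apply ga_mult; [apply ga_const | assumption].
Qed.

Lemma ga_minus U l f g : gen_alg U l f -> gen_alg U l g ->
  gen_alg U l (fun x y => f x y - g x y).
Proof. intros; apply ga_plus; [|apply ga_opp]; assumption. Qed.

Lemma ga_pow U l f n : gen_alg U l f -> gen_alg U l (fun x y => f x y ^ n).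
Proof.
  intros H; induction n as [|n IH]; [apply (ga_const U l 1)|].
  apply (ga_mult U l f (fun x y => f x y ^ n)); assumption.
Qed.

(** Generators have weight one because weight zero would bound their derivatives by zero. *)
Definition fam_list (K0 : R) (l : list (R -> R -> R))
    (N : nat) (K : R) (f : R -> R -> R) : Prop :=
  N = 1%nat /\ K = K0 /\ List.In f l.

Lemma gen_alg_cl U l K0 f : gen_alg U l f ->
  exists N K, 0 <= K /\ cl U (fam_list K0 l) N K f.
Proof.
  intros H; induction H as [f Hf | c | f g Hf (N1 & K1 & P1 & C1) Hg (N2 & K2 & P2 & C2)
    | f g Hf (N1 & K1 & P1 & C1) Hg (N2 & K2 & P2 & C2)
    | f g E Hf (N & K & P & C)].
  - exists 1%nat, (Rmax 0 K0); split; [apply Rmax_l|].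
    apply cl_weaken with 1%nat K0 f; auto using Rmax_r.
    apply cl_gen; repeat split; assumption.
  - exists 0%nat, (Rabs c); split; [apply Rabs_pos | apply cl_const].
  - exists (max N1 N2), (K1 + K2); split; [lra|].
    apply cl_plus; [apply cl_weaken with (4 := C1) | apply cl_weaken with (4 := C2)];
      auto using Rle_refl with arith.
  - exists (N1 + N2)%nat, (K1 * K2); split; [apply Rmult_le_pos; assumption|].
    apply cl_mult; assumption.
  - exists N, K; split; [assumption|].
    apply cl_weaken with (4 := C); auto using Rle_refl.
Qed.

(** Bounded functions whose partial derivatives are polynomials in the functions themselves solve a
    polynomial differential system. All derivatives stay in one algebra, and finitely many
    generators allow a single bound and a single rate. *)
Lemma AN_system U l :
  (forall f, List.In f l -> exists K, forall x y, U x y -> Rabs (f x y) <= K) ->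
  (forall f, List.In f l -> exists fx fy,
     partials U f fx fy /\ gen_alg U l fx /\ gen_alg U l fy) ->
  forall f, gen_alg U l f -> AN U f.
Proof.
  intros HB HD.
  (* A common bound of at least one makes the allowed [A * INR 1 * K0] dominate the bound [A] of the
     derivatives of the generators. *)
  assert (B : exists K0, 1 <= K0 /\
    forall f, List.In f l -> forall x y, U x y -> Rabs (f x y) <= K0).
  { clear HD; induction l as [|g l IH].
    - exists 1; split; [lra|]; intros f [].
    - destruct IH as (K0 & H1 & H2); [intros f Hf; apply HB; right; assumption|].
      destruct (HB g) as (K & HK); [left; reflexivity|].
      exists (Rmax K0 K); split; [eapply Rle_trans, Rmax_l; assumption|].
      intros f [<-|Hf] x y Hxy;
        [eapply Rle_trans, Rmax_r | eapply Rle_trans, Rmax_l]; auto. }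
  destruct B as (K0 & HK0 & B).
  assert (D : exists A d, 0 <= A /\ forall f, List.In f l -> exists fx fy,
     partials U f fx fy /\ cl U (fam_list K0 l) d A fx /\ cl U (fam_list K0 l) d A fy).
  { assert (Q : forall l', (forall f, List.In f l' -> List.In f l) ->
      exists A d, 0 <= A /\ forall f, List.In f l' -> exists fx fy,
      partials U f fx fy /\ cl U (fam_list K0 l) d A fx /\
      cl U (fam_list K0 l) d A fy).
    { induction l' as [|g l' IH]; intros Hl.
      - exists 0, 0%nat; split; [lra|]; intros f [].
      - destruct IH as (A & d & HA & H).
        { intros f Hf; apply Hl; right; assumption. }
        destruct (HD g) as (gx & gy & p & cx & cy); [apply Hl; left; reflexivity|].
        destruct (gen_alg_cl U l K0 gx cx) as (N1 & K1 & P1 & C1).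
        destruct (gen_alg_cl U l K0 gy cy) as (N2 & K2 & P2 & C2).
        exists (A + K1 + K2), (d + N1 + N2)%nat; split; [lra|].
        intros f [<-|Hf].
        + exists gx, gy; split; [assumption|]; split;
            [apply cl_weaken with (4 := C1) | apply cl_weaken with (4 := C2)];
            auto; try lia; lra.
        + destruct (H f Hf) as (fx & fy & q & c1 & c2).
          exists fx, fy; split; [assumption|]; split;
            [apply cl_weaken with (4 := c1) | apply cl_weaken with (4 := c2)];
            auto; try lia; lra. }
    apply Q; auto. }
  destruct D as (A & d & HA & D).
  intros f Hf; destruct (gen_alg_cl U l K0 f Hf) as (N & K & _ & C).
  exists (fam_list K0 l), A, d, N, K; split; [|assumption].
  split; [assumption|]; intros N' K' f' (-> & -> & Hf').
  split; [lra|]; split; [apply B; assumption|].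
  destruct (D f' Hf') as (fx & fy & p & c1 & c2).
  exists fx, fy; split; [assumption|]; simpl INR.
  split; [apply cl_weaken with (4 := c1) | apply cl_weaken with (4 := c2)];
    auto; try lia; nra.
Qed.

Ltac ga := match goal with
  | |- gen_alg _ _ (fun _ _ => ?c) => apply ga_const
  | |- gen_alg _ _ (fun x y => @?f x y + @?g x y) => apply (ga_plus _ _ f g); ga
  | |- gen_alg _ _ (fun x y => @?f x y * @?g x y) => apply (ga_mult _ _ f g); ga
  | |- gen_alg _ _ (fun x y => @?f x y - @?g x y) => apply (ga_minus _ _ f g); ga
  | |- gen_alg _ _ (fun x y => - @?f x y) => apply (ga_opp _ _ f); ga
  | |- gen_alg _ _ (fun x y => @?f x y ^ ?n) => apply (ga_pow _ _ f n); ga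
  | |- gen_alg _ _ _ => apply ga_in; simpl; tauto
  end.

Lemma AN_coordinates x1 x2 y1 y2 f :
  gen_alg (box x1 x2 y1 y2) (cons (fun x _ => x) (cons (fun _ y => y) nil)) f ->
  AN (box x1 x2 y1 y2) f.
Proof.
  apply AN_system; intros g [<- | [<- | []]].
  - exists (Rmax (Rabs x1) (Rabs x2)); intros x y [H _]; apply RmaxAbs; lra.
  - exists (Rmax (Rabs y1) (Rabs y2)); intros x y [_ H]; apply RmaxAbs; lra.
  - exists (fun _ _ => 1), (fun _ _ => 0); split; [|split; ga].
    intros x y _; split; auto_derive; trivial.
  - exists (fun _ _ => 0), (fun _ _ => 1); split; [|split; ga].
    intros x y _; split; auto_derive; trivial.
Qed.

Lemma AN_fst x1 x2 y1 y2 : AN (box x1 x2 y1 y2) (fun x _ => x).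
Proof. apply AN_coordinates; ga. Qed.

Lemma AN_snd x1 x2 y1 y2 : AN (box x1 x2 y1 y2) (fun _ y => y).
Proof. apply AN_coordinates; ga. Qed.

Ltac an := match goal with
  | H : AN ?U ?f |- AN ?U ?f => exact H
  | |- AN _ (fun _ _ => ?c) => apply AN_const
  | |- AN _ (fun x _ => x) => apply AN_fst
  | |- AN _ (fun _ y => y) => apply AN_snd
  | |- AN _ (fun x y => @?f x y + @?g x y) => apply (AN_plus _ f g); an
  | |- AN _ (fun x y => @?f x y * @?g x y) => apply (AN_mult _ f g); an
  | |- AN _ (fun x y => @?f x y - @?g x y) => apply (AN_minus _ f g); an
  | |- AN _ (fun x y => - @?f x y) => apply (AN_opp _ f); an
  | |- AN _ (fun x y => @?f x y ^ ?n) => apply (AN_pow _ f n); an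
  | |- AN _ _ => idtac
  end.

Ltac req := match goal with |- @eq _ ?a ?b => change (@eq R a b) end.

(** * Integrals depending on a parameter *)

Lemma continuity_2d_snd f x y :
  continuity_2d_pt f x y -> continuous (fun t => f x t) y.
Proof.
  intros H; apply continuity_pt_filterlim; intros eps Heps.
  destruct (H (mkposreal eps Heps)) as [d Hd]; exists d; split; [apply cond_pos|].
  intros t [_ Ht]; apply Hd; [rewrite Rminus_diag, Rabs_R0; apply cond_pos | exact Ht].
Qed.

Lemma box_segment x1 x2 y1 y2 x a b t :
  box x1 x2 y1 y2 x a -> box x1 x2 y1 y2 x b -> Rmin a b <= t <= Rmax a b ->
  box x1 x2 y1 y2 x t.
Proof.
  intros [H1 H2] [_ H3] H4; split; [assumption|].
  unfold Rmin, Rmax in H4; destruct (Rle_dec a b); lra.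
Qed.

Lemma box_ex_RInt x1 x2 y1 y2 f x a b :
  (forall x y, box x1 x2 y1 y2 x y -> continuity_2d_pt f x y) ->
  box x1 x2 y1 y2 x a -> box x1 x2 y1 y2 x b -> ex_RInt (fun t => f x t) a b.
Proof.
  intros Hc Ha Hb; apply (ex_RInt_continuous (V := R_CompleteNormedModule)).
  intros t Ht; apply continuity_2d_snd, Hc; apply (box_segment x1 x2 y1 y2 x a b); assumption.
Qed.

Lemma partials_RInt x1 x2 y1 y2 c f fx fy :
  y1 < c < y2 -> partials (box x1 x2 y1 y2) f fx fy ->
  (forall x y, box x1 x2 y1 y2 x y -> continuity_2d_pt f x y) ->
  (forall x y, box x1 x2 y1 y2 x y -> continuity_2d_pt fx x y) ->
  partials (box x1 x2 y1 y2) (fun x y => RInt (fun t => f x t) c y)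
    (fun x y => RInt (fun t => fx x t) c y) f.
Proof.
  intros Hc Hp Cf Cx x y Hxy.
  set (U := box x1 x2 y1 y2) in *.
  assert (HU : open2 U) by apply open2_box.
  assert (Uc : forall x y, U x y -> U x c) by (intros ? ? [? ?]; split; lra).
  assert (Useg : forall x y t, U x y -> Rmin c y <= t <= Rmax c y -> U x t).
  { intros x' y' t H1 H2; apply (box_segment x1 x2 y1 y2 x' c y'); auto.
    apply (Uc x' y' H1). }
  assert (Uint : forall x y, U x y -> ex_RInt (fun t => f x t) c y).
  { intros x' y' H; apply (box_ex_RInt x1 x2 y1 y2); auto. apply (Uc x' y' H). }
  split.
  - assert (E : RInt (fun t => fx x t) c y = RInt (fun t => Derive (fun u => f u t) x) c y).
    { apply RInt_ext; intros t Ht; symmetry; apply is_derive_unique.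
      apply Hp, (Useg x y); [assumption | lra]. }
    rewrite E. apply (is_derive_RInt_param f c y x).
    + apply filter_imp with (2 := open2_locally_x U x y HU Hxy).
      intros x' Hx' t Ht; exists (fx x' t); apply Hp, (Useg x' y); assumption.
    + intros t Ht.
      assert (Hxt : U x t) by (apply (Useg x y); assumption).
      apply continuity_2d_pt_ext_loc with (2 := Cx x t Hxt).
      destruct (HU x t Hxt) as [e He]; exists e; intros u v Hu Hv.
      symmetry; apply is_derive_unique, Hp, He; assumption.
    + apply filter_imp with (2 := open2_locally_x U x y HU Hxy).
      intros x' Hx'; apply Uint; assumption.
  - apply (is_derive_RInt (V := R_NormedModule) (fun t => f x t) _ c).
    + apply filter_imp with (2 := open2_locally_y U x y HU Hxy).
      intros y' Hy'; apply (RInt_correct (V := R_CompleteNormedModule)).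
      apply Uint; assumption.
    + apply continuity_2d_snd, Cf, Hxy.
Qed.

Lemma abs_RInt_box x1 x2 y1 y2 c f K x y :
  y1 < c < y2 -> 0 <= K ->
  (forall x y, box x1 x2 y1 y2 x y -> continuity_2d_pt f x y) ->
  (forall x y, box x1 x2 y1 y2 x y -> Rabs (f x y) <= K) ->
  box x1 x2 y1 y2 x y -> Rabs (RInt (fun t => f x t) c y) <= (y2 - y1) * K.
Proof.
  intros Hc HK Cf B Hxy.
  assert (Uc : box x1 x2 y1 y2 x c) by (destruct Hxy; split; lra).
  apply Rle_trans with (Rabs (y - c) * K).
  - apply (norm_RInt_le_const_abs (fun t => f x t) c y).
    + intros t Ht; apply B, (box_segment x1 x2 y1 y2 x c y); assumption.
    + apply (RInt_correct (V := R_CompleteNormedModule)); apply (box_ex_RInt x1 x2 y1 y2); assumption.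
  - apply Rmult_le_compat_r; [assumption|].
    apply Rabs_le; destruct Hxy; lra.
Qed.

(** The family is enlarged by all primitives of its members. Differentiation in [x] goes under the
    integral, differentiation in [y] gives back the integrand. The second case dictates the
    bookkeeping: a primitive carries one extra unit of weight, so that its weight is never zero, and
    the rate is at least [/ L] to undo the factor [L] in its bound. *)
Lemma AN_RInt x1 x2 y1 y2 c f : y1 < c < y2 -> AN (box x1 x2 y1 y2) f ->
  AN (box x1 x2 y1 y2) (fun x y => RInt (fun t => f x t) c y).
Proof.
  intros Hc (S & A & d & N & K & HS & Hf).
  set (U := box x1 x2 y1 y2) in *; set (L := y2 - y1).
  assert (HU : open2 U) by apply open2_box.
  assert (HL : 0 < L) by (unfold L; lra).
  set (W := fam_or S (fun N K f => exists g M J, cl U S M J g /\ N = (M + 1)%nat /\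
    K = L * J /\ f = fun x y => RInt (fun t => g x t) c y)).
  assert (CC : forall N K g, cl U S N K g -> forall x y, U x y -> continuity_2d_pt g x y).
  { intros N' K' g Hg; apply AN_continuity; [assumption|].
    exists S, A, d, N', K'; auto. }
  exists W, (Rmax A (/ L)), d, (N + 1)%nat, (L * K); split.
  2: { apply cl_gen; right; exists f, N, K; auto. }
  split; [apply Rle_trans with A; [apply HS | apply Rmax_l]|].
  intros N' K' f' [Hf' | (g & M & J & Hg & -> & -> & ->)].
  - destruct (valid_mono U S A d (Rmax A (/ L)) d) as [_ HS']; auto using Rmax_l.
    destruct (HS' N' K' f' Hf') as (a & b & fx & fy & p & c1 & c2).
    split; [assumption|]; split; [assumption|]; exists fx, fy; split; [assumption|].
    split; eapply cl_mono; try eassumption; intros; apply cl_gen; left; assumption.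
  - destruct (cl_step U S A d HU HS M J g Hg) as (a & b & gx & gy & p & c1 & c2).
    split; [apply Rmult_le_pos; lra|].
    split.
    { intros x y Hxy; apply (abs_RInt_box x1 x2); auto; apply (CC M J g Hg). }
    exists (fun x y => RInt (fun t => gx x t) c y), g; split.
    { apply partials_RInt with gy; auto; [apply (CC M J g Hg) | apply (CC _ _ _ c1)]. }
    assert (P1 : 0 <= L * J) by (apply Rmult_le_pos; lra).
    assert (P2 := pos_INR M).
    split.
    + apply cl_weaken with (N := (M + d + 1)%nat) (K := L * (A * INR M * J))
        (f := fun x y => RInt (fun t => gx x t) c y); [lia | | reflexivity |].
      * replace (L * (A * INR M * J)) with (A * INR M * (L * J)) by ring.
        apply Rmult_le_compat_r; [assumption|].
        apply Rmult_le_compat; [apply HS | apply P2 | apply Rmax_l |].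
        apply le_INR; lia.
      * apply cl_gen; right. exists gx, (M + d)%nat, (A * INR M * J); auto.
    + apply cl_weaken with (N := M) (K := J) (f := g); [lia | | reflexivity |].
      * rewrite plus_INR; simpl INR.
        apply Rle_trans with (/ L * (0 + 1) * (L * J)).
        { apply Req_le; field; lra. }
        apply Rmult_le_compat_r; [assumption|].
        apply Rmult_le_compat; try lra; [|apply Rmax_r].
        left; apply Rinv_0_lt_compat; assumption.
      * eapply cl_mono; try eassumption; intros; apply cl_gen; left; assumption.
Qed.

Lemma is_derive_div_const (f : R -> R) (c x l : R) :
  is_derive f x l -> is_derive (fun t => f t / c) x (l / c).
Proof.
  intros H; apply is_derive_ext with (fun t => / c * f t).
  { intros t; req; unfold Rdiv; ring. }
  replace (l / c) with (/ c * l) by (unfold Rdiv; ring).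
  apply is_derive_scal; assumption.
Qed.

(** * From factorial bounds to power series *)

(** The Taylor polynomial of order n is regarded as a function [T n] of its centre t, with x fixed.
    Its derivative telescopes to one term and its value at t = x is [g 0 x], so the mean value
    theorem gives the Cauchy remainder. That remainder carries a factor n + 1, bounded by 2^(n+1)
    and paid for by the ratio 1/4. *)
Lemma taylor_abs (g : nat -> R -> R) x0 rho C R0 :
  0 <= C -> 0 < R0 ->
  (forall n t, Rabs (t - x0) < rho -> is_derive (g n) t (g (S n) t)) ->
  (forall n t, Rabs (t - x0) < rho -> Rabs (g n t) <= C * R0 ^ n * INR (fact n)) ->
  forall x, Rabs (x - x0) < rho -> R0 * Rabs (x - x0) <= / 4 ->
  is_series (fun n => g n x0 / INR (fact n) * (x - x0) ^ n) (g 0%nat x).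
Proof.
  intros HC HR Hd Hb x Hx Hs.
  set (T := fun n t => sum_n (fun k => g k t / INR (fact k) * (x - t) ^ k) n).
  assert (DT : forall n t, Rabs (t - x0) < rho ->
    is_derive (T n) t (g (S n) t / INR (fact n) * (x - t) ^ n)).
  { intros n t Ht; induction n as [|n IH].
    - unfold T. apply is_derive_ext with (fun t => g 0%nat t / INR (fact 0) * (x - t) ^ 0).
      { intros u; rewrite sum_O; reflexivity. }
      simpl. apply is_derive_ext with (g 0%nat); [intros; req; field|].
      replace (g 1%nat t / 1 * 1) with (g 1%nat t) by field; apply Hd; assumption.
    - apply is_derive_ext with (fun t => T n t + g (S n) t / INR (fact (S n)) * (x - t) ^ (S n)).
      { intros u; unfold T; rewrite sum_Sn; reflexivity. }
      assert (F : INR (fact (S n)) = INR (S n) * INR (fact n)).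
      { rewrite <- mult_INR; f_equal. }
      assert (F1 : INR (fact n) <> 0) by apply INR_fact_neq_0.
      assert (F2 : INR (S n) <> 0) by (apply not_0_INR; lia).
      replace (g (S (S n)) t / INR (fact (S n)) * (x - t) ^ S n) with
        (g (S n) t / INR (fact n) * (x - t) ^ n +
         (g (S (S n)) t / INR (fact (S n)) * (x - t) ^ S n +
          g (S n) t / INR (fact (S n)) * (INR (S n) * (-1) * (x - t) ^ n))).
      2: { rewrite F; field; split; assumption. }
      apply Rderive_plus; [exact IH|].
      apply (is_derive_mult (fun t => g (S n) t / INR (fact (S n))) (fun t => (x - t) ^ S n)).
      + apply is_derive_div_const, Hd; assumption.
      + replace (INR (S n) * -1 * (x - t) ^ n) with (INR (S n) * (-1) * (x - t) ^ (pred (S n))) by reflexivity.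
        apply is_derive_pow.
        auto_derive; [trivial | ring].
      + intros; apply Rmult_comm. }
  assert (B : forall n, Rabs (T n x0 - g 0%nat x) <= C * (/ 2) ^ (S n)).
  { intros n.
    destruct (MVT_derive (T n) (fun t => g (S n) t / INR (fact n) * (x - t) ^ n)
      x0 x) as (c & Hc & E).
    { intros t Ht; apply DT. apply Rabs_between with x; assumption. }
    assert (Ex : T n x = g 0%nat x).
    { unfold T; clear; induction n as [|n IH]; [rewrite sum_O; simpl; field|].
      rewrite sum_Sn, IH, Rminus_diag; unfold plus; simpl; ring. }
    rewrite Ex in E; rewrite Rabs_minus_sym, E, !Rabs_mult.
    assert (Hc' : Rabs (c - x0) < rho) by (apply Rabs_between with x; assumption).
    assert (F0 : 0 < INR (fact n)) by apply INR_fact_lt_0.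
    assert (B1 : Rabs (g (S n) c / INR (fact n)) <= C * R0 ^ S n * INR (S n)).
    { unfold Rdiv; rewrite Rabs_mult, (Rabs_pos_eq (/ _)).
      2: { left; apply Rinv_0_lt_compat; assumption. }
      apply Rmult_le_reg_r with (INR (fact n)); [assumption|].
      rewrite Rmult_assoc, Rinv_l, Rmult_1_r by lra.
      eapply Rle_trans; [apply Hb; assumption|].
      apply Req_le; change (fact (S n)) with (S n * fact n)%nat; rewrite mult_INR; ring. }
    assert (B2 : Rabs ((x - c) ^ n) <= Rabs (x - x0) ^ n).
    { rewrite <- RPow_abs; apply pow_incr; split; [apply Rabs_pos|].
      unfold Rmin, Rmax in Hc; destruct (Rle_dec x0 x);
        unfold Rabs; repeat destruct Rcase_abs; lra. }
    assert (B3 : INR (S n) <= 2 ^ S n).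
    { clear; induction n as [|n IH]; [simpl; lra|].
      rewrite S_INR; change (2 ^ S (S n)) with (2 * 2 ^ S n).
      assert (1 <= 2 ^ S n) by (apply pow_R1_Rle; lra). lra. }
    assert (B4 : (R0 * Rabs (x - x0)) ^ S n <= (/ 4) ^ S n).
    { apply pow_incr; split; [apply Rmult_le_pos; [lra | apply Rabs_pos] | assumption]. }
    apply Rle_trans with (C * R0 ^ S n * INR (S n) * Rabs (x - x0) ^ n * Rabs (x - x0)).
    { apply Rmult_le_compat_r; [apply Rabs_pos|].
      apply Rmult_le_compat; auto using Rabs_pos. }
    replace (C * R0 ^ S n * INR (S n) * Rabs (x - x0) ^ n * Rabs (x - x0)) with
      (C * ((R0 * Rabs (x - x0)) ^ S n * INR (S n))).
    2: { rewrite Rpow_mult_distr; simpl; ring. }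
    apply Rmult_le_compat_l; [assumption|].
    replace ((/ 2) ^ S n) with ((/ 4) ^ S n * 2 ^ S n).
    2: { rewrite <- Rpow_mult_distr; f_equal; field. }
    apply Rmult_le_compat; auto using pos_INR.
    apply pow_le, Rmult_le_pos; [lra | apply Rabs_pos]. }
  assert (Lim : is_lim_seq (fun n => C * (/ 2) ^ S n) 0).
  { apply is_lim_seq_ext with (fun n => C * / 2 * (/ 2) ^ n); [intros; simpl; ring|].
    replace (Finite 0) with (Rbar_mult (C * / 2) 0) by (simpl; f_equal; ring).
    apply is_lim_seq_scal_l, is_lim_seq_geom. rewrite Rabs_pos_eq; lra. }
  change (is_lim_seq (fun n => T n x0) (g 0%nat x)).
  apply is_lim_seq_ext with (fun n => g 0%nat x + (T n x0 - g 0%nat x)).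
  { intros; simpl; ring. }
  replace (Finite (g 0%nat x)) with (Finite (g 0%nat x + 0)) by (f_equal; ring).
  apply is_lim_seq_plus'; [apply is_lim_seq_const|].
  apply is_lim_seq_abs_0.
  apply is_lim_seq_le_le with (fun _ => 0) (fun n => C * (/ 2) ^ S n);
    auto using is_lim_seq_const.
  intros n; split; [apply Rabs_pos | apply B].
Qed.

Definition DX (f : R -> R -> R) : R -> R -> R := fun x y => Derive (fun t => f t y) x.
Definition DY (f : R -> R -> R) : R -> R -> R := fun x y => Derive (fun t => f x t) y.

Lemma cl_DX_DY U S A d N K f : open2 U -> valid U S A d -> cl U S N K f ->
  partials U f (DX f) (DY f) /\
  cl U S (N + d)%nat (A * INR N * K) (DX f) /\
  cl U S (N + d)%nat (A * INR N * K) (DY f).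
Proof.
  intros HU HS Hf; destruct (cl_step U S A d HU HS N K f Hf)
    as (_ & _ & fx & fy & p & c1 & c2).
  assert (E1 : forall x y, U x y -> fx x y = DX f x y).
  { intros x y Hxy; symmetry; apply is_derive_unique, p, Hxy. }
  assert (E2 : forall x y, U x y -> fy x y = DY f x y).
  { intros x y Hxy; symmetry; apply is_derive_unique, p, Hxy. }
  split; [|split].
  - intros x y Hxy; rewrite <- E1, <- E2 by assumption; apply p, Hxy.
  - apply cl_weaken with (4 := c1); auto using Rle_refl.
  - apply cl_weaken with (4 := c2); auto using Rle_refl.
Qed.

Definition mixed (f : R -> R -> R) (i j : nat) : R -> R -> R :=
  Nat.iter j DY (Nat.iter i DX f).

Lemma AN_mixed U f : open2 U -> AN U f -> exists C R0, 0 <= C /\ 0 < R0 /\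
  (forall i j, AN U (mixed f i j)) /\
  (forall i j x y, U x y ->
     Rabs (mixed f i j x y) <= C * R0 ^ (i + j) * INR (fact (i + j))) /\
  (forall i x y, U x y -> is_derive (fun t => mixed f i 0 t y) x (mixed f (S i) 0 x y)) /\
  (forall i j x y, U x y -> is_derive (fun t => mixed f i j x t) y (mixed f i (S j) x y)).
Proof.
  intros HU (S0 & A & d & N & K & HS & Hf).
  (* Comes from N + n d <= (N + d) (n + 1), the weight after n derivations; the added 1 keeps [R0]
     positive. *)
  set (R0 := A * INR (N + d) + 1).
  assert (HA : 0 <= A) by apply HS.
  assert (HK : 0 <= K) by apply (cl_step U S0 A d HU HS N K f Hf).
  assert (HR : 0 < R0).
  { unfold R0; assert (0 <= A * INR (N + d)) by (apply Rmult_le_pos; auto using pos_INR). lra. }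
  assert (G : forall n g, cl U S0 (N + n * d)%nat (K * R0 ^ n * INR (fact n)) g ->
    partials U g (DX g) (DY g) /\
    cl U S0 (N + (S n) * d)%nat (K * R0 ^ (S n) * INR (fact (S n))) (DX g) /\
    cl U S0 (N + (S n) * d)%nat (K * R0 ^ (S n) * INR (fact (S n))) (DY g)).
  { intros n g Hg; destruct (cl_DX_DY U S0 A d _ _ g HU HS Hg) as (p & c1 & c2).
    split; [assumption|].
    assert (B : A * INR (N + n * d) * (K * R0 ^ n * INR (fact n)) <=
      K * R0 ^ S n * INR (fact (S n))).
    { change (fact (S n)) with (S n * fact n)%nat; rewrite mult_INR.
      replace (K * R0 ^ S n * (INR (S n) * INR (fact n))) with
        (R0 * INR (S n) * (K * R0 ^ n * INR (fact n))) by (simpl pow; ring).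
      apply Rmult_le_compat_r.
      { repeat apply Rmult_le_pos; auto using pos_INR, pow_le, Rlt_le. }
      apply Rle_trans with (A * INR (N + d) * INR (S n)).
      - rewrite Rmult_assoc; apply Rmult_le_compat_l; [assumption|].
        rewrite <- mult_INR; apply le_INR; nia.
      - apply Rmult_le_compat_r; [apply pos_INR|]. unfold R0; lra. }
    split; [apply cl_weaken with (4 := c1) | apply cl_weaken with (4 := c2)];
      auto; lia. }
  assert (M1 : forall i, cl U S0 (N + i * d)%nat (K * R0 ^ i * INR (fact i)) (Nat.iter i DX f)).
  { induction i as [|i IH].
    - apply cl_weaken with (4 := Hf); auto; [lia|]. simpl; lra.
    - apply (G i (Nat.iter i DX f) IH). }
  assert (M2 : forall i j, cl U S0 (N + (i + j) * d)%nat
    (K * R0 ^ (i + j) * INR (fact (i + j))) (mixed f i j)).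
  { intros i; induction j as [|j IH].
    - rewrite Nat.add_0_r; apply M1.
    - rewrite Nat.add_succ_r; apply (G (i + j)%nat (mixed f i j) IH). }
  exists K, R0; split; [assumption|]; split; [assumption|]; split; [|split; [|split]].
  - intros i j; do 5 eexists; split; [exact HS | apply M2].
  - intros i j; apply (cl_step U S0 A d HU HS _ _ _ (M2 i j)).
  - intros i x y Hxy. destruct (G i (mixed f i 0)) as (p & _ & _).
    { rewrite <- (Nat.add_0_r i) at 1 2 3; apply M2. }
    apply (proj1 (p x y Hxy)).
  - intros i j x y Hxy; destruct (G (i + j)%nat (mixed f i j) (M2 i j)) as (p & _ & _).
    apply (proj2 (p x y Hxy)).
Qed.

(** The binomial coefficient of i + j over i is at most 2^(i+j), by Pascal's rule multiplied out. *)
Lemma fact_add_le i j :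
  INR (fact (i + j)) <= 2 ^ (i + j) * INR (fact i) * INR (fact j).
Proof.
  assert (F : forall n, INR (fact (S n)) = INR (S n) * INR (fact n)).
  { intros n; rewrite <- mult_INR; reflexivity. }
  remember (i + j)%nat as n eqn:E; revert i j E.
  induction n as [|n IH]; intros i j E.
  - assert (i = 0%nat) as -> by lia; assert (j = 0%nat) as -> by lia; simpl; lra.
  - assert (P : forall k, 0 < INR (fact k)) by apply INR_fact_lt_0.
    assert (P2 : 0 < 2 ^ n) by (apply pow_lt; lra).
    destruct i as [|i].
    { replace (S n) with j by lia. simpl INR.
      assert (1 <= 2 ^ j) by (apply pow_R1_Rle; lra).
      specialize (P j); nra. }
    destruct j as [|j].
    { replace (S n) with (S i) by lia. change (INR (fact 0)) with 1.
      assert (1 <= 2 ^ S i) by (apply pow_R1_Rle; lra).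
      specialize (P (S i)); nra. }
    assert (H1 := IH i (S j) ltac:(lia)); assert (H2 := IH (S i) j ltac:(lia)).
    rewrite (F n). replace (INR (S n)) with (INR (S i) + INR (S j)).
    2: { rewrite <- plus_INR; f_equal; lia. }
    rewrite (F i), (F j) in *.
    assert (0 < INR (S i)) by (apply lt_0_INR; lia).
    assert (0 < INR (S j)) by (apply lt_0_INR; lia).
    apply Rmult_le_compat_l with (r := INR (S i)) in H1; [|lra].
    apply Rmult_le_compat_l with (r := INR (S j)) in H2; [|lra].
    simpl pow. simpl pow in *. lra.
Qed.

Lemma AN_pseries2 U f x0 y0 : open2 U -> AN U f -> U x0 y0 ->
  exists (c : nat -> nat -> R) (r : posreal), abs_summable2 c r /\
    forall x y, Rabs (x - x0) < r -> Rabs (y - y0) < r -> U x y /\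
      f x y = Series (fun i => Series (fun j => c i j * (x - x0) ^ i * (y - y0) ^ j)).
Proof.
  intros HU Hf H0; destruct (AN_mixed U f HU Hf) as (C & R0 & HC & HR & _ & B & D1 & D2).
  destruct (HU x0 y0 H0) as [e He].
  (* Splitting (i + j)! into i! j! doubles the rate to [2 * R0]; this radius leaves the ratio 1/4
     that [taylor_abs] requires. *)
  assert (Hr : 0 < Rmin e (/ (8 * R0))).
  { apply Rmin_pos; [apply cond_pos|]; apply Rinv_0_lt_compat; lra. }
  set (r := mkposreal _ Hr).
  assert (r1 : r <= e) by apply Rmin_l.
  assert (r2 : 8 * R0 * r <= 1).
  { apply Rle_trans with (8 * R0 * (/ (8 * R0))).
    - apply Rmult_le_compat_l; [lra | apply Rmin_r].
    - apply Req_le; field; lra. }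
  assert (P : forall k, 0 < INR (fact k)) by apply INR_fact_lt_0.
  exists (fun i j => mixed f i j x0 y0 / INR (fact i) / INR (fact j)), r.
  assert (Bc : forall i j, Rabs (mixed f i j x0 y0 / INR (fact i) / INR (fact j)) <=
    C * (2 * R0) ^ (i + j)).
  { intros i j; unfold Rdiv; rewrite !Rabs_mult, !(Rabs_pos_eq (/ _)).
    2, 3: left; apply Rinv_0_lt_compat, P.
    apply Rmult_le_reg_r with (INR (fact j)); [apply P|].
    rewrite Rmult_assoc, Rinv_l, Rmult_1_r by (apply Rgt_not_eq, P).
    apply Rmult_le_reg_r with (INR (fact i)); [apply P|].
    rewrite Rmult_assoc, Rinv_l, Rmult_1_r by (apply Rgt_not_eq, P).
    eapply Rle_trans; [apply B, H0|].
    rewrite Rpow_mult_distr.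
    replace (C * (2 ^ (i + j) * R0 ^ (i + j)) * INR (fact j) * INR (fact i)) with
      (C * R0 ^ (i + j) * (2 ^ (i + j) * INR (fact i) * INR (fact j))) by ring.
    apply Rmult_le_compat_l; [|apply fact_add_le].
    apply Rmult_le_pos; [assumption|]; apply pow_le; lra. }
  assert (Br : forall i j, Rabs (mixed f i j x0 y0 / INR (fact i) / INR (fact j)) *
    r ^ (i + j) <= C * (/ 4) ^ i * (/ 4) ^ j).
  { intros i j. apply Rle_trans with (C * (2 * R0) ^ (i + j) * r ^ (i + j)).
    - apply Rmult_le_compat_r; [|apply Bc]. apply pow_le, Rlt_le, cond_pos.
    - rewrite !Rmult_assoc, <- pow_add, <- Rpow_mult_distr.
      apply Rmult_le_compat_l; [assumption|].
      apply pow_incr; split; [|lra].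
      apply Rmult_le_pos; [lra | apply Rlt_le, cond_pos]. }
  assert (Geo : forall a : R, is_series (fun j : nat => a * (/ 4) ^ j) (a * (4 / 3))).
  { intros a. apply (is_series_scal a (fun j : nat => (/ 4) ^ j) (4 / 3)).
    replace (4 / 3) with (/ (1 - / 4)) by field.
    apply is_series_geom; rewrite Rabs_pos_eq; lra. }
  assert (Pos : forall i j, 0 <= Rabs (mixed f i j x0 y0 / INR (fact i) / INR (fact j)) *
    r ^ (i + j)).
  { intros; apply Rmult_le_pos; [apply Rabs_pos|]; apply pow_le, Rlt_le, cond_pos. }
  assert (Sum1 : forall i, ex_series (fun j => Rabs (mixed f i j x0 y0 / INR (fact i) /
    INR (fact j)) * r ^ (i + j))).
  { intros i. apply (ex_series_le (K := R_AbsRing) (V := R_CompleteNormedModule))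
      with (fun j : nat => C * (/ 4) ^ i * (/ 4) ^ j).
    - intros j; unfold norm; simpl; unfold abs; simpl.
      rewrite Rabs_pos_eq by apply Pos. apply Br.
    - eexists; apply Geo. }
  split; [split; [exact Sum1|]|].
  - apply (ex_series_le (K := R_AbsRing) (V := R_CompleteNormedModule))
      with (fun i : nat => C * (4 / 3) * (/ 4) ^ i).
    + intros i; unfold norm; simpl; unfold abs; simpl.
      rewrite Rabs_pos_eq.
      * replace (C * (4 / 3) * (/ 4) ^ i) with (C * (/ 4) ^ i * (4 / 3)) by ring.
        rewrite <- (is_series_unique _ _ (Geo (C * (/ 4) ^ i))).
        apply Series_le; [|eexists; apply Geo].
        intros j; split; [apply Pos | apply Br].
      * rewrite <- (is_series_unique (fun _ : nat => 0) 0).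
        -- apply Series_le; [|apply Sum1]. intros j; split; [apply Rle_refl | apply Pos].
        -- apply is_series_ext with (fun j : nat => 0 * (/ 4) ^ j); [intros; req; ring|].
           assert (G0 := Geo 0); replace (0 * (4 / 3)) with 0 in G0 by ring; exact G0.
    + eexists; apply Geo.
  - intros x y Hx Hy.
    split; [apply He; lra|].
    assert (Sm : forall t t0 : R, Rabs (t - t0) < r -> 2 * R0 * Rabs (t - t0) <= / 4).
    { intros t t0 Ht. apply Rle_trans with (2 * R0 * r).
      - apply Rmult_le_compat_l; lra.
      - lra. }
    (* Each inner sum is the Taylor series in y of the i-th X-derivative along the line x = x0; the
       outer sum is then the Taylor series in x at the fixed height y. *)
    assert (In : forall i, Series (fun j => mixed f i j x0 y0 / INR (fact i) / INR (fact j) *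
      (x - x0) ^ i * (y - y0) ^ j) = mixed f i 0 x0 y / INR (fact i) * (x - x0) ^ i).
    { intros i; apply is_series_unique.
      apply is_series_ext with (fun j => ((x - x0) ^ i / INR (fact i)) *
        (mixed f i j x0 y0 / INR (fact j) * (y - y0) ^ j)).
      { intros j; unfold Rdiv; simpl; ring. }
      replace (mixed f i 0 x0 y / INR (fact i) * (x - x0) ^ i) with
        ((x - x0) ^ i / INR (fact i) * mixed f i 0 x0 y) by (unfold Rdiv; ring).
      apply (is_series_scal ((x - x0) ^ i / INR (fact i))
        (fun j => mixed f i j x0 y0 / INR (fact j) * (y - y0) ^ j)).
      assert (In0 : forall t, Rabs (t - y0) < r -> U x0 t).
      { intros t Ht; apply He; [rewrite Rminus_diag, Rabs_R0; apply cond_pos | lra]. }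
      apply (taylor_abs (fun j t => mixed f i j x0 t) y0 r
        (C * (2 * R0) ^ i * INR (fact i)) (2 * R0)).
      - repeat apply Rmult_le_pos; auto using pos_INR. apply pow_le; lra.
      - lra.
      - intros n t Ht; apply D2, In0, Ht.
      - intros n t Ht. eapply Rle_trans; [apply B, In0, Ht|].
        replace (C * (2 * R0) ^ i * INR (fact i) * (2 * R0) ^ n * INR (fact n)) with
          (C * R0 ^ (i + n) * (2 ^ (i + n) * INR (fact i) * INR (fact n))).
        2: { rewrite !Rpow_mult_distr, !pow_add; ring. }
        apply Rmult_le_compat_l; [|apply fact_add_le].
        apply Rmult_le_pos; [assumption|]; apply pow_le; lra.
      - assumption.
      - apply Sm; assumption. }
    rewrite (Series_ext _ _ In); symmetry; apply is_series_unique.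
    assert (In0 : forall t, Rabs (t - x0) < r -> U t y).
    { intros t Ht; apply He; lra. }
    apply (taylor_abs (fun i t => mixed f i 0 t y) x0 r C (2 * R0)); auto.
    + lra.
    + intros n t Ht. eapply Rle_trans; [apply B, In0, Ht|].
      rewrite Nat.add_0_r; apply Rmult_le_compat_r; [apply pos_INR|].
      apply Rmult_le_compat_l; [assumption|]. apply pow_incr; lra.
Qed.

Lemma AN_pseries1 U f x0 y0 : open2 U -> AN U f -> U x0 y0 ->
  exists (c : nat -> R) (r : posreal),
    forall x, Rabs (x - x0) < r -> is_pseries c (x - x0) (f x y0).
Proof.
  intros HU Hf H0; destruct (AN_mixed U f HU Hf) as (C & R0 & HC & HR & _ & B & D1 & _).
  destruct (HU x0 y0 H0) as [e He].
  assert (Hr : 0 < Rmin e (/ (4 * R0))).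
  { apply Rmin_pos; [apply cond_pos|]; apply Rinv_0_lt_compat; lra. }
  set (r := mkposreal _ Hr).
  assert (r1 : r <= e) by apply Rmin_l.
  assert (r2 : 4 * R0 * r <= 1).
  { apply Rle_trans with (4 * R0 * (/ (4 * R0))).
    - apply Rmult_le_compat_l; [lra | apply Rmin_r].
    - apply Req_le; field; lra. }
  exists (fun i => mixed f i 0 x0 y0 / INR (fact i)), r.
  intros x Hx.
  assert (In0 : forall t, Rabs (t - x0) < r -> U t y0).
  { intros t Ht; apply He; [lra | rewrite Rminus_diag, Rabs_R0; apply cond_pos]. }
  apply is_pseries_R.
  apply (taylor_abs (fun i t => mixed f i 0 t y0) x0 r C R0); auto.
  - intros n t Ht. assert (H := B n 0%nat t y0 (In0 t Ht)).
    rewrite Nat.add_0_r in H; exact H.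
  - apply Rle_trans with (R0 * r); [apply Rmult_le_compat_l; lra | lra].
Qed.

(** * The cubic equation and the density *)

Lemma cbrt_pow3 z : cbrt z ^ 3 = z.
Proof.
  assert (P : forall t, 0 < t -> Rpower t (1 / 3) ^ 3 = t).
  { intros t Ht; rewrite <- Rpower_pow by apply exp_pos.
    rewrite Rpower_mult; replace (1 / 3 * INR 3) with 1 by (simpl; field).
    apply Rpower_1; assumption. }
  unfold cbrt; destruct (Rtotal_order z 0) as [H | [-> | H]].
  - rewrite sign_eq_m1, Rpow_mult_distr, P by (try assumption; apply Rabs_pos_lt; lra).
    rewrite Rabs_left by assumption; ring.
  - rewrite sign_0; ring.
  - rewrite sign_eq_1, Rpow_mult_distr, P by (try assumption; apply Rabs_pos_lt; lra).
    rewrite Rabs_right by lra; ring.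
Qed.

Lemma cube_inj a b : a ^ 3 = b ^ 3 -> a = b.
Proof.
  intros H; assert (E : (a - b) * (a ^ 2 + a * b + b ^ 2) = 0) by (ring_simplify; lra).
  apply Rmult_integral in E; destruct E as [E | E]; [lra|].
  assert (E1 : (a + b / 2) ^ 2 = 0) by nra.
  assert (E2 : b ^ 2 = 0) by nra.
  assert (b = 0) by nra; subst b; nra.
Qed.

Lemma cubic_inj k Z a b : 0 < k -> 0 <= Z ->
  k * a + Z * a ^ 3 = k * b + Z * b ^ 3 -> a = b.
Proof.
  intros Hk HZ H.
  assert (E : (a - b) * (k + Z * (a ^ 2 + a * b + b ^ 2)) = 0) by (ring_simplify; lra).
  apply Rmult_integral in E; destruct E as [E | E]; [lra|].
  assert (0 <= a ^ 2 + a * b + b ^ 2).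
  { replace (a ^ 2 + a * b + b ^ 2) with ((a + b / 2) ^ 2 + 3 / 4 * b ^ 2) by field.
    assert (H1 := pow2_ge_0 (a + b / 2)); assert (H2 := pow2_ge_0 b); lra. }
  assert (0 <= Z * (a ^ 2 + a * b + b ^ 2)) by (apply Rmult_le_pos; assumption).
  lra.
Qed.

(** Cardano's formula: the cubes of the two roots have product -1/27, so the roots have product
    -1/3, which removes the mixed term. *)
Lemma Psi1_eq z : Psi1 z + Psi1 z ^ 3 = - z.
Proof.
  unfold Psi1; set (u := cbrt (_ + _)); set (v := cbrt (_ - _)).
  assert (Hs : 0 <= 1 / 27 + z ^ 2 / 4) by (assert (H := pow2_ge_0 z); lra).
  assert (Hu : u ^ 3 = - (z / 2) + sqrt (1 / 27 + z ^ 2 / 4)) by apply cbrt_pow3.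
  assert (Hv : v ^ 3 = - (z / 2) - sqrt (1 / 27 + z ^ 2 / 4)) by apply cbrt_pow3.
  assert (Huv : u * v = - (1 / 3)).
  { apply cube_inj. rewrite Rpow_mult_distr, Hu, Hv.
    assert (H := sqrt_sqrt _ Hs). nra. }
  replace (u + v + (u + v) ^ 3) with
    (u ^ 3 + v ^ 3 + (u + v) * (1 + 3 * (u * v))) by ring.
  rewrite Huv, Hu, Hv; field.
Qed.

(* For [Z >= 0] this is the root of [q + Z q^3 = 1]; the affine continuation to
   [Z < 0] only serves to make it differentiable at [0]. *)
Definition qroot (Z : R) : R :=
  if Rle_dec Z 0 then 1 - Z else - Psi1 (sqrt Z) / sqrt Z.

(** The inverse of the derivative of q + Z q^3 in q. It enters the derivative of the root and is, at
    the same time, the density to be integrated. *)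
Definition qslope (Z : R) : R := / (1 + 3 * Z * qroot Z ^ 2).

Lemma qroot_eq Z : 0 <= Z -> qroot Z + Z * qroot Z ^ 3 = 1.
Proof.
  intros HZ; unfold qroot; destruct (Rle_dec Z 0) as [H | H].
  - assert (Z = 0) as -> by lra; ring.
  - assert (Hs : 0 < sqrt Z) by (apply sqrt_lt_R0; lra).
    assert (E := Psi1_eq (sqrt Z)).
    rewrite <- (sqrt_sqrt Z) at 3 by lra.
    transitivity (- (Psi1 (sqrt Z) + Psi1 (sqrt Z) ^ 3) / sqrt Z); [field; lra|].
    rewrite E; field; lra.
Qed.

Lemma qroot_bounds Z : 0 <= Z -> 0 < qroot Z <= 1.
Proof.
  intros HZ; assert (E := qroot_eq Z HZ); set (q := qroot Z) in *.
  assert (Hq : 0 < q).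
  { destruct (Rlt_or_le 0 q); [assumption|].
    assert (q ^ 3 <= 0) by nra. nra. }
  assert (0 <= Z * q ^ 3) by (apply Rmult_le_pos; [assumption | apply pow_le; lra]).
  lra.
Qed.

Lemma qslope_den Z : 0 <= Z -> 1 <= 1 + 3 * Z * qroot Z ^ 2.
Proof.
  intros HZ; assert (0 <= Z * qroot Z ^ 2) by (apply Rmult_le_pos; [assumption | apply pow2_ge_0]).
  lra.
Qed.

Lemma qslope_eq Z : 0 <= Z -> qslope Z * (1 + 3 * Z * qroot Z ^ 2) = 1.
Proof. intros HZ; assert (H := qslope_den Z HZ); unfold qslope; field; lra. Qed.

Lemma Rinv_ge1_le1 x : 1 <= x -> / x <= 1.
Proof.
  intros H; apply Rmult_le_reg_r with x; [lra|]. rewrite Rinv_l; lra.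
Qed.

Lemma qslope_bounds Z : 0 <= Z -> / (1 + 3 * Z) <= qslope Z <= 1.
Proof.
  intros HZ; assert (H := qslope_den Z HZ); assert (Hq := qroot_bounds Z HZ).
  unfold qslope; split.
  - apply Rinv_le_contravar; [lra|].
    assert (qroot Z ^ 2 <= 1) by nra. nra.
  - apply Rinv_ge1_le1, H.
Qed.

Lemma is_derive_quadratic (f : R -> R) (x l C : R) (d : posreal) :
  (forall t, Rabs (t - x) < d -> Rabs (f t - f x - l * (t - x)) <= C * (t - x) ^ 2) ->
  is_derive f x l.
Proof.
  intros H; apply is_derive_Reals; intros eps Heps.
  set (C' := Rmax C 0 + 1).
  assert (HC : 0 < C') by (unfold C'; assert (H0 := Rmax_r C 0); lra).
  assert (Hd : 0 < Rmin d (eps / C')).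
  { apply Rmin_pos; [apply cond_pos | apply Rdiv_lt_0_compat; assumption]. }
  exists (mkposreal _ Hd); simpl; intros h Hh Hh2.
  assert (Hh3 : Rabs h < d) by (eapply Rlt_le_trans; [exact Hh2 | apply Rmin_l]).
  assert (Hh4 : Rabs h < eps / C') by (eapply Rlt_le_trans; [exact Hh2 | apply Rmin_r]).
  specialize (H (x + h)); replace (x + h - x) with h in H by ring.
  specialize (H Hh3).
  assert (P : 0 < Rabs h) by (apply Rabs_pos_lt; assumption).
  replace ((f (x + h) - f x) / h - l) with ((f (x + h) - f x - l * h) / h) by (field; assumption).
  unfold Rdiv; rewrite Rabs_mult, Rabs_inv.
  apply Rmult_lt_reg_r with (Rabs h); [assumption|].
  rewrite Rmult_assoc, Rinv_l, Rmult_1_r by lra.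
  eapply Rle_lt_trans; [exact H|].
  rewrite <- (pow2_abs h).
  apply Rle_lt_trans with (C' * Rabs h * Rabs h).
  - replace (C' * Rabs h * Rabs h) with (C' * Rabs h ^ 2) by ring.
    apply Rmult_le_compat_r; [apply pow2_ge_0|].
    unfold C'; assert (H0 := Rmax_l C 0); lra.
  - apply Rmult_lt_compat_r; [assumption|].
    apply Rmult_lt_reg_r with (/ C'); [apply Rinv_0_lt_compat; assumption|].
    replace (C' * Rabs h * / C') with (Rabs h) by (field; lra). exact Hh4.
Qed.

(** Subtracting the two cubics gives (a - b) (1 + Z1 S) = - (Z1 - Z2) b^3 exactly, with S = a^2 + a
    b + b^2. The error comes from replacing 1 + Z1 S by 1 + 3 Z2 b^2. An explicit constant serves
    both for differentiability, including the one-sided case [Z2 = 0], and for the expansion at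
    0. *)
Lemma qroot_quadratic Z1 Z2 : 0 <= Z1 -> 0 <= Z2 ->
  Rabs (qroot Z1 - qroot Z2 - - qroot Z2 ^ 3 * qslope Z2 * (Z1 - Z2)) <=
  (3 + 3 * Z2) * (Z1 - Z2) ^ 2.
Proof.
  intros H1 H2.
  assert (E1 := qroot_eq Z1 H1); assert (E2 := qroot_eq Z2 H2).
  assert (B1 := qroot_bounds Z1 H1); assert (B2 := qroot_bounds Z2 H2).
  assert (D2 := qslope_den Z2 H2).
  unfold qslope; set (a := qroot Z1) in *; set (b := qroot Z2) in *.
  set (S := a ^ 2 + a * b + b ^ 2).
  assert (HS : 0 <= S <= 3) by (unfold S; nra).
  assert (HD : 1 <= 1 + Z1 * S).
  { assert (0 <= Z1 * S) by (apply Rmult_le_pos; lra). lra. }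
  assert (Eab : a - b = - (Z1 - Z2) * b ^ 3 / (1 + Z1 * S)).
  { apply Rmult_eq_reg_r with (1 + Z1 * S); [|lra].
    unfold Rdiv; rewrite Rmult_assoc, Rinv_l, Rmult_1_r by lra. unfold S; nra. }
  assert (Hb3 : 0 <= b ^ 3 <= 1).
  { split; [apply pow_le; lra|]. rewrite <- (pow1 3); apply pow_incr; lra. }
  assert (Lip : Rabs (a - b) <= Rabs (Z1 - Z2)).
  { rewrite Eab; unfold Rdiv; rewrite !Rabs_mult, Rabs_Ropp.
    rewrite (Rabs_pos_eq (b ^ 3)) by lra.
    rewrite (Rabs_pos_eq (/ _)) by (left; apply Rinv_0_lt_compat; lra).
    assert (/ (1 + Z1 * S) <= 1) by (apply Rinv_ge1_le1; lra).
    assert (0 < / (1 + Z1 * S)) by (apply Rinv_0_lt_compat; lra).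
    assert (b ^ 3 * / (1 + Z1 * S) <= 1) by nra.
    assert (0 <= Rabs (Z1 - Z2)) by apply Rabs_pos. nra. }
  set (D := 1 + Z1 * S) in *; set (D' := 1 + 3 * Z2 * b ^ 2) in *.
  assert (Eq : a - b - - b ^ 3 * / D' * (Z1 - Z2) =
    (Z1 - Z2) * b ^ 3 * ((D - D') * (/ D * / D'))).
  { rewrite Eab; field; lra. }
  rewrite Eq, !Rabs_mult, (Rabs_pos_eq (b ^ 3)) by lra.
  assert (BD : Rabs (D - D') <= (3 + 3 * Z2) * Rabs (Z1 - Z2)).
  { replace (D - D') with ((Z1 - Z2) * S + Z2 * ((a - b) * (a + 2 * b))) by (unfold D, D', S; ring).
    eapply Rle_trans; [apply Rabs_triang|].
    rewrite !Rabs_mult, (Rabs_pos_eq S), (Rabs_pos_eq Z2), (Rabs_pos_eq (a + 2 * b)) by lra.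
    assert (0 <= Rabs (a - b)) by apply Rabs_pos.
    assert (Rabs (a - b) * (a + 2 * b) <= Rabs (Z1 - Z2) * 3).
    { apply Rmult_le_compat; lra. }
    assert (Z2 * (Rabs (a - b) * (a + 2 * b)) <= Z2 * (Rabs (Z1 - Z2) * 3)).
    { apply Rmult_le_compat_l; assumption. }
    assert (Rabs (Z1 - Z2) * S <= Rabs (Z1 - Z2) * 3).
    { apply Rmult_le_compat_l; [apply Rabs_pos | lra]. }
    lra. }
  assert (I1 : 0 < / D <= 1).
  { split; [apply Rinv_0_lt_compat; lra|]. apply Rinv_ge1_le1; lra. }
  assert (I2 : 0 < / D' <= 1).
  { split; [apply Rinv_0_lt_compat; lra|]. apply Rinv_ge1_le1; lra. }
  rewrite (Rabs_pos_eq (/ D)), (Rabs_pos_eq (/ D')) by lra.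
  rewrite <- (pow2_abs (Z1 - Z2)).
  assert (P := Rabs_pos (Z1 - Z2)); assert (P2 := Rabs_pos (D - D')).
  apply Rle_trans with (Rabs (Z1 - Z2) * 1 * (((3 + 3 * Z2) * Rabs (Z1 - Z2)) * 1)).
  2: { apply Req_le; ring. }
  apply Rmult_le_compat.
  - apply Rmult_le_pos; lra.
  - apply Rmult_le_pos; [lra|]. apply Rmult_le_pos; lra.
  - apply Rmult_le_compat_l; lra.
  - apply Rmult_le_compat; [lra | apply Rmult_le_pos; lra | lra|]. nra.
Qed.

Lemma is_derive_qroot Z : 0 <= Z ->
  is_derive qroot Z (- qroot Z ^ 3 * qslope Z).
Proof.
  intros HZ.
  assert (Q0 : qroot 0 = 1) by (unfold qroot; destruct (Rle_dec 0 0); lra).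
  destruct (Rle_lt_or_eq_dec 0 Z HZ) as [H | <-].
  - apply (is_derive_quadratic qroot Z _ (3 + 3 * Z) (mkposreal Z H)).
    simpl; intros t Ht; apply Rabs_def2 in Ht; apply qroot_quadratic; lra.
  - apply (is_derive_quadratic qroot 0 _ 3 (mkposreal 1 Rlt_0_1)).
    (* To the right of 0 the quadratic bound applies; to the left the affine continuation has
       exactly the slope -1. *)
    simpl; intros t Ht. destruct (Rle_lt_dec 0 t) as [H | H].
    + eapply Rle_trans; [apply qroot_quadratic; lra|]. apply Req_le; ring.
    + unfold qslope; rewrite Q0.
      replace (qroot t) with (1 - t) by (unfold qroot; destruct (Rle_dec t 0); lra).
      match goal with |- Rabs ?a <= _ => replace a with 0 by field end.
      rewrite Rabs_R0. assert (H0 := pow2_ge_0 t); lra.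
Qed.

Lemma is_derive_qslope Z : 0 <= Z ->
  is_derive qslope Z (- (3 * qroot Z ^ 2 * qslope Z ^ 3 * (1 + Z * qroot Z ^ 2))).
Proof.
  intros HZ. assert (D := qslope_den Z HZ).
  assert (HD : is_derive qroot Z (- qroot Z ^ 3 * qslope Z)) by (apply is_derive_qroot; assumption).
  unfold qslope at 1.
  replace (- (3 * qroot Z ^ 2 * qslope Z ^ 3 * (1 + Z * qroot Z ^ 2))) with
    (- (3 * (qroot Z ^ 2 + Z * (2 * (- qroot Z ^ 3 * qslope Z) * qroot Z))) /
      (1 + 3 * Z * qroot Z ^ 2) ^ 2).
  2: { unfold qslope; field; lra. }
  apply (is_derive_inv (fun Z => 1 + 3 * Z * qroot Z ^ 2)); [|lra].
  assert (ex_derive qroot Z) by (eexists; exact HD).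
  auto_derive; [assumption|].
  change (fun x : R => qroot x) with qroot; rewrite (is_derive_unique _ _ _ HD); ring.
Qed.

(** * The density as a function of the angle *)

Definition wroot (X p : R) : R := qroot (X ^ 2 * cos p ^ 6).

(** The density with respect to the angle: for b = tan p the factor 1 / (1 + b^2) of [density] is
    absorbed by dp, and (1 + b^2)^(-3/2) becomes cos^3 p. *)
Definition dens (X p : R) : R := qslope (X ^ 2 * cos p ^ 6).

Lemma Zarg_nonneg X p : 0 <= X ^ 2 * cos p ^ 6.
Proof.
  apply Rmult_le_pos; [apply pow2_ge_0|].
  replace (cos p ^ 6) with ((cos p ^ 3) ^ 2) by ring; apply pow2_ge_0.
Qed.

Lemma wroot_eq X p : wroot X p + X ^ 2 * cos p ^ 6 * wroot X p ^ 3 = 1.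
Proof. apply qroot_eq, Zarg_nonneg. Qed.

Lemma dens_eq X p : dens X p * (1 + 3 * (X ^ 2 * cos p ^ 6) * wroot X p ^ 2) = 1.
Proof. apply qslope_eq, Zarg_nonneg. Qed.

Lemma cos6_le p : 0 <= cos p ^ 6 <= 1.
Proof.
  assert (H := COS_bound p). replace (cos p ^ 6) with ((cos p ^ 2) ^ 3) by ring.
  assert (0 <= cos p ^ 2 <= 1) by nra.
  split; [apply pow_le; lra|]. rewrite <- (pow1 3); apply pow_incr; lra.
Qed.

Lemma dens_bounds X p : / (1 + 3 * X ^ 2) <= dens X p <= 1.
Proof.
  destruct (qslope_bounds _ (Zarg_nonneg X p)) as [H1 H2]; split; [|exact H2].
  eapply Rle_trans; [|exact H1]. assert (H3 := Zarg_nonneg X p).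
  apply Rinv_le_contravar; [lra|].
  assert (H := cos6_le p); assert (H4 := pow2_ge_0 X); nra.
Qed.

Lemma dens_pos X p : 0 < dens X p.
Proof.
  eapply Rlt_le_trans; [|apply dens_bounds]. apply Rinv_0_lt_compat.
  assert (H := pow2_ge_0 X); lra.
Qed.

Lemma wroot_bounds X p : 0 < wroot X p <= 1.
Proof. apply qroot_bounds, Zarg_nonneg. Qed.

Definition dens_X (X p : R) : R :=
  - (3 * wroot X p ^ 2 * dens X p ^ 3 * (1 + X ^ 2 * cos p ^ 6 * wroot X p ^ 2)) *
  (2 * X * cos p ^ 6).

Definition dens_p (X p : R) : R :=
  - (3 * wroot X p ^ 2 * dens X p ^ 3 * (1 + X ^ 2 * cos p ^ 6 * wroot X p ^ 2)) *
  (- (6 * X ^ 2 * cos p ^ 5 * sin p)).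

Definition wroot_X (X p : R) : R := - wroot X p ^ 3 * dens X p * (2 * X * cos p ^ 6).

Definition wroot_p (X p : R) : R :=
  - wroot X p ^ 3 * dens X p * (- (6 * X ^ 2 * cos p ^ 5 * sin p)).

Lemma partials_Zarg U : partials U (fun X p => X ^ 2 * cos p ^ 6)
  (fun X p => 2 * X * cos p ^ 6) (fun X p => - (6 * X ^ 2 * cos p ^ 5 * sin p)).
Proof. intros X p _; split; auto_derive; trivial; ring. Qed.

Lemma partials_comp1 U (g : R -> R) (g' : R -> R -> R) f fx fy :
  partials U f fx fy ->
  (forall x y, U x y -> is_derive g (f x y) (g' x y)) ->
  partials U (fun x y => g (f x y)) (fun x y => g' x y * fx x y)
    (fun x y => g' x y * fy x y).
Proof.
  intros Hf Hg x y Hxy; destruct (Hf x y Hxy) as [H1 H2].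
  rewrite (Rmult_comm _ (fx x y)), (Rmult_comm _ (fy x y)); split.
  - apply (is_derive_comp g (fun t => f t y)); auto.
  - apply (is_derive_comp g (fun t => f x t)); auto.
Qed.

Lemma partials_wroot U : partials U wroot wroot_X wroot_p.
Proof.
  apply (partials_comp1 U qroot (fun X p => - wroot X p ^ 3 * dens X p)
    (fun X p => X ^ 2 * cos p ^ 6)); [apply partials_Zarg|].
  intros X p _; apply is_derive_qroot, Zarg_nonneg.
Qed.

Lemma partials_dens U : partials U dens dens_X dens_p.
Proof.
  apply (partials_comp1 U qslope (fun X p =>
    - (3 * wroot X p ^ 2 * dens X p ^ 3 * (1 + X ^ 2 * cos p ^ 6 * wroot X p ^ 2)))
    (fun X p => X ^ 2 * cos p ^ 6)); [apply partials_Zarg|].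
  intros X p _; apply is_derive_qslope, Zarg_nonneg.
Qed.

(** The list closes up because [dens] is itself a generator: the quotients in the derivatives of the
    root and of the density are products with powers of [dens]. *)
Lemma AN_elementary x1 x2 y1 y2 f :
  gen_alg (box x1 x2 y1 y2)
    (cons (fun X _ => X) (cons (fun _ p => cos p) (cons (fun _ p => sin p)
      (cons wroot (cons dens nil))))) f ->
  AN (box x1 x2 y1 y2) f.
Proof.
  apply AN_system.
  - intros g [<- | [<- | [<- | [<- | [<- | []]]]]].
    + exists (Rmax (Rabs x1) (Rabs x2)); intros x y [H _]; apply RmaxAbs; lra.
    + exists 1; intros x y _; apply Rabs_le, COS_bound.
    + exists 1; intros x y _; apply Rabs_le, SIN_bound.
    + exists 1; intros x y _; apply Rabs_le. assert (H := wroot_bounds x y); lra.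
    + exists 1; intros x y _; apply Rabs_le.
      assert (H := dens_bounds x y); assert (H0 := dens_pos x y); lra.
  - intros g [<- | [<- | [<- | [<- | [<- | []]]]]].
    + exists (fun _ _ => 1), (fun _ _ => 0); split.
      { intros x y _; split; auto_derive; trivial. }
      split; ga.
    + exists (fun _ _ => 0), (fun _ p => - sin p); split.
      { intros x y _; split; auto_derive; trivial; ring. }
      split; ga.
    + exists (fun _ _ => 0), (fun _ p => cos p); split.
      { intros x y _; split; auto_derive; trivial; ring. }
      split; ga.
    + exists wroot_X, wroot_p; split; [apply partials_wroot|].
      unfold wroot_X, wroot_p; split; ga.
    + exists dens_X, dens_p; split; [apply partials_dens|].
      unfold dens_X, dens_p; split; ga.
Qed.

Lemma AN_dens x1 x2 y1 y2 : AN (box x1 x2 y1 y2) dens.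
Proof. apply AN_elementary; ga. Qed.

Lemma AN_dens_X x1 x2 y1 y2 : AN (box x1 x2 y1 y2) dens_X.
Proof. apply AN_elementary; unfold dens_X; ga. Qed.

Definition all2 (x y : R) : Prop := True.

Lemma open2_all2 : open2 all2.
Proof. intros x y _; exists (mkposreal 1 Rlt_0_1); intros; exact I. Qed.

Lemma box_around x y : box (x - 1) (x + 1) (y - 1) (y + 1) x y.
Proof. split; lra. Qed.

Lemma AN_box_continuity f : (forall x1 x2 y1 y2, AN (box x1 x2 y1 y2) f) ->
  forall x y, continuity_2d_pt f x y.
Proof.
  intros H x y; apply (AN_continuity _ f (open2_box (x - 1) (x + 1) (y - 1) (y + 1)));
    [apply H | apply box_around].
Qed.

(** * The integral of the density and its symmetries *)

Definition Kfun (X p : R) : R := 2 * RInt (dens X) (- (PI / 2)) p.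

Definition Kfun_X (X p : R) : R := 2 * RInt (dens_X X) (- (PI / 2)) p.

(** [AN_RInt] wants the base point of the integral inside the range of p; the box is enlarged to
    contain -PI/2, and the result restricted afterwards. *)
Definition big_box (x1 x2 y1 y2 : R) : R -> R -> Prop :=
  box x1 x2 (Rmin y1 (- (PI / 2) - 1)) (Rmax y2 (- (PI / 2) + 1)).

Lemma big_box_sub x1 x2 y1 y2 x y : box x1 x2 y1 y2 x y -> big_box x1 x2 y1 y2 x y.
Proof.
  intros [H1 H2]; split; [assumption|].
  assert (A := Rmin_l y1 (- (PI / 2) - 1)); assert (B := Rmax_l y2 (- (PI / 2) + 1)); lra.
Qed.

Lemma big_box_mid y1 y2 : Rmin y1 (- (PI / 2) - 1) < - (PI / 2) < Rmax y2 (- (PI / 2) + 1).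
Proof.
  assert (A := Rmin_r y1 (- (PI / 2) - 1)); assert (B := Rmax_r y2 (- (PI / 2) + 1)); lra.
Qed.

Lemma AN_Kfun x1 x2 y1 y2 : AN (box x1 x2 y1 y2) Kfun.
Proof.
  apply AN_sub with (big_box x1 x2 y1 y2); [apply big_box_sub|].
  apply (AN_mult _ (fun _ _ => 2)); [apply AN_const|].
  apply AN_RInt; [apply big_box_mid | apply AN_dens].
Qed.

Lemma AN_Kfun_X x1 x2 y1 y2 : AN (box x1 x2 y1 y2) Kfun_X.
Proof.
  apply AN_sub with (big_box x1 x2 y1 y2); [apply big_box_sub|].
  apply (AN_mult _ (fun _ _ => 2)); [apply AN_const|].
  apply AN_RInt; [apply big_box_mid | apply AN_dens_X].
Qed.

Lemma partials_scal U c f fx fy : partials U f fx fy ->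
  partials U (fun x y => c * f x y) (fun x y => c * fx x y) (fun x y => c * fy x y).
Proof.
  intros H x y Hxy; destruct (H x y Hxy); split; apply is_derive_scal; assumption.
Qed.

Lemma partials_Kfun : partials all2 Kfun Kfun_X (fun X p => 2 * dens X p).
Proof.
  intros X p _.
  assert (H : partials (big_box (X - 1) (X + 1) (p - 1) (p + 1)) Kfun Kfun_X
    (fun X p => 2 * dens X p)).
  { apply partials_scal, partials_RInt with (fy := dens_p).
    - apply big_box_mid.
    - apply partials_dens.
    - intros; apply AN_box_continuity, AN_dens.
    - intros; apply AN_box_continuity, AN_dens_X. }
  apply H, big_box_sub, box_around.
Qed.

Lemma Kfun_start X : Kfun X (- (PI / 2)) = 0.
Proof. unfold Kfun; rewrite RInt_point; unfold zero; simpl; ring. Qed.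

Lemma Kfun_X_start X : Kfun_X X (- (PI / 2)) = 0.
Proof. unfold Kfun_X; rewrite RInt_point; unfold zero; simpl; ring. Qed.

Lemma Kfun_incr X p1 p2 : p1 <= p2 ->
  2 / (1 + 3 * X ^ 2) * (p2 - p1) <= Kfun X p2 - Kfun X p1 <= 2 * (p2 - p1).
Proof.
  intros H; destruct (MVT_derive (Kfun X) (fun p => 2 * dens X p) p1 p2)
    as (c & _ & E).
  { intros t _; apply (partials_Kfun X t I). }
  rewrite E; destruct (dens_bounds X c); unfold Rdiv; split;
    apply Rmult_le_compat_r; lra.
Qed.

Lemma Kfun_lt X p1 p2 : p1 < p2 -> Kfun X p1 < Kfun X p2.
Proof.
  intros H; destruct (Kfun_incr X p1 p2) as [H1 _]; [lra|].
  assert (0 < 2 / (1 + 3 * X ^ 2) * (p2 - p1)).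
  { apply Rmult_lt_0_compat; [|lra]; apply Rdiv_lt_0_compat; [lra|].
    assert (H0 := pow2_ge_0 X); lra. }
  lra.
Qed.

Lemma Kfun_lt_iff X p1 p2 : Kfun X p1 < Kfun X p2 <-> p1 < p2.
Proof.
  split; [|apply Kfun_lt]; intros H.
  destruct (Rlt_or_le p1 p2) as [H1 | [H1 | ->]]; [assumption | | lra].
  apply Kfun_lt with (X := X) in H1; lra.
Qed.

Lemma Kfun_inj X p1 p2 : Kfun X p1 = Kfun X p2 -> p1 = p2.
Proof.
  intros H; destruct (Rtotal_order p1 p2) as [H1 | [H1 | H1]]; [|assumption|];
    apply Kfun_lt with (X := X) in H1; lra.
Qed.

Lemma constant_of_derive_0 (f : R -> R) :
  (forall t, is_derive f t 0) -> forall a b, f a = f b.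
Proof.
  intros H a b; destruct (MVT_derive f (fun _ => 0) a b) as (c & _ & E); auto.
  lra.
Qed.

Lemma dens_shift X p : dens X (p + PI) = dens X p.
Proof. unfold dens; rewrite neg_cos; f_equal; ring. Qed.

Lemma dens_opp_p X p : dens X (- p) = dens X p.
Proof. unfold dens; rewrite cos_neg; reflexivity. Qed.

Lemma dens_opp_X X p : dens (- X) p = dens X p.
Proof. unfold dens; f_equal; ring. Qed.

Lemma is_derive_Kfun X p : is_derive (Kfun X) p (2 * dens X p).
Proof. apply (partials_Kfun X p I). Qed.

Lemma Kfun_shift X p : Kfun X (p + PI) = Kfun X p + Kfun X (PI / 2).
Proof.
  assert (H := constant_of_derive_0 (fun p => Kfun X (p + PI) - Kfun X p)).
  specialize (fun G => H G p (- (PI / 2))); cbv beta in H.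
  rewrite Kfun_start in H; replace (- (PI / 2) + PI) with (PI / 2) in H by field.
  rewrite <- (Rminus_0_r (Kfun X (PI / 2))), <- H; [ring|].
  intros t; replace 0 with (1 * (2 * dens X (t + PI)) - 2 * dens X t) by (rewrite dens_shift; ring).
  apply Rderive_minus; [|apply is_derive_Kfun].
  apply (is_derive_comp (Kfun X) (fun p => p + PI)); [apply is_derive_Kfun|].
  auto_derive; trivial.
Qed.

Lemma Kfun_opp X p : Kfun X (- p) = Kfun X (PI / 2) - Kfun X p.
Proof.
  assert (H := constant_of_derive_0 (fun p => Kfun X (- p) + Kfun X p)).
  specialize (fun G => H G p (PI / 2)); cbv beta in H.
  rewrite Kfun_start, Rplus_0_l in H.
  rewrite <- H; [ring|].
  intros t; replace 0 with (-1 * (2 * dens X (- t)) + 2 * dens X t) by (rewrite dens_opp_p; ring).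
  apply Rderive_plus; [|apply is_derive_Kfun].
  apply (is_derive_comp (Kfun X) (fun p => - p)); [apply is_derive_Kfun|].
  auto_derive; trivial.
Qed.

Lemma Kfun_opp_X X p : Kfun (- X) p = Kfun X p.
Proof. unfold Kfun; f_equal; apply RInt_ext; intros; apply dens_opp_X. Qed.

Lemma Kfun_0 p : Kfun 0 p = 2 * (p + PI / 2).
Proof.
  unfold Kfun; f_equal.
  rewrite (RInt_ext (dens 0) (fun _ => 1)).
  - rewrite RInt_const; unfold scal; simpl; unfold mult; simpl; field.
  - intros t _; req; assert (H := dens_eq 0 t); ring_simplify in H; exact H.
Qed.

(** * The improper integrals in terms of [Kfun] *)

(** The fundamental theorem of calculus for improper integrals. General filters at both ends let one
    lemma serve the infinite ends of [Ystar'], the fixed end of [Phi'] and the singular ends of the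
    Beta integral. *)
Lemma is_RInt_gen_antiderivative (f G : R -> R) (Fa Fb : (R -> Prop) -> Prop)
    (la lb : R) :
  Filter Fa -> Filter Fb ->
  filter_prod Fa Fb (fun ab => forall t, Rmin (fst ab) (snd ab) <= t <= Rmax (fst ab) (snd ab) ->
    is_derive G t (f t) /\ continuous f t) ->
  filterlim G Fa (locally la) -> filterlim G Fb (locally lb) ->
  is_RInt_gen f Fa Fb (lb - la).
Proof.
  intros HFa HFb HD Ha Hb P HP.
  assert (HL : filterlim (fun ab : R * R => G (snd ab) - G (fst ab)) (filter_prod Fa Fb)
    (locally (lb - la))).
  { apply (filterlim_comp_2 (fun ab => G (snd ab)) (fun ab => G (fst ab)) Rminus
      (G := locally lb) (H := locally la)).
    - apply filterlim_comp with (2 := Hb); apply filterlim_snd.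
    - apply filterlim_comp with (2 := Ha); apply filterlim_fst.
    - apply (filterlim_comp_2 fst (fun x => - snd x) Rplus
        (G := locally lb) (H := locally (- la))).
      + apply filterlim_fst.
      + apply filterlim_comp with (1 := filterlim_snd).
        apply (filterlim_opp la).
      + apply (filterlim_plus lb (- la)). }
  specialize (HL P HP); unfold filtermapi; unfold filtermap in HL.
  apply (filter_imp (fun ab => P (G (snd ab) - G (fst ab)) /\
    forall t, Rmin (fst ab) (snd ab) <= t <= Rmax (fst ab) (snd ab) ->
    is_derive G t (f t) /\ continuous f t)).
  - intros [a b] [H1 H2]; exists (G b - G a); split; [|exact H1].
    apply (is_RInt_derive G f a b); intros t Ht; apply H2; assumption.
  - apply filter_and; assumption.
Qed.

Lemma atan_lim_p : filterlim atan (Rbar_locally p_infty) (locally (PI / 2)).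
Proof.
  intros P [e He]. assert (Hpi := PI_RGT_0).
  set (d := Rmin e (PI / 2)).
  assert (Hd : 0 < d) by (apply Rmin_pos; [apply cond_pos | lra]).
  assert (Hd1 : d <= e) by apply Rmin_l.
  assert (Hd2 : d <= PI / 2) by apply Rmin_r.
  exists (tan (PI / 2 - d)); intros t Ht; apply He.
  apply atan_increasing in Ht. rewrite atan_tan in Ht by lra.
  assert (H := atan_bound t).
  change (Rabs (atan t - PI / 2) < e); apply Rabs_def1; lra.
Qed.

Lemma atan_lim_m : filterlim atan (Rbar_locally m_infty) (locally (- (PI / 2))).
Proof.
  apply filterlim_ext with (fun t => - atan (- t)).
  { intros t; rewrite atan_opp; ring. }
  apply filterlim_comp with (G := locally (PI / 2)); [|apply (filterlim_opp (PI / 2))].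
  apply filterlim_comp with (G := Rbar_locally p_infty).
  - apply (filterlim_Rbar_opp m_infty).
  - apply atan_lim_p.
Qed.

Lemma cos_atan2 b : cos (atan b) ^ 2 = / (1 + b ^ 2).
Proof.
  assert (H := pow2_ge_0 b).
  rewrite cos_atan. unfold Rsqr; replace (b * b) with (b ^ 2) by ring.
  unfold Rdiv; rewrite Rmult_1_l, pow_inv, <- Rsqr_pow2, Rsqr_sqrt by lra; reflexivity.
Qed.

(** [Psi1] is odd, so its quotient by -z depends on z^2 only. Both sides solve a + a^3 = - z, whose
    real root is unique. *)
Lemma Psi1_qroot z : Psi1 z = - z * qroot (z ^ 2).
Proof.
  apply (cubic_inj 1 1); [lra | lra|].
  assert (E := qroot_eq (z ^ 2) (pow2_ge_0 z)); assert (E1 := Psi1_eq z).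
  transitivity (- z); [lra|].
  transitivity (- z * (qroot (z ^ 2) + z ^ 2 * qroot (z ^ 2) ^ 3)); [rewrite E|]; ring.
Qed.

Lemma density_eq X b : density X b = / (1 + b ^ 2) * dens X (atan b).
Proof.
  assert (H := pow2_ge_0 b).
  assert (E : X / Rpower (1 + b ^ 2) (3 / 2) = X * cos (atan b) ^ 3).
  { unfold Rdiv; f_equal.
    replace (3 * / 2) with (/ 2 * INR 3) by (simpl; field).
    rewrite <- Rpower_mult, Rpower_pow by apply exp_pos.
    rewrite Rpower_sqrt, cos_atan by lra.
    unfold Rsqr; replace (b * b) with (b ^ 2) by ring.
    rewrite <- pow_inv; f_equal; unfold Rdiv; ring. }
  unfold density; rewrite E, Psi1_qroot.
  replace ((X * cos (atan b) ^ 3) ^ 2) with (X ^ 2 * cos (atan b) ^ 6) by ring.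
  fold (wroot X (atan b)).
  replace (3 * (- (X * cos (atan b) ^ 3) * wroot X (atan b)) ^ 2) with
    (3 * (X ^ 2 * cos (atan b) ^ 6) * wroot X (atan b) ^ 2) by ring.
  unfold dens, qslope; fold (wroot X (atan b)).
  unfold Rdiv; rewrite Rmult_1_l, Rinv_mult; reflexivity.
Qed.

Lemma density_antiderivative X b :
  is_derive (fun b => Kfun X (atan b) / 2) b (density X b).
Proof.
  replace (density X b) with ((/ (1 + b ^ 2) * (2 * dens X (atan b))) / 2)
    by (rewrite density_eq; assert (H := pow2_ge_0 b); field; lra).
  apply is_derive_div_const, (is_derive_comp (Kfun X) atan).
  - apply is_derive_Kfun.
  - apply is_derive_Reals, derivable_pt_lim_atan.
Qed.

Lemma continuous_Kfun X p : continuous (Kfun X) p.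
Proof. eapply continuous_of_derive, is_derive_Kfun. Qed.

Lemma continuous_density X b : continuous (density X) b.
Proof.
  apply continuous_ext with (fun b => / (1 + b ^ 2) * dens X (atan b)).
  { intros; symmetry; apply density_eq. }
  apply (continuous_mult (K := R_AbsRing) (fun b => / (1 + b ^ 2)) (fun b => dens X (atan b))).
  - apply (ex_derive_continuous (V := R_NormedModule)).
    auto_derive. assert (H := pow2_ge_0 b); simpl in H; lra.
  - apply (continuous_comp atan (dens X)).
    + eapply continuous_of_derive, is_derive_Reals, derivable_pt_lim_atan.
    + apply continuity_2d_snd, AN_box_continuity, AN_dens.
Qed.

Lemma Ystar'_Kfun X : Ystar' X = Kfun X (PI / 2) / 2.
Proof.
  unfold Ystar'; apply is_RInt_gen_unique.
  - replace (Kfun X (PI / 2) / 2) with (Kfun X (PI / 2) / 2 - Kfun X (- (PI / 2)) / 2)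
      by (rewrite Kfun_start; field).
    apply is_RInt_gen_antiderivative with (G := fun b => Kfun X (atan b) / 2);
      try apply Rbar_locally_filter.
    + apply filter_forall; intros ab t _; split;
        [apply density_antiderivative | apply continuous_density].
    + apply (filterlim_comp _ _ _ atan (fun p => Kfun X p / 2) _ (locally (- (PI / 2))));
        [apply atan_lim_m|].
      apply (continuous_scal_l (K := R_AbsRing) (V := R_NormedModule) (Kfun X) (/ 2)), continuous_Kfun.
    + apply (filterlim_comp _ _ _ atan (fun p => Kfun X p / 2) _ (locally (PI / 2)));
        [apply atan_lim_p|].
      apply (continuous_scal_l (K := R_AbsRing) (V := R_NormedModule) (Kfun X) (/ 2)), continuous_Kfun.
Qed.

Lemma Phi'_eq a b : Phi' (a, b) =
  (a + a ^ 3 + b ^ 2 * a / 4, Kfun (a + a ^ 3 + b ^ 2 * a / 4) (atan (b / 2))).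
Proof.
  unfold Phi'; set (X := a + a ^ 3 + b ^ 2 * a / 4); f_equal.
  rewrite (is_RInt_gen_unique _ (Kfun X (atan (b / 2)) / 2)); [req; field|].
  replace (Kfun X (atan (b / 2)) / 2) with
    (Kfun X (atan (b / 2)) / 2 - Kfun X (- (PI / 2)) / 2) by (rewrite Kfun_start; field).
  apply is_RInt_gen_antiderivative with (G := fun b => Kfun X (atan b) / 2);
    try apply Rbar_locally_filter; try apply at_point_filter.
  - apply filter_forall; intros ab t _; split;
      [apply density_antiderivative | apply continuous_density].
  - apply (filterlim_comp _ _ _ atan (fun p => Kfun X p / 2) _ (locally (- (PI / 2))));
      [apply atan_lim_m|].
    apply (continuous_scal_l (K := R_AbsRing) (V := R_NormedModule) (Kfun X) (/ 2)), continuous_Kfun.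
  - intros P HP; exact (locally_singleton _ _ HP).
Qed.

Lemma Kfun_top X : Kfun X (PI / 2) = 2 * Ystar' X.
Proof. rewrite Ystar'_Kfun; field. Qed.

Lemma Ystar'_pos X : 0 < Ystar' X.
Proof.
  assert (H := PI_RGT_0); assert (H1 := Kfun_lt X (- (PI / 2)) (PI / 2)).
  rewrite Kfun_start, Kfun_top in H1; lra.
Qed.

Lemma Kfun_mid X : Kfun X 0 = Ystar' X.
Proof.
  assert (H := Kfun_opp X 0); rewrite Ropp_0, Kfun_top in H; lra.
Qed.

(** * The inverse in the second variable *)

Lemma is_derive_lipschitz (f : R -> R) x l : is_derive f x l ->
  exists d : posreal, forall t, Rabs (t - x) < d ->
    Rabs (f t - f x) <= (Rabs l + 1) * Rabs (t - x).
Proof.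
  intros H; apply is_derive_Reals in H; destruct (H 1 Rlt_0_1) as [d Hd].
  exists d; intros t Ht; destruct (Req_dec t x) as [-> | Hn].
  { rewrite !Rminus_diag, Rabs_R0; lra. }
  specialize (Hd (t - x) ltac:(lra) Ht); replace (x + (t - x)) with t in Hd by ring.
  replace (f t - f x) with (((f t - f x) / (t - x) - l + l) * (t - x)) by (field; lra).
  rewrite Rabs_mult; apply Rmult_le_compat_r; [apply Rabs_pos|].
  eapply Rle_trans; [apply Rabs_triang|]; lra.
Qed.

(** The solution [f] is given on the whole line, so only its differentiability is at stake. The
    lower bound on [Fy] makes [f] Lipschitz at [x0] by the mean value theorem in y; the differential
    of [F] at the single point (x0, f x0) then determines the slope. *)
Lemma is_derive_implicit (F Fx Fy : R -> R -> R) (f : R -> R) (c m x0 : R) (d : posreal) :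
  partials all2 F Fx Fy -> (forall x y, continuity_2d_pt Fx x y) ->
  (forall x, F x (f x) = c) -> 0 < m ->
  (forall x y, Rabs (x - x0) < d -> m <= Fy x y) ->
  is_derive f x0 (- Fx x0 (f x0) / Fy x0 (f x0)).
Proof.
  intros Hp Hc Hf Hm HFy.
  set (lx := Fx x0 (f x0)); set (ly := Fy x0 (f x0)).
  assert (Hly : m <= ly).
  { apply HFy; rewrite Rminus_diag, Rabs_R0; apply cond_pos. }
  destruct (is_derive_lipschitz (fun x => F x (f x0)) x0 lx) as [d1 Hd1].
  { apply (Hp x0 (f x0) I). }
  set (L := (Rabs lx + 1) / m).
  assert (HL : 0 <= L).
  { apply Rdiv_le_0_compat; [|assumption]. assert (H := Rabs_pos lx); lra. }
  assert (Lip : forall x, Rabs (x - x0) < d -> Rabs (x - x0) < d1 ->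
    Rabs (f x - f x0) <= L * Rabs (x - x0)).
  { intros x H1 H2; specialize (Hd1 x H2); cbv beta in Hd1.
    destruct (MVT_derive (F x) (Fy x) (f x0) (f x)) as (y & _ & E).
    { intros t _; apply (Hp x t I). }
    rewrite Hf, <- (Hf x0) in E.
    assert (Hy := HFy x y H1).
    apply Rmult_le_reg_l with m; [assumption|].
    replace (m * (L * Rabs (x - x0))) with ((Rabs lx + 1) * Rabs (x - x0)) by (unfold L; field; lra).
    eapply Rle_trans; [|exact Hd1].
    rewrite (Rabs_minus_sym (F x (f x0))), E, Rabs_mult, (Rabs_pos_eq (Fy x y)) by lra.
    apply Rmult_le_compat_r; [apply Rabs_pos | assumption]. }
  assert (D := partials_differentiable all2 F Fx Fy x0 (f x0) open2_all2 Hp I (Hc _ _)).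
  fold lx ly in D.
  apply is_derive_Reals; intros eps Heps.
  assert (He : 0 < eps * m / (2 * (1 + L))).
  { apply Rdiv_lt_0_compat; [apply Rmult_lt_0_compat|]; lra. }
  destruct (D (mkposreal _ He)) as [d2 Hd2]; simpl in Hd2.
  assert (Hd3 : 0 < Rmin (Rmin d d1) (d2 / (1 + L))).
  { apply Rmin_pos; [apply Rmin_pos; apply cond_pos|].
    apply Rdiv_lt_0_compat; [apply cond_pos | lra]. }
  exists (mkposreal _ Hd3); simpl; intros h Hh Hh'.
  apply Rmin_Rgt_l in Hh'; destruct Hh' as [Hh1 Hh3].
  apply Rmin_Rgt_l in Hh1; destruct Hh1 as [Hh1 Hh2]; unfold Rgt in *.
  assert (P : 0 < Rabs h) by (apply Rabs_pos_lt; assumption).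
  assert (HLip := Lip (x0 + h)); replace (x0 + h - x0) with h in HLip by ring.
  specialize (HLip Hh1 Hh2).
  assert (Hh3' : Rabs h * (1 + L) < d2).
  { apply Rmult_lt_reg_r with (/ (1 + L)); [apply Rinv_0_lt_compat; lra|].
    rewrite Rmult_assoc, Rinv_r, Rmult_1_r by lra; exact Hh3. }
  assert (0 <= Rabs h * L) by (apply Rmult_le_pos; lra).
  specialize (Hd2 (x0 + h) (f (x0 + h))); rewrite !Hf in Hd2.
  replace (x0 + h - x0) with h in Hd2 by ring.
  set (k := f (x0 + h) - f x0) in *.
  assert (H1 : Rabs h < d2) by lra. assert (H2 : Rabs k < d2) by lra.
  specialize (Hd2 H1 H2).
  assert (HM : Rmax (Rabs h) (Rabs k) <= (1 + L) * Rabs h).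
  { apply Rmax_lub; lra. }
  replace (c - c - (lx * h + ly * k)) with (- (lx * h + ly * k)) in Hd2 by ring.
  rewrite Rabs_Ropp in Hd2.
  assert (B : Rabs (lx * h + ly * k) <= eps * m / 2 * Rabs h).
  { eapply Rle_trans; [exact Hd2|].
    apply Rle_trans with (eps * m / (2 * (1 + L)) * ((1 + L) * Rabs h)).
    - apply Rmult_le_compat_l; lra.
    - apply Req_le; field; lra. }
  replace (k / h - - lx / ly) with ((lx * h + ly * k) / (ly * h)) by (field; split; lra).
  unfold Rdiv; rewrite Rabs_mult, Rabs_inv, Rabs_mult, (Rabs_pos_eq ly) by lra.
  apply Rmult_lt_reg_r with (ly * Rabs h); [apply Rmult_lt_0_compat; lra|].
  rewrite Rmult_assoc, Rinv_l, Rmult_1_r by (apply Rgt_not_eq, Rmult_lt_0_compat; lra).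
  eapply Rle_lt_trans; [exact B|].
  apply Rle_lt_trans with (eps * ly / 2 * Rabs h).
  - apply Rmult_le_compat_r; [lra|]. nra.
  - assert (0 < eps * ly * Rabs h) by (repeat apply Rmult_lt_0_compat; lra). lra.
Qed.

Lemma Kfun_surj X Y : exists p, Kfun X p = Y.
Proof.
  assert (Hm : 0 < 1 + 3 * X ^ 2) by (assert (H := pow2_ge_0 X); lra).
  set (M := (1 + 3 * X ^ 2) / 2 * Rabs Y).
  assert (HM : 0 <= M) by (apply Rmult_le_pos; [lra | apply Rabs_pos]).
  assert (HK : 2 / (1 + 3 * X ^ 2) * M = Rabs Y) by (unfold M; field; lra).
  destruct (Kfun_incr X (- (PI / 2)) (- (PI / 2) + M)) as [H1 _]; [lra|].
  destruct (Kfun_incr X (- (PI / 2) - M) (- (PI / 2))) as [H2 _]; [lra|].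
  rewrite Kfun_start in *.
  replace (- (PI / 2) + M - - (PI / 2)) with M in H1 by ring.
  replace (- (PI / 2) - (- (PI / 2) - M)) with M in H2 by ring.
  rewrite HK in *.
  destruct (IVT_gen (Kfun X) (- (PI / 2) - M) (- (PI / 2) + M) Y) as (p & _ & Hp).
  - intros t; apply continuity_pt_filterlim, continuous_Kfun.
  - assert (HY := Rle_abs Y); assert (HY' := Rle_abs (- Y)); rewrite Rabs_Ropp in HY'.
    split; [eapply Rle_trans; [apply Rmin_l|] | eapply Rle_trans; [|apply Rmax_r]]; lra.
  - exists p; assumption.
Qed.

Definition phi (X Y : R) : R := epsilon (inhabits 0) (fun p => Kfun X p = Y).

Lemma Kfun_phi X Y : Kfun X (phi X Y) = Y.
Proof. unfold phi; apply epsilon_spec, Kfun_surj. Qed.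

Lemma phi_Kfun X p : phi X (Kfun X p) = p.
Proof. apply Kfun_inj with X, Kfun_phi. Qed.

Lemma phi_unique X Y p : Kfun X p = Y -> phi X Y = p.
Proof. intros <-; apply phi_Kfun. Qed.

Lemma phi_0 X : phi X 0 = - (PI / 2).
Proof. apply phi_unique, Kfun_start. Qed.

Lemma phi_top X : phi X (2 * Ystar' X) = PI / 2.
Proof. apply phi_unique, Kfun_top. Qed.

Lemma phi_mid X : phi X (Ystar' X) = 0.
Proof. apply phi_unique, Kfun_mid. Qed.

Lemma phi_lt X Y1 Y2 : Y1 < Y2 <-> phi X Y1 < phi X Y2.
Proof. rewrite <- (Kfun_lt_iff X (phi X Y1) (phi X Y2)), !Kfun_phi; reflexivity. Qed.

Lemma phi_bound X Y : Rabs (phi X Y) <= PI / 2 + (1 + 3 * X ^ 2) / 2 * Rabs Y.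
Proof.
  assert (Hm : 0 < 1 + 3 * X ^ 2) by (assert (H := pow2_ge_0 X); lra).
  assert (Hpi := PI_RGT_0).
  assert (B : Rabs (phi X Y + PI / 2) <= (1 + 3 * X ^ 2) / 2 * Rabs Y).
  { apply Rmult_le_reg_l with (2 / (1 + 3 * X ^ 2)).
    { apply Rdiv_lt_0_compat; lra. }
    replace (2 / (1 + 3 * X ^ 2) * ((1 + 3 * X ^ 2) / 2 * Rabs Y)) with (Rabs Y) by (field; lra).
    assert (E := Kfun_phi X Y); set (p := phi X Y) in *.
    destruct (Rle_lt_dec (- (PI / 2)) p) as [H | H].
    - destruct (Kfun_incr X (- (PI / 2)) p H) as [H1 _]; rewrite Kfun_start in H1.
      rewrite (Rabs_pos_eq (p + PI / 2)) by lra. assert (H2 := Rle_abs Y).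
      replace (p - - (PI / 2)) with (p + PI / 2) in H1 by ring; lra.
    - destruct (Kfun_incr X p (- (PI / 2))) as [H1 _]; [lra|]; rewrite Kfun_start in H1.
      rewrite (Rabs_left (p + PI / 2)) by lra. assert (H2 := Rle_abs (- Y)).
      rewrite Rabs_Ropp in H2.
      replace (- (PI / 2) - p) with (- (p + PI / 2)) in H1 by ring; lra. }
  replace (phi X Y) with (phi X Y + PI / 2 + - (PI / 2)) by ring.
  eapply Rle_trans; [apply Rabs_triang|]. rewrite Rabs_Ropp, (Rabs_pos_eq (PI / 2)) by lra. lra.
Qed.

(* [1 / dens] as a polynomial in the generators of [AN_elementary]. *)
Definition idens (X p : R) : R := 1 + 3 * (X ^ 2 * cos p ^ 6) * wroot X p ^ 2.

Lemma idens_dens X p : idens X p * dens X p = 1.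
Proof. rewrite Rmult_comm; apply dens_eq. Qed.

Lemma idens_eq X p : idens X p = / dens X p.
Proof.
  assert (H := dens_pos X p); apply Rmult_eq_reg_r with (dens X p); [|lra].
  rewrite idens_dens, Rinv_l; lra.
Qed.

Lemma AN_idens x1 x2 y1 y2 : AN (box x1 x2 y1 y2) idens.
Proof. apply AN_elementary; unfold idens; ga. Qed.

(** Like [phi_Y], a function of (X, p) and not of (X, Y): these are the right-hand sides of the
    system solved by [phi], in the form that [AN_flow] takes. They are - K_X / K_p and 1 / K_p, with
    division by [dens] replaced by multiplication by [idens]. *)
Definition phi_X (X p : R) : R := - Kfun_X X p * idens X p / 2.

Definition phi_Y (X p : R) : R := idens X p / 2.

Lemma partials_phi : partials all2 phi (fun X Y => phi_X X (phi X Y))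
  (fun X Y => phi_Y X (phi X Y)).
Proof.
  intros X Y _; split.
  - replace (phi_X X (phi X Y)) with (- Kfun_X X (phi X Y) / (2 * dens X (phi X Y))).
    2: { unfold phi_X; rewrite idens_eq; assert (H := dens_pos X (phi X Y)); field; lra. }
    set (M := Rmax (Rabs (X - 1)) (Rabs (X + 1))).
    apply (is_derive_implicit Kfun Kfun_X (fun X p => 2 * dens X p) (fun X => phi X Y) Y
      (2 * / (1 + 3 * M ^ 2)) X (mkposreal 1 Rlt_0_1)).
    + apply partials_Kfun.
    + intros; apply AN_box_continuity, AN_Kfun_X.
    + intros; apply Kfun_phi.
    + apply Rmult_lt_0_compat; [lra|]; apply Rinv_0_lt_compat.
      assert (H := pow2_ge_0 M); lra.
    + simpl pos; intros x y Hx; apply Rmult_le_compat_l; [lra|].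
      eapply Rle_trans; [|apply dens_bounds].
      assert (H := pow2_ge_0 x); apply Rinv_le_contravar; [lra|].
      apply Rplus_le_compat_l, Rmult_le_compat_l; [lra|].
      rewrite <- (pow2_abs x); apply pow_incr; split; [apply Rabs_pos|].
      apply Rabs_def2 in Hx; apply RmaxAbs; lra.
  - replace (phi_Y X (phi X Y)) with (- (-1) / (2 * dens X (phi X Y))).
    2: { unfold phi_Y; rewrite idens_eq; assert (H := dens_pos X (phi X Y)); field; lra. }
    (* Here X is frozen and Y plays the part of the parameter, in the equation Kfun X p - Y = 0. *)
    apply (is_derive_implicit (fun Y p => Kfun X p - Y) (fun _ _ => -1)
      (fun _ p => 2 * dens X p) (fun Y => phi X Y) 0
      (2 * / (1 + 3 * X ^ 2)) Y (mkposreal 1 Rlt_0_1)).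
    + intros y p _; split; [auto_derive; trivial; ring|].
      replace (2 * dens X p) with (2 * dens X p - 0) by ring.
      apply Rderive_minus; [apply is_derive_Kfun|].
      apply Rderive_const.
    + intros; apply continuity_2d_pt_const.
    + intros y; rewrite Kfun_phi; ring.
    + apply Rmult_lt_0_compat; [lra|]; apply Rinv_0_lt_compat.
      assert (H := pow2_ge_0 X); lra.
    + simpl pos; intros x y Hx; apply Rmult_le_compat_l; [lra | apply dens_bounds].
Qed.

(** The coefficients of the system are under control only on bounded boxes. The a priori bound
    [phi_bound] confines [phi] to (-L, L) as long as (X, Y) stays in the given box. *)
Lemma AN_phi_comp (H : R -> R -> R) : (forall x1 x2 y1 y2, AN (box x1 x2 y1 y2) H) ->
  forall x1 x2 y1 y2, AN (box x1 x2 y1 y2) (fun X Y => H X (phi X Y)).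
Proof.
  intros HH x1 x2 y1 y2.
  set (M := Rmax (Rabs x1) (Rabs x2)); set (N := Rmax (Rabs y1) (Rabs y2)).
  set (L := PI / 2 + (1 + 3 * M ^ 2) / 2 * N + 1).
  apply (AN_flow (box x1 x2 y1 y2) (box x1 x2 (- L) L) phi_X phi_Y).
  - apply open2_box.
  - apply open2_box.
  - intros x y [Hx Hy]; split; [assumption|].
    assert (B : Rabs (phi x y) < L).
    { eapply Rle_lt_trans; [apply phi_bound|]. unfold L.
      assert (Mx : Rabs x <= M) by (apply RmaxAbs; lra).
      assert (Ny : Rabs y <= N) by (apply RmaxAbs; lra).
      assert (x ^ 2 <= M ^ 2).
      { rewrite <- (pow2_abs x); apply pow_incr; split; [apply Rabs_pos | assumption]. }
      assert (Hx2 := pow2_ge_0 x).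
      assert ((1 + 3 * x ^ 2) / 2 * Rabs y <= (1 + 3 * M ^ 2) / 2 * N).
      { apply Rmult_le_compat; [lra | apply Rabs_pos | lra | assumption]. }
      lra. }
    apply Rabs_def2 in B; lra.
  - unfold phi_X, Rdiv. apply AN_mult; [apply AN_mult; [apply AN_opp, AN_Kfun_X | apply AN_idens] | apply AN_const].
  - unfold phi_Y, Rdiv. apply AN_mult; [apply AN_idens | apply AN_const].
  - intros x y _; apply partials_phi; exact I.
  - apply HH.
Qed.

Lemma continuity_phi X Y : continuity_2d_pt phi X Y.
Proof.
  apply AN_box_continuity. intros; apply (AN_phi_comp (fun _ p => p)).
  intros; apply AN_snd.
Qed.

(** * The profile, its derivatives and its primitive *)

Definition afun (X p : R) : R := X * cos p ^ 2 * wroot X p.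

(** Not the derivative of [afun] at fixed p: this is the X-derivative of [A] at fixed Y, expressed
    in (X, p). In the same way [afun_Y] stands for the Y-derivative of [A], and [ifun] for the
    integral of [A_X] from 0 to Y. *)
Definition afun_X (X p : R) : R :=
  cos p ^ 2 * dens X p + X * sin p * cos p * wroot X p * Kfun_X X p.

Definition afun_Y (X p : R) : R := - (X * sin p * cos p * wroot X p).

(** Found by requiring that the field (A - 3/2 X, Y/2 - A_I), along which [A_pde] makes A decay at
    rate 1/2, be the image of (- a/2, - b/2). With b = 2 tan p the second component reads p' = - sin
    p cos p / 2. Differentiating Y = Kfun X p along the field then gives Y/2 - A_I = (A - 3/2 X)
    Kfun_X - sin p cos p dens, which is solved for A_I. *)
Definition ifun (X p : R) : R :=
  (3 / 2 * X - afun X p) * Kfun_X X p + Kfun X p / 2 + sin p * cos p * dens X p.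

Definition A (X Y : R) : R := afun X (phi X Y).

Lemma AN_afun x1 x2 y1 y2 : AN (box x1 x2 y1 y2) afun.
Proof. apply AN_elementary; unfold afun; ga. Qed.

Lemma AN_afun_Y x1 x2 y1 y2 : AN (box x1 x2 y1 y2) afun_Y.
Proof. apply AN_elementary; unfold afun_Y; ga. Qed.

Lemma AN_afun_X x1 x2 y1 y2 : AN (box x1 x2 y1 y2) afun_X.
Proof.
  unfold afun_X.
  apply (AN_plus _ (fun X p => cos p ^ 2 * dens X p)
    (fun X p => X * sin p * cos p * wroot X p * Kfun_X X p)).
  - apply AN_elementary; ga.
  - apply (AN_mult _ (fun X p => X * sin p * cos p * wroot X p)); [|apply AN_Kfun_X].
    apply AN_elementary; ga.
Qed.

Lemma AN_A x1 x2 y1 y2 : AN (box x1 x2 y1 y2) A.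
Proof. apply (AN_phi_comp afun), AN_afun. Qed.

(** These are the derivatives at fixed p. The first collapses to [cos p ^ 2 * dens X p] because w (1
    + 3 Z w^2) - 2 Z w^3 = w + Z w^3 = 1. *)
Lemma partials_afun U : partials U afun (fun X p => cos p ^ 2 * dens X p)
  (fun X p => - (2 * X * sin p * cos p * wroot X p * dens X p)).
Proof.
  intros X p Hp; destruct (partials_wroot U X p Hp) as [H1 H2].
  assert (E := wroot_eq X p); assert (E' := dens_eq X p).
  unfold afun; split.
  - apply is_derive_ext with (fun X => cos p ^ 2 * (X * wroot X p)); [intros; req; ring|].
    apply is_derive_scal.
    replace (dens X p) with (1 * wroot X p + X * wroot_X X p).
    + apply (is_derive_mult (fun t => t) (fun t => wroot t p)); [|exact H1|intros; apply Rmult_comm].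
      apply (is_derive_id (K := R_AbsRing)).
    + unfold wroot_X. set (w := wroot X p) in *; set (e := dens X p) in *.
      set (Z := X ^ 2 * cos p ^ 6) in *.
      replace (1 * w + X * (- w ^ 3 * e * (2 * X * cos p ^ 6))) with
        (w - 2 * Z * w ^ 3 * e) by (unfold Z; ring).
      transitivity (e * (w * (1 + 3 * Z * w ^ 2) - 2 * Z * w ^ 3)).
      { transitivity (w * (e * (1 + 3 * Z * w ^ 2)) - 2 * Z * w ^ 3 * e); [rewrite E'|]; ring. }
      transitivity (e * (w + Z * w ^ 3)); [ring|]. rewrite E; ring.
  - apply is_derive_ext with (fun p => X * (cos p ^ 2 * wroot X p)); [intros; req; ring|].
    replace (- (2 * X * sin p * cos p * wroot X p * dens X p)) with
      (X * ((2 * (- sin p) * cos p ^ 1) * wroot X p + cos p ^ 2 * wroot_p X p)).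
    + apply is_derive_scal.
      apply (is_derive_mult (fun t => cos t ^ 2) (fun t => wroot X t)); [|exact H2|intros; apply Rmult_comm].
      auto_derive; trivial; ring.
    + unfold wroot_p. set (w := wroot X p) in *; set (e := dens X p) in *.
      set (Z := X ^ 2 * cos p ^ 6) in *.
      replace (X * (2 * - sin p * cos p ^ 1 * w +
        cos p ^ 2 * (- w ^ 3 * e * - (6 * X ^ 2 * cos p ^ 5 * sin p)))) with
        (- (2 * X * sin p * cos p * (w * 1 - 3 * Z * w ^ 3 * e))) by (unfold Z; ring).
      rewrite <- E' at 1; ring.
Qed.

Lemma partials_phi_comp H Hx Hp : partials all2 H Hx Hp ->
  (forall x y, continuity_2d_pt Hx x y) ->
  partials all2 (fun X Y => H X (phi X Y))
    (fun X Y => Hx X (phi X Y) * 1 + Hp X (phi X Y) * phi_X X (phi X Y))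
    (fun X Y => Hx X (phi X Y) * 0 + Hp X (phi X Y) * phi_Y X (phi X Y)).
Proof.
  intros HH HC; apply (partials_comp all2 all2 H Hx Hp (fun X _ => X) (fun _ _ => 1) (fun _ _ => 0)).
  - apply open2_all2.
  - apply open2_all2.
  - intros; exact I.
  - assumption.
  - intros; apply HC.
  - intros x y _; split; auto_derive; trivial.
  - apply partials_phi.
Qed.

Definition A_X (X Y : R) : R := afun_X X (phi X Y).
Definition A_Y (X Y : R) : R := afun_Y X (phi X Y).
Definition A_I (X Y : R) : R := ifun X (phi X Y).

Lemma partials_A : partials all2 A A_X A_Y.
Proof.
  intros X Y _.
  destruct (partials_phi_comp _ _ _ (partials_afun all2)) with (x := X) (y := Y) as [H1 H2].
  - intros; apply AN_box_continuity; intros; apply AN_elementary; ga.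
  - exact I.
  - assert (E := idens_dens X (phi X Y)); split.
    + match type of H1 with is_derive _ _ ?l => replace (A_X X Y) with l; [exact H1|] end.
      unfold A_X, afun_X, phi_X; set (p := phi X Y) in *.
      transitivity (cos p ^ 2 * dens X p + X * sin p * cos p * wroot X p * Kfun_X X p *
        (idens X p * dens X p)); [field | rewrite E; ring].
    + match type of H2 with is_derive _ _ ?l => replace (A_Y X Y) with l; [exact H2|] end.
      unfold A_Y, afun_Y, phi_Y; set (p := phi X Y) in *.
      transitivity (- (X * sin p * cos p * wroot X p) *
        (idens X p * dens X p)); [field | rewrite E; ring].
Qed.

Lemma continuity_A_X X Y : continuity_2d_pt A_X X Y.
Proof. apply AN_box_continuity; intros; apply (AN_phi_comp afun_X), AN_afun_X. Qed.

Lemma continuity_A_Y X Y : continuity_2d_pt A_Y X Y.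
Proof. apply AN_box_continuity; intros; apply (AN_phi_comp afun_Y), AN_afun_Y. Qed.

Lemma partials_Kfun_X_p X p : is_derive (Kfun_X X) p (2 * dens_X X p).
Proof.
  apply is_derive_scal, (is_derive_RInt (V := R_NormedModule) (dens_X X) _ (- (PI / 2))).
  - apply filter_forall; intros b; apply (RInt_correct (V := R_CompleteNormedModule)).
    apply (ex_RInt_continuous (V := R_CompleteNormedModule)); intros t _.
    apply continuity_2d_snd, AN_box_continuity, AN_dens_X.
  - apply continuity_2d_snd, AN_box_continuity, AN_dens_X.
Qed.

Lemma is_derive_phi_Y X Y : is_derive (fun Y => phi X Y) Y (phi_Y X (phi X Y)).
Proof. apply (partials_phi X Y I). Qed.

(* The closed form of the integral of [A_X]; the underlying identity is
   [(1 + Z w^2) (3 - 2 w) = 1 + 3 Z w^2], a consequence of [w + Z w^3 = 1]. *)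
Lemma is_derive_A_I X Y : is_derive (fun Y => A_I X Y) Y (A_X X Y).
Proof.
  set (p := phi X Y).
  assert (Hs : cos p ^ 2 + sin p ^ 2 = 1).
  { assert (H := sin2_cos2 p); unfold Rsqr in H; lra. }
  assert (E := wroot_eq X p); assert (E' := dens_eq X p).
  assert (D : is_derive (fun p => ifun X p) p
    ((- (- (2 * X * sin p * cos p * wroot X p * dens X p))) * Kfun_X X p +
     (3 / 2 * X - afun X p) * (2 * dens_X X p) + 2 * dens X p / 2 +
     ((cos p ^ 2 - sin p ^ 2) * dens X p + sin p * cos p * dens_p X p))).
  { apply Rderive_plus.
    - apply Rderive_plus.
      + apply (is_derive_mult (fun p => 3 / 2 * X - afun X p) (Kfun_X X));
          [|apply partials_Kfun_X_p|intros; apply Rmult_comm].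
        replace (- - (2 * X * sin p * cos p * wroot X p * dens X p)) with
          (0 - - (2 * X * sin p * cos p * wroot X p * dens X p)) by ring.
        apply (Rderive_minus (fun _ => 3 / 2 * X) (fun p => afun X p));
          [apply Rderive_const | apply (partials_afun all2 X p I)].
      + apply is_derive_div_const, is_derive_Kfun.
    - apply (is_derive_mult (fun p => sin p * cos p) (fun p => dens X p));
        [|apply (partials_dens all2 X p I)|intros; apply Rmult_comm].
      auto_derive; trivial; ring. }
  assert (D2 := is_derive_comp (fun p => ifun X p) (fun Y => phi X Y) Y _ _ D (is_derive_phi_Y X Y)).
  match type of D2 with is_derive _ _ ?l => replace (A_X X Y) with l; [exact D2|] end.
  unfold scal; simpl; unfold mult; simpl.
  unfold A_X, afun_X, phi_Y, afun, dens_X, dens_p, idens; fold p.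
  set (w := wroot X p) in *; set (e := dens X p) in *; set (k := Kfun_X X p).
  set (c := cos p) in *; set (s := sin p) in *.
  set (Z := X ^ 2 * c ^ 6) in *.
  assert (Ht : (1 + Z * w ^ 2) * (3 - 2 * w) = 1 + 3 * Z * w ^ 2).
  { transitivity (3 - 2 * (w + Z * w ^ 3) + 3 * Z * w ^ 2); [ring | rewrite E; ring]. }
  assert (Ez : e * ((1 + Z * w ^ 2) * (3 - 2 * w)) = 1) by (rewrite Ht; exact E').
  set (g := 3 * w ^ 2 * e ^ 3 * (1 + Z * w ^ 2)).
  set (i := 1 + 3 * Z * w ^ 2) in *.
  symmetry.
  (* The intermediate expression keeps two products equal to 1 and the vanishing factor c^2 + s^2 -
     1 unevaluated. Evaluated, it is [A_X]; left as it stands, it agrees identically with the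
     derivative obtained from the chain rule. *)
  transitivity (X * s * c * w * k * (e * i) + c ^ 2 * (e * i) -
    3 * w ^ 2 * e * Z * c ^ 2 * (e * ((1 + Z * w ^ 2) * (3 - 2 * w))) * (e * i) +
    i / 2 * (c ^ 2 + s ^ 2 - 1) * (6 * g * Z - e)).
  { rewrite Ez, E', Hs.
    transitivity (c ^ 2 * (e * i) + X * s * c * w * k - c ^ 2 * (3 * Z * w ^ 2 * e));
      [unfold i | rewrite E']; ring. }
  unfold g, i, Z; clearbody w e k c s; field.
Qed.

(** * The diffeomorphism *)

Lemma analytic2_on_AN (D : R * R -> Prop) (f : R * R -> R) :
  (forall x0 y0, D (x0, y0) -> exists U g, open2 U /\ U x0 y0 /\ AN U g /\
     forall x y, D (x, y) -> U x y -> f (x, y) = g x y) ->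
  analytic2_on D f.
Proof.
  intros H x0 y0 H0; destruct (H x0 y0 H0) as (U & g & HU & HU0 & Hg & E).
  destruct (AN_pseries2 U g x0 y0 HU Hg HU0) as (c & r & Hc & Hs).
  exists c, r; split; [assumption|]; intros x y Hxy Hx Hy.
  destruct (Hs x y Hx Hy) as [H1 H2]. rewrite E; assumption.
Qed.

Lemma analytic2_on_global (D : R * R -> Prop) (f : R * R -> R) g :
  (forall x1 x2 y1 y2, AN (box x1 x2 y1 y2) g) ->
  (forall x y, D (x, y) -> f (x, y) = g x y) -> analytic2_on D f.
Proof.
  intros Hg E; apply analytic2_on_AN; intros x0 y0 _.
  exists (box (x0 - 1) (x0 + 1) (y0 - 1) (y0 + 1)), g.
  auto using open2_box, box_around.
Qed.

Lemma AN_tan x1 x2 p1 p2 : - (PI / 2) < p1 -> p2 < PI / 2 ->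
  AN (box x1 x2 p1 p2) (fun _ p => tan p).
Proof.
  intros H1 H2; apply (AN_system _ (cons (fun _ p => tan p) nil)); [| |ga].
  - intros f [<- | []]; exists (Rmax (Rabs (tan p1)) (Rabs (tan p2))).
    intros x p [_ H]; apply RmaxAbs; left; apply tan_increasing; lra.
  - intros f [<- | []]; exists (fun _ _ => 0), (fun _ p => tan p ^ 2 + 1); split; [|split; ga].
    intros x p [_ H]; split; [apply Rderive_const|].
    apply is_derive_tan; apply Rgt_not_eq, cos_gt_0; lra.
Qed.

Lemma AN_atan_half x1 x2 y1 y2 : AN (box x1 x2 y1 y2) (fun _ b => atan (b / 2)).
Proof.
  assert (Pos : forall b, 1 <= 1 + (b / 2) ^ 2).
  { intros b; assert (H := pow2_ge_0 (b / 2)); lra. }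
  apply (AN_system _ (cons (fun _ b => b) (cons (fun _ b => / (1 + (b / 2) ^ 2))
    (cons (fun _ b => atan (b / 2)) nil)))); [| |ga].
  - intros f [<- | [<- | [<- | []]]].
    + exists (Rmax (Rabs y1) (Rabs y2)); intros x b [_ H]; apply RmaxAbs; lra.
    + exists 1; intros x b _; specialize (Pos b); apply Rabs_le; split.
      * apply Rle_trans with 0; [lra|]; left; apply Rinv_0_lt_compat; lra.
      * apply Rinv_ge1_le1; assumption.
    + exists (PI / 2); intros x b _; apply Rabs_le; assert (H := atan_bound (b / 2)); lra.
  - intros f [<- | [<- | [<- | []]]].
    + exists (fun _ _ => 0), (fun _ _ => 1); split; [|split; ga].
      intros x b _; split; auto_derive; trivial.
    + exists (fun _ _ => 0), (fun _ b => - (b * / 2 * (/ (1 + (b / 2) ^ 2)) ^ 2)).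
      split; [|split; ga].
      intros x b _; specialize (Pos b); split; auto_derive; trivial; [simpl in Pos; lra|].
      field; simpl in Pos; nra.
    + exists (fun _ _ => 0), (fun _ b => / 2 * / (1 + (b / 2) ^ 2)).
      split; [|split; ga].
      intros x b _; split; [apply Rderive_const|].
      apply (is_derive_comp atan (fun b => b / 2)).
      * apply is_derive_Reals, derivable_pt_lim_atan.
      * auto_derive; trivial; field.
Qed.

Definition Xab (a b : R) : R := a + a ^ 3 + b ^ 2 * a / 4.

(** Both sides solve (1 + (b/2)^2) a + a^3 = X: multiply the equation of w by X and use 1 + (b/2)^2
    = 1 / cos^2 p. *)
Lemma afun_Xab a b : afun (Xab a b) (atan (b / 2)) = a.
Proof.
  assert (Hb := pow2_ge_0 (b / 2)).
  assert (C := cos_atan2 (b / 2)).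
  set (c := cos (atan (b / 2))) in *. set (X := Xab a b).
  assert (E := wroot_eq X (atan (b / 2))); fold c in E.
  unfold afun; fold c; set (w := wroot X (atan (b / 2))) in *.
  apply (cubic_inj (1 + (b / 2) ^ 2) 1); [lra | lra|].
  transitivity X; [|unfold X, Xab; field].
  assert (C' : (1 + (b / 2) ^ 2) * c ^ 2 = 1) by (rewrite C; field; lra).
  transitivity (X * (((1 + (b / 2) ^ 2) * c ^ 2) * w + X ^ 2 * c ^ 6 * w ^ 3)); [ring|].
  rewrite C', Rmult_1_l, E; ring.
Qed.

Lemma Xab_afun X p : 0 < cos p -> Xab (afun X p) (2 * tan p) = X.
Proof.
  intros Hc; assert (E := wroot_eq X p).
  assert (Hs := sin2_cos2 p); unfold Rsqr in Hs.
  unfold Xab, afun, tan; set (c := cos p) in *; set (s := sin p) in *.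
  set (w := wroot X p) in *.
  transitivity (X * (w * (s * s + c * c) + X ^ 2 * c ^ 6 * w ^ 3)); [field; lra|].
  rewrite Hs, Rmult_1_r, E; ring.
Qed.

Lemma Phi'_inj p q : Phi' p = Phi' q -> p = q.
Proof.
  destruct p as [a b], q as [a' b']; rewrite !Phi'_eq.
  fold (Xab a b) (Xab a' b'); intros H; injection H as H1 H2.
  rewrite <- H1 in H2; apply Kfun_inj in H2.
  assert (Ha := afun_Xab a b); assert (Ha' := afun_Xab a' b').
  rewrite <- H1, <- H2, Ha in Ha'; subst a'; f_equal.
  apply (f_equal tan) in H2; rewrite !tan_atan in H2; lra.
Qed.

Lemma strip_phi X Y : strip (X, Y) <-> - (PI / 2) < phi X Y < PI / 2.
Proof.
  unfold strip; simpl. rewrite <- (phi_0 X), <- (phi_top X) at 1.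
  rewrite <- !phi_lt; reflexivity.
Qed.

Lemma Phi'_surj X Y : strip (X, Y) -> Phi' (A X Y, 2 * tan (phi X Y)) = (X, Y).
Proof.
  intros H; apply strip_phi in H.
  rewrite Phi'_eq; fold (Xab (A X Y) (2 * tan (phi X Y))).
  unfold A; rewrite Xab_afun by (apply cos_gt_0; lra).
  replace (2 * tan (phi X Y) / 2) with (tan (phi X Y)) by field.
  rewrite atan_tan by lra; rewrite Kfun_phi; reflexivity.
Qed.

Lemma Phi'_inv_left p : Phi'_inv (Phi' p) = p.
Proof.
  apply Phi'_inj; unfold Phi'_inv.
  apply (epsilon_spec (inhabits (0, 0)) (fun p' => Phi' p' = Phi' p)).
  exists p; reflexivity.
Qed.

Lemma Phi'_inv_eq X Y : strip (X, Y) -> Phi'_inv (X, Y) = (A X Y, 2 * tan (phi X Y)).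
Proof. intros H; rewrite <- (Phi'_surj X Y H) at 1; apply Phi'_inv_left. Qed.

Lemma Phi'_strip p : strip (Phi' p).
Proof.
  destruct p as [a b]; rewrite Phi'_eq; unfold strip; cbv beta iota delta [fst snd].
  set (X := a + a ^ 3 + b ^ 2 * a / 4); assert (H := atan_bound (b / 2)).
  split; [rewrite <- (Kfun_start X) | rewrite <- (Kfun_top X)]; apply Kfun_lt; lra.
Qed.

Lemma AN_Xab x1 x2 y1 y2 : AN (box x1 x2 y1 y2) Xab.
Proof. unfold Xab, Rdiv; an. Qed.

Lemma Phi'_diffeo : analytic_diffeo_onto strip Phi' Phi'_inv.
Proof.
  split; [apply Phi'_strip|]; split; [apply Phi'_inv_left|]; split; [|split].
  - intros [X Y] H; rewrite Phi'_inv_eq by assumption; apply Phi'_surj, H.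
  - split.
    + apply analytic2_on_global with Xab; [apply AN_Xab|].
      intros; rewrite Phi'_eq; reflexivity.
    + apply analytic2_on_global with (fun a b => Kfun (Xab a b) (atan (b / 2))).
      2: { intros; rewrite Phi'_eq; reflexivity. }
      intros x1 x2 y1 y2.
      (* [Kfun] is analytic with uniform constants on boxes, so the first component has to be
         bounded before composing. *)
      destruct (AN_bounded _ _ (open2_box x1 x2 y1 y2) (AN_Xab x1 x2 y1 y2)) as (M & _ & HM).
      apply (AN_comp _ (box (- (M + 1)) (M + 1) (- (PI / 2)) (PI / 2)) Kfun Xab
        (fun _ b => atan (b / 2))); auto using open2_box, AN_Kfun, AN_Xab, AN_atan_half.
      intros a b Hab; split; [|assert (H := atan_bound (b / 2)); lra].
      assert (H := HM a b Hab); apply Rabs_le_between in H; lra.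
  - split.
    + apply analytic2_on_global with A; [apply AN_A|].
      intros X Y H; rewrite Phi'_inv_eq by assumption; reflexivity.
    + apply analytic2_on_AN; intros X0 Y0 H0.
      assert (Hp := proj1 (strip_phi X0 Y0) H0).
      (* Half the distance to the poles of tan: [phi] is kept in an interval with closure inside
         (-PI/2, PI/2). *)
      assert (Hd : 0 < Rmin (phi X0 Y0 + PI / 2) (PI / 2 - phi X0 Y0) / 2).
      { apply Rdiv_lt_0_compat; [apply Rmin_pos|]; lra. }
      set (d := Rmin (phi X0 Y0 + PI / 2) (PI / 2 - phi X0 Y0) / 2) in *.
      assert (Hd1 : 2 * d <= phi X0 Y0 + PI / 2) by (unfold d; field_simplify; apply Rmin_l).
      assert (Hd2 : 2 * d <= PI / 2 - phi X0 Y0) by (unfold d; field_simplify; apply Rmin_r).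
      destruct (continuity_phi X0 Y0 (mkposreal d Hd)) as [e He]; simpl in He.
      set (U := box (X0 - e) (X0 + e) (Y0 - e) (Y0 + e)).
      assert (HU : forall x y, U x y -> Rabs (phi x y - phi X0 Y0) < d).
      { intros x y [Hx Hy]; apply He; apply Rabs_def1; lra. }
      assert (He0 := cond_pos e).
      exists U, (fun X Y => 2 * tan (phi X Y)).
      split; [apply open2_box|]; split; [split; lra|]; split.
      * apply (AN_mult _ (fun _ _ => 2)); [apply AN_const|].
        apply (AN_comp U (box (X0 - e) (X0 + e) (phi X0 Y0 - d) (phi X0 Y0 + d))
          (fun _ p => tan p) (fun X _ => X) phi); try apply open2_box.
        -- intros x y Hxy; split; [apply Hxy|]. assert (H := HU x y Hxy).
           apply Rabs_def2 in H; lra.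
        -- apply AN_tan; lra.
        -- apply AN_fst.
        -- apply (AN_phi_comp (fun _ p => p)); intros; apply AN_snd.
      * intros X Y H _; rewrite Phi'_inv_eq by assumption; reflexivity.
Qed.

Lemma partials_Xab U : partials U Xab (fun a b => 1 + 3 * a ^ 2 + b ^ 2 / 4)
  (fun a b => a * b / 2).
Proof. intros a b _; unfold Xab; split; auto_derive; trivial; field. Qed.

(** The terms in [Kfun_X] cancel in the determinant. What remains is dens (1 + 3 a^2 + b^2/4) / (1 +
    (b/2)^2), and this is 1 because [dens] is the inverse of 1 + 3 a^2 cos^2 p. *)
Lemma Phi'_volume : volume_preserving Phi'.
Proof.
  intros a b.
  assert (Hv : partials all2 (fun _ b => atan (b / 2)) (fun _ _ => 0)
    (fun _ b => / 2 * / (1 + (b / 2) ^ 2))).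
  { intros x y _; split; [apply Rderive_const|].
    apply (is_derive_comp atan (fun b => b / 2)).
    - apply is_derive_Reals, derivable_pt_lim_atan.
    - auto_derive; trivial; field. }
  destruct (partials_comp all2 all2 Kfun Kfun_X (fun X p => 2 * dens X p) Xab _ _ _ _ _
    open2_all2 open2_all2 (fun _ _ _ => I) partials_Kfun
    (fun x y _ => AN_box_continuity _ AN_Kfun_X x y) (partials_Xab all2) Hv a b I) as [H1 H2].
  destruct (partials_Xab all2 a b I) as [H3 H4].
  do 4 eexists; split; [|split; [|split; [|split]]].
  - apply is_derive_ext with (2 := H3); reflexivity.
  - apply is_derive_ext with (2 := H4); reflexivity.
  - apply is_derive_ext with (2 := H1); intros; rewrite Phi'_eq; reflexivity.
  - apply is_derive_ext with (2 := H2); intros; rewrite Phi'_eq; reflexivity.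
  - cbv beta.
    set (X := Xab a b); set (p := atan (b / 2)).
    assert (E := dens_eq X p); assert (Ea := afun_Xab a b); fold X p in Ea.
    assert (C := cos_atan2 (b / 2)); fold p in C.
    assert (Hb := pow2_ge_0 (b / 2)).
    assert (En : dens X p * (1 + 3 * a ^ 2 + b ^ 2 / 4) = 1 + (b / 2) ^ 2).
    { replace (1 + 3 * a ^ 2 + b ^ 2 / 4) with
        ((1 + (b / 2) ^ 2) * (1 + 3 * a ^ 2 * / (1 + (b / 2) ^ 2))).
      2: { field; lra. }
      rewrite <- C. rewrite <- Ea at 1.
      replace (3 * afun X p ^ 2 * cos p ^ 2) with (3 * (X ^ 2 * cos p ^ 6) * wroot X p ^ 2)
        by (unfold afun; ring).
      transitivity ((1 + (b / 2) ^ 2) * (dens X p * (1 + 3 * (X ^ 2 * cos p ^ 6) * wroot X p ^ 2)));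
        [ring | rewrite E; ring]. }
    match goal with |- Rabs ?t = 1 =>
      replace t with (dens X p * (1 + 3 * a ^ 2 + b ^ 2 / 4) * / (1 + (b / 2) ^ 2)) by (field; nra) end.
    rewrite En, Rinv_r, Rabs_R1 by lra; reflexivity.
Qed.

Lemma analytic_ext f g : (forall x, f x = g x) -> analytic f -> analytic g.
Proof.
  intros E H x0; destruct (H x0) as (c & r & Hc); exists c, r.
  intros x Hx; rewrite <- E; auto.
Qed.

Lemma Ystar'_analytic : analytic Ystar'.
Proof.
  apply analytic_ext with (fun X => / 2 * Kfun X (PI / 2)).
  { intros X; rewrite Ystar'_Kfun; field. }
  intros x0.
  apply (AN_pseries1 (box (x0 - 1) (x0 + 1) (PI / 2 - 1) (PI / 2 + 1))
    (fun X p => / 2 * Kfun X p) x0 (PI / 2)).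
  - apply open2_box.
  - apply (AN_mult _ (fun _ _ => / 2)); [apply AN_const | apply AN_Kfun].
  - apply box_around.
Qed.

(** * The profile *)

Lemma cos_phi_0 X Y : phi X Y = - (PI / 2) \/ phi X Y = PI / 2 -> cos (phi X Y) = 0.
Proof. intros [-> | ->]; [rewrite cos_neg|]; apply cos_PI2. Qed.

Lemma A_vanish X Y : cos (phi X Y) = 0 -> A X Y = 0.
Proof. intros H; unfold A, afun; rewrite H; ring. Qed.

Lemma A_X_vanish X Y : cos (phi X Y) = 0 -> A_X X Y = 0.
Proof. intros H; unfold A_X, afun_X; rewrite H; ring. Qed.

Lemma A_Y_vanish X Y : cos (phi X Y) = 0 -> A_Y X Y = 0.
Proof. intros H; unfold A_Y, afun_Y; rewrite H; ring. Qed.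

Lemma A_I_start X : A_I X 0 = 0.
Proof.
  unfold A_I, ifun. rewrite phi_0, Kfun_start, Kfun_X_start, cos_neg, cos_PI2; field.
Qed.

Lemma RInt_A_X X Y : is_RInt (A_X X) 0 Y (A_I X Y).
Proof.
  replace (A_I X Y) with (A_I X Y - A_I X 0) by (rewrite A_I_start; ring).
  apply (is_RInt_derive (V := R_CompleteNormedModule) (A_I X) (A_X X)).
  - intros y _; apply is_derive_A_I.
  - intros y _; apply continuity_2d_snd, continuity_A_X.
Qed.

(** With the formula for [ifun] the terms in [Kfun] and [Kfun_X] cancel. What is left is X cos^2 p /
    2 times w - 3 e + 2 w e, with e = [dens], and it vanishes by the two equations for w and e. *)
Lemma A_pde X Y : A X Y / 2 - 3 / 2 * X * A_X X Y + Y / 2 * A_Y X Y +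
  A X Y * A_X X Y - A_I X Y * A_Y X Y = 0.
Proof.
  (* Only the explicit coefficient Y/2 is rewritten, so that it can cancel against the term Kfun/2
     of [ifun]. *)
  rewrite <- (Kfun_phi X Y) at 3.
  unfold A, A_X, A_Y, A_I, ifun, afun_X, afun_Y, afun; set (p := phi X Y).
  assert (Hs : cos p ^ 2 + sin p ^ 2 = 1).
  { assert (H := sin2_cos2 p); unfold Rsqr in H; lra. }
  assert (E := wroot_eq X p); assert (E' := dens_eq X p).
  set (w := wroot X p) in *; set (e := dens X p) in *; set (k := Kfun_X X p).
  set (K := Kfun X p). set (c := cos p) in *; set (s := sin p) in *.
  set (Z := X ^ 2 * c ^ 6) in *.
  transitivity (X * c ^ 2 / 2 * (w - 3 * e + 2 * w * e * (c ^ 2 + s ^ 2))); [field|].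
  rewrite Hs.
  transitivity (X * c ^ 2 / 2 * (w * (1 - e * (1 + 3 * Z * w ^ 2)) + 3 * e * (w + Z * w ^ 3 - 1)));
    [field | rewrite E, E'; ring].
Qed.

(** * Extension by zero outside the strip *)

(** The sign change from A to the profile is built in, so that the same operation produces [Theta']
    and both its derivatives, from [A], [A_X] and [A_Y]. *)
Definition cut (f : R -> R -> R) (X Y : R) : R :=
  if Rlt_dec 0 Y then if Rlt_dec Y (2 * Ystar' X) then - f X Y else 0 else 0.

Lemma cut_in f X Y : strip (X, Y) -> cut f X Y = - f X Y.
Proof.
  intros [H1 H2]; simpl in *; unfold cut.
  destruct (Rlt_dec 0 Y); [|lra]; destruct (Rlt_dec Y (2 * Ystar' X)); lra.
Qed.

Lemma cut_out f X Y : ~ strip (X, Y) -> cut f X Y = 0.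
Proof.
  intros H; unfold cut.
  destruct (Rlt_dec 0 Y); [|reflexivity]; destruct (Rlt_dec Y (2 * Ystar' X)); [|reflexivity].
  exfalso; apply H; split; assumption.
Qed.

Lemma cut_le f X Y : Rabs (cut f X Y) <= Rabs (f X Y).
Proof.
  unfold cut; destruct (Rlt_dec 0 Y); [destruct (Rlt_dec Y (2 * Ystar' X))|].
  - rewrite Rabs_Ropp; lra.
  - rewrite Rabs_R0; apply Rabs_pos.
  - rewrite Rabs_R0; apply Rabs_pos.
Qed.

Lemma Theta'_cut X Y : Theta' (X, Y) = cut A X Y.
Proof.
  unfold Theta', cut; simpl.
  destruct (Rlt_dec 0 Y); [|reflexivity]; destruct (Rlt_dec Y (2 * Ystar' X)); [|reflexivity].
  rewrite Phi'_inv_eq by (split; assumption); reflexivity.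
Qed.

Lemma locally_phi_lt X Y v : phi X Y < v -> locally_2d (fun x y => phi x y < v) X Y.
Proof.
  intros H; destruct (continuity_phi X Y (mkposreal (v - phi X Y) ltac:(lra))) as [d Hd].
  exists d; intros x y Hx Hy; specialize (Hd x y Hx Hy); simpl in Hd.
  apply Rabs_def2 in Hd; lra.
Qed.

Lemma locally_phi_gt X Y v : v < phi X Y -> locally_2d (fun x y => v < phi x y) X Y.
Proof.
  intros H; destruct (continuity_phi X Y (mkposreal (phi X Y - v) ltac:(lra))) as [d Hd].
  exists d; intros x y Hx Hy; specialize (Hd x y Hx Hy); simpl in Hd.
  apply Rabs_def2 in Hd; lra.
Qed.

(** Near a point that lies on neither boundary curve the cut-off function is given by one formula.
    The third alternative is phi = -PI/2 or phi = PI/2, the only place where two formulas meet. *)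
Lemma strip_cases X Y :
  locally_2d (fun x y => strip (x, y)) X Y \/
  locally_2d (fun x y => ~ strip (x, y)) X Y \/
  (~ strip (X, Y) /\ cos (phi X Y) = 0).
Proof.
  destruct (Rtotal_order (phi X Y) (- (PI / 2))) as [H | [H | H]].
  - right; left; apply locally_2d_impl with (2 := locally_phi_lt X Y _ H).
    apply locally_2d_forall; intros x y Hxy; rewrite strip_phi; lra.
  - right; right; split; [rewrite strip_phi; lra | apply cos_phi_0; auto].
  - destruct (Rtotal_order (phi X Y) (PI / 2)) as [H' | [H' | H']].
    + left; apply locally_2d_impl with (2 := locally_phi_lt X Y _ H').
      apply locally_2d_impl with (2 := locally_phi_gt X Y _ H).
      apply locally_2d_forall; intros x y H1 H2; rewrite strip_phi; lra.
    + right; right; split; [rewrite strip_phi; lra | apply cos_phi_0; auto].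
    + right; left; apply locally_2d_impl with (2 := locally_phi_gt X Y _ H').
      apply locally_2d_forall; intros x y Hxy; rewrite strip_phi; lra.
Qed.

Lemma cut_continuity f X Y : continuity_2d_pt f X Y ->
  (cos (phi X Y) = 0 -> f X Y = 0) -> continuity_2d_pt (cut f) X Y.
Proof.
  intros Hf H0; destruct (strip_cases X Y) as [H | [H | [H H']]].
  - apply continuity_2d_pt_ext_loc with (fun x y => - f x y).
    + apply locally_2d_impl with (2 := H); apply locally_2d_forall.
      intros x y Hxy; symmetry; apply cut_in; assumption.
    + apply continuity_2d_pt_opp; assumption.
  - apply continuity_2d_pt_ext_loc with (fun x y => 0).
    + apply locally_2d_impl with (2 := H); apply locally_2d_forall.
      intros x y Hxy; symmetry; apply cut_out; assumption.
    + apply continuity_2d_pt_const.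
  - intros eps; destruct (Hf eps) as [d Hd]; exists d; intros x y Hx Hy.
    rewrite (cut_out f X Y H), Rminus_0_r.
    eapply Rle_lt_trans; [apply cut_le|].
    specialize (Hd x y Hx Hy); rewrite (H0 H'), Rminus_0_r in Hd; exact Hd.
Qed.

(** The gluing argument on the boundary curves: there A vanishes together with its first
    derivatives, and its cut-off is dominated by it. *)
Lemma is_derive_dominated (f g : R -> R) x : is_derive f x 0 -> f x = 0 ->
  (forall t, Rabs (g t) <= Rabs (f t)) -> is_derive g x 0.
Proof.
  intros Hf H0 Hg; apply is_derive_Reals in Hf; apply is_derive_Reals.
  assert (G0 : g x = 0).
  { specialize (Hg x); rewrite H0, Rabs_R0 in Hg.
    destruct (Req_dec (g x) 0) as [H | H]; [assumption|].
    apply Rabs_pos_lt in H; lra. }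
  intros eps Heps; destruct (Hf eps Heps) as [d Hd]; exists d; intros h Hh Hh'.
  specialize (Hd h Hh Hh'); rewrite H0 in Hd; rewrite G0, !Rminus_0_r in *.
  eapply Rle_lt_trans; [|exact Hd]. unfold Rdiv; rewrite !Rabs_mult.
  apply Rmult_le_compat_r; [apply Rabs_pos | apply Hg].
Qed.

Lemma locally_2d_fst (P : R -> R -> Prop) x y :
  locally_2d P x y -> locally x (fun t => P t y).
Proof.
  intros [d Hd]; exists d; intros t Ht; apply Hd; [exact Ht|].
  rewrite Rminus_diag, Rabs_R0; apply cond_pos.
Qed.

Lemma locally_2d_snd (P : R -> R -> Prop) x y :
  locally_2d P x y -> locally y (fun t => P x t).
Proof.
  intros [d Hd]; exists d; intros t Ht; apply Hd; [|exact Ht].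
  rewrite Rminus_diag, Rabs_R0; apply cond_pos.
Qed.

Lemma cut_partials f fx fy : partials all2 f fx fy ->
  (forall X Y, cos (phi X Y) = 0 -> f X Y = 0 /\ fx X Y = 0 /\ fy X Y = 0) ->
  partials all2 (cut f) (cut fx) (cut fy).
Proof.
  intros Hp H0 X Y _; destruct (Hp X Y I) as [Hx Hy].
  destruct (strip_cases X Y) as [H | [H | [H H']]].
  - assert (HS := locally_2d_singleton _ _ _ H); rewrite !cut_in by exact HS; split.
    + apply is_derive_ext_loc with (fun t => - f t Y).
      * apply filter_imp with (2 := locally_2d_fst _ _ _ H).
        intros t Ht; symmetry; apply cut_in; assumption.
      * apply Rderive_opp; assumption.
    + apply is_derive_ext_loc with (fun t => - f X t).
      * apply filter_imp with (2 := locally_2d_snd _ _ _ H).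
        intros t Ht; symmetry; apply cut_in; assumption.
      * apply Rderive_opp; assumption.
  - assert (HS := locally_2d_singleton _ _ _ H); rewrite !(cut_out _ X Y) by exact HS; split.
    + apply is_derive_ext_loc with (fun t => 0).
      * apply filter_imp with (2 := locally_2d_fst _ _ _ H).
        intros t Ht; symmetry; apply cut_out; assumption.
      * apply Rderive_const.
    + apply is_derive_ext_loc with (fun t => 0).
      * apply filter_imp with (2 := locally_2d_snd _ _ _ H).
        intros t Ht; symmetry; apply cut_out; assumption.
      * apply Rderive_const.
  - destruct (H0 X Y H') as (E1 & E2 & E3); rewrite E2 in Hx; rewrite E3 in Hy.
    rewrite !(cut_out _ X Y) by exact H; split.
    + apply (is_derive_dominated (fun t => f t Y)); [exact Hx | exact E1 | intros; apply cut_le].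
    + apply (is_derive_dominated (f X)); [exact Hy | exact E1 | intros; apply cut_le].
Qed.

Lemma partials_cut_A : partials all2 (cut A) (cut A_X) (cut A_Y).
Proof.
  apply cut_partials; [apply partials_A|].
  intros X Y H; auto using A_vanish, A_X_vanish, A_Y_vanish.
Qed.

Lemma continuity_cut_A_X X Y : continuity_2d_pt (cut A_X) X Y.
Proof. apply cut_continuity; [apply continuity_A_X | apply A_X_vanish]. Qed.

Lemma continuity_cut_A_Y X Y : continuity_2d_pt (cut A_Y) X Y.
Proof. apply cut_continuity; [apply continuity_A_Y | apply A_Y_vanish]. Qed.

Lemma cut_closed f X Y : (cos (phi X Y) = 0 -> f X Y = 0) ->
  closed_strip (X, Y) -> cut f X Y = - f X Y.
Proof.
  intros H0 [H1 H2]; simpl in *.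
  destruct (Rle_lt_or_eq_dec _ _ H1) as [H3 | <-].
  - destruct (Rle_lt_or_eq_dec _ _ H2) as [H4 | ->].
    + apply cut_in; split; assumption.
    + rewrite H0 by (rewrite phi_top; apply cos_PI2).
      rewrite cut_out; [ring|]. intros [_ H]; simpl in H; lra.
  - rewrite H0 by (rewrite phi_0, cos_neg; apply cos_PI2).
    rewrite cut_out; [ring|]. intros [H _]; simpl in H; lra.
Qed.

Lemma within_filter_lim (D : R -> Prop) y : is_filter_lim (within D (locally y)) y.
Proof.
  intros P HP; apply filter_imp with (2 := HP); auto.
Qed.

Lemma is_derive_is_half (f : R -> R) (y l : R) :
  0 <= y -> is_derive f y l -> is_derive_half f y l.
Proof.
  intros Hy H.
  assert (PF : ProperFilter (within (fun z => 0 <= z) (locally y))).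
  { split; [|apply within_filter, locally_filter].
    intros P HP; exists y; apply (locally_singleton _ _ HP), Hy. }
  apply (filterdiff_locally (K := R_AbsRing) (U := R_NormedModule)
    (V := R_NormedModule) f y); [apply within_filter_lim | exact H].
Qed.

Lemma is_derive_half_unique (f : R -> R) (y l l' : R) : 0 <= y ->
  is_derive f y l -> is_derive_half f y l' -> l = l'.
Proof.
  intros Hy H [_ H']; apply is_derive_Reals in H.
  specialize (H' y (within_filter_lim _ y)).
  destruct (Req_dec l l') as [E | E]; [assumption|]; exfalso.
  assert (He : 0 < Rabs (l - l') / 2).
  { apply Rdiv_lt_0_compat; [|lra]; apply Rabs_pos_lt; lra. }
  destruct (H' (mkposreal _ He)) as [d Hd]; destruct (H _ He) as [d' Hd'].
  set (h := Rmin d d' / 2).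
  assert (H1 : 0 < Rmin d d') by (apply Rmin_pos; apply cond_pos).
  assert (H2 : Rmin d d' <= d) by apply Rmin_l.
  assert (H3 : Rmin d d' <= d') by apply Rmin_r.
  assert (Hh : 0 < h) by (unfold h; lra).
  assert (Ah : Rabs h = h) by (apply Rabs_pos_eq; lra).
  specialize (Hd' h ltac:(lra) ltac:(rewrite Ah; unfold h; lra)).
  specialize (Hd (y + h)); simpl in Hd.
  unfold norm, minus, plus, opp, scal in Hd; simpl in Hd; unfold abs, mult in Hd; simpl in Hd.
  assert (Hb : ball y d (y + h)).
  { change (Rabs (y + h - y) < d); replace (y + h - y) with h by ring.
    rewrite Ah; unfold h; lra. }
  specialize (Hd Hb ltac:(lra)).
  replace (y + h + - y) with h in Hd by ring. rewrite Ah in Hd.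
  replace (f (y + h) + - f y + - (h * l')) with
    (((f (y + h) - f y) / h - l + (l - l')) * h) in Hd by (field; lra).
  rewrite Rabs_mult, Ah in Hd.
  apply Rmult_le_reg_r in Hd; [|assumption].
  assert (T := Rabs_triang_inv (l - l') (- ((f (y + h) - f y) / h - l))).
  rewrite Rabs_Ropp in T.
  replace (l - l' - - ((f (y + h) - f y) / h - l)) with ((f (y + h) - f y) / h - l + (l - l')) in T by ring.
  lra.
Qed.

Lemma Theta'_dX X Y : is_dX Theta' (X, Y) (cut A_X X Y).
Proof.
  unfold is_dX; simpl; apply is_derive_ext with (fun x => cut A x Y).
  - intros; symmetry; apply Theta'_cut.
  - apply (partials_cut_A X Y I).
Qed.

Lemma Theta'_dY X Y : is_derive (fun y => Theta' (X, y)) Y (cut A_Y X Y).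
Proof.
  apply is_derive_ext with (fun y => cut A X y).
  - intros; symmetry; apply Theta'_cut.
  - apply (partials_cut_A X Y I).
Qed.

Lemma continuous_within_of (D : R * R -> Prop) f :
  (forall x y, continuity_2d_pt f x y) ->
  continuous_within D (fun p => f (fst p) (snd p)).
Proof.
  intros H [x y] _. specialize (H x y); apply continuity_2d_pt_filterlim in H.
  intros P HP; destruct (H P HP) as [e He]; exists e; intros q Hq _; apply He, Hq.
Qed.

Lemma Theta'_C1 : C1_half_plane Theta'.
Proof.
  exists (fun p => cut A_X (fst p) (snd p)), (fun p => cut A_Y (fst p) (snd p)).
  split; [|split].
  - intros [X Y] H; split; [apply Theta'_dX | apply is_derive_is_half, Theta'_dY; exact H].
  - apply continuous_within_of, continuity_cut_A_X.
  - apply continuous_within_of, continuity_cut_A_Y.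
Qed.

Lemma AN_opp_A x1 x2 y1 y2 : AN (box x1 x2 y1 y2) (fun X Y => - A X Y).
Proof. apply AN_opp, AN_A. Qed.

Lemma Theta'_closed X Y : closed_strip (X, Y) -> Theta' (X, Y) = - A X Y.
Proof. intros H; rewrite Theta'_cut; apply cut_closed; [apply A_vanish | assumption]. Qed.

Lemma Theta'_analytic : analytic2_on closed_strip Theta'.
Proof.
  apply analytic2_on_global with (fun X Y => - A X Y); [apply AN_opp_A|].
  intros; apply Theta'_closed; assumption.
Qed.

(** * The periodic extension *)

Lemma phi_period X Y : phi X (Y + 2 * Ystar' X) = phi X Y + PI.
Proof. apply phi_unique; rewrite Kfun_shift, Kfun_phi, Kfun_top; reflexivity. Qed.

Lemma wroot_shift X p : wroot X (p + PI) = wroot X p.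
Proof. unfold wroot; rewrite neg_cos; f_equal; ring. Qed.

Lemma A_period X Y : A X (Y + 2 * Ystar' X) = A X Y.
Proof.
  unfold A, afun; rewrite phi_period, wroot_shift, neg_cos; ring.
Qed.

Lemma periodic_Z (f : R -> R) (T : R) : (forall y, f (y + T) = f y) ->
  forall (k : Z) y, f (y + IZR k * T) = f y.
Proof.
  intros H.
  assert (N : forall (n : nat) y, f (y + INR n * T) = f y).
  { induction n as [|n IH]; intros y; [simpl; f_equal; ring|].
    rewrite S_INR; replace (y + (INR n + 1) * T) with (y + INR n * T + T) by ring.
    rewrite H; apply IH. }
  intros k y; destruct (Z.le_ge_cases 0 k) as [Hk | Hk].
  - rewrite <- (Z2Nat.id k Hk), <- INR_IZR_INZ; apply N.
  - rewrite <- (N (Z.to_nat (- k)) (y + IZR k * T)), INR_IZR_INZ, Z2Nat.id by lia.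
    rewrite opp_IZR; f_equal; ring.
Qed.

Lemma Theta'_bar_eq X Y : Theta'_bar (X, Y) = - A X Y.
Proof.
  unfold Theta'_bar, rmod; simpl; set (T := 2 * Ystar' X); set (k := Int_part (Y / T)).
  assert (HT : 0 < T) by (unfold T; assert (H := Ystar'_pos X); lra).
  destruct (base_Int_part (Y / T)) as [H1 H2]; fold k in H1, H2.
  assert (E : Y / T * T = Y) by (field; lra).
  rewrite Theta'_closed.
  - f_equal. replace (Y - IZR k * T) with (Y + IZR (- k) * T) by (rewrite opp_IZR; ring).
    apply (periodic_Z (A X)); intros; apply A_period.
  - split; simpl; fold T; nra.
Qed.

Lemma Theta'_bar_analytic : analytic2_on half_plane Theta'_bar.
Proof.
  apply analytic2_on_global with (fun X Y => - A X Y); [apply AN_opp_A|].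
  intros; apply Theta'_bar_eq.
Qed.

(** * The Prandtl system *)

Lemma Rpower_half s : 0 < s -> Rpower s (1 / 2) = sqrt s.
Proof. intros H; replace (1 / 2) with (/ 2) by field; apply Rpower_sqrt, H. Qed.

Lemma Rpower_three_halves s : 0 < s -> Rpower s (3 / 2) = sqrt s ^ 3.
Proof.
  intros H; rewrite <- Rpower_sqrt by assumption.
  rewrite <- Rpower_pow by apply exp_pos. rewrite Rpower_mult; f_equal; simpl; field.
Qed.

Lemma self_similar_sqrt T (P : R -> R -> R) t x y : t < T ->
  self_similar T (fun q => P (fst q) (snd q)) t x y =
  sqrt (T - t) * P (x * (/ sqrt (T - t)) ^ 3) (y * sqrt (T - t)).
Proof.
  intros Ht; unfold self_similar; cbv beta iota delta [fst snd].
  assert (Hs : 0 < sqrt (T - t)) by (apply sqrt_lt_R0; lra).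
  rewrite Rpower_Ropp, Rpower_half, Rpower_three_halves by lra.
  f_equal; f_equal; field; lra.
Qed.

Definition cont3 (g : R -> R -> R -> R) (t x y : R) : Prop :=
  continuous (fun q : R * (R * R) => g (fst q) (fst (snd q)) (snd (snd q))) (t, (x, y)).

Lemma cont3_before T g : (forall t x y, t < T -> cont3 g t x y) -> continuous_before T g.
Proof.
  intros H t x y Ht _ P HP; destruct (H t x y Ht P HP) as [e He]; exists e.
  intros q Hq _; apply He, Hq.
Qed.

Lemma cont3_t (f : R -> R) t x y : continuous f t -> cont3 (fun t _ _ => f t) t x y.
Proof.
  intros H; apply (continuous_comp (U := prod_UniformSpace R_UniformSpace
    (prod_UniformSpace R_UniformSpace R_UniformSpace)) fst f); [apply continuous_fst | exact H].
Qed.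

Lemma cont3_x t x y : cont3 (fun _ x _ => x) t x y.
Proof.
  apply (continuous_comp (U := prod_UniformSpace R_UniformSpace
    (prod_UniformSpace R_UniformSpace R_UniformSpace)) snd fst);
    [apply continuous_snd | apply continuous_fst].
Qed.

Lemma cont3_y t x y : cont3 (fun _ _ y => y) t x y.
Proof.
  apply (continuous_comp (U := prod_UniformSpace R_UniformSpace
    (prod_UniformSpace R_UniformSpace R_UniformSpace)) snd snd);
    [apply continuous_snd | apply continuous_snd].
Qed.

Lemma cont3_mult f g t x y : cont3 f t x y -> cont3 g t x y ->
  cont3 (fun t x y => f t x y * g t x y) t x y.
Proof.
  apply (continuous_mult (U := prod_UniformSpace R_UniformSpace
    (prod_UniformSpace R_UniformSpace R_UniformSpace)) (K := R_AbsRing)).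
Qed.

Lemma cont3_plus f g t x y : cont3 f t x y -> cont3 g t x y ->
  cont3 (fun t x y => f t x y + g t x y) t x y.
Proof.
  apply (continuous_plus (U := prod_UniformSpace R_UniformSpace
    (prod_UniformSpace R_UniformSpace R_UniformSpace)) (V := R_NormedModule)).
Qed.

Lemma cont3_comp2 (h : R -> R -> R) f g t x y :
  continuity_2d_pt h (f t x y) (g t x y) -> cont3 f t x y -> cont3 g t x y ->
  cont3 (fun t x y => h (f t x y) (g t x y)) t x y.
Proof.
  intros Hh Hf Hg; apply continuity_2d_pt_filterlim in Hh.
  apply (continuous_comp_2 (U := prod_UniformSpace R_UniformSpace
    (prod_UniformSpace R_UniformSpace R_UniformSpace))
    (fun q => f (fst q) (fst (snd q)) (snd (snd q)))
    (fun q => g (fst q) (fst (snd q)) (snd (snd q))) h); assumption.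
Qed.

(** With r = sqrt (T - t), X = x / r^3 and Y = y r, each of u_t, u u_x and v u_y is 1/r times an
    expression in (X, Y): the change of variables in the integral gives v = - r^(-3) times the
    primitive of [PX]. The Prandtl equation is thus 1/r times the hypothesis on the profile. *)
Lemma profile_prandtl (P PX PY : R -> R -> R) T :
  partials all2 P PX PY ->
  (forall X Y, continuity_2d_pt PX X Y) -> (forall X Y, continuity_2d_pt PY X Y) ->
  (forall X Y, 0 <= Y ->
    - P X Y / 2 + 3 / 2 * X * PX X Y - Y / 2 * PY X Y + P X Y * PX X Y -
    RInt (PX X) 0 Y * PY X Y = 0) ->
  prandtl_solution T (self_similar T (fun q => P (fst q) (snd q))).
Proof.
  intros HP CX CY pde.
  assert (CP : forall X Y, continuity_2d_pt P X Y).
  { intros X Y; apply differentiable_continuity_pt; exists (PX X Y), (PY X Y).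
    apply (partials_differentiable all2); auto using open2_all2; exact I. }
  set (r := fun t => sqrt (T - t)).
  assert (Hr : forall t, t < T -> 0 < r t) by (intros; apply sqrt_lt_R0; lra).
  assert (Dr : forall t, t < T -> is_derive r t (- / (2 * r t))).
  { intros t Ht; unfold r; auto_derive; [lra|].
    change (T + - t) with (T - t); field. apply Rgt_not_eq, sqrt_lt_R0; lra. }
  assert (Di : forall t, t < T -> is_derive (fun t => / r t) t (/ (2 * r t ^ 3))).
  { intros t Ht; assert (H := Hr t Ht).
    replace (/ (2 * r t ^ 3)) with (- (- / (2 * r t)) / r t ^ 2) by (field; lra).
    apply is_derive_inv; [apply Dr; assumption | lra]. }
  set (Xs := fun t x => x * (/ r t) ^ 3); set (Ys := fun t y => y * r t).
  exists (fun t x y => / r t * (- / 2 * P (Xs t x) (Ys t y) +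
      3 / 2 * Xs t x * PX (Xs t x) (Ys t y) + - / 2 * Ys t y * PY (Xs t x) (Ys t y))).
  exists (fun t x y => / r t * / r t * PX (Xs t x) (Ys t y)).
  exists (fun t x y => r t * r t * PY (Xs t x) (Ys t y)).
  exists (fun t x y => - (/ r t * / r t * PX (Xs t x) (Ys t y))).
  intros v.
  assert (Cr : forall t x y, t < T -> cont3 (fun t _ _ => r t) t x y).
  { intros t x y Ht; apply (cont3_t r).
    eapply continuous_of_derive, Dr, Ht. }
  assert (Ci : forall t x y, t < T -> cont3 (fun t _ _ => / r t) t x y).
  { intros t x y Ht; apply (cont3_t (fun t => / r t)).
    eapply continuous_of_derive, Di, Ht. }
  assert (CXs : forall t x y, t < T -> cont3 (fun t x _ => Xs t x) t x y).
  { intros t x y Ht; unfold Xs, pow.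
    apply cont3_mult; [apply cont3_x|].
    apply cont3_mult; [auto|]. apply cont3_mult; [auto|]. apply cont3_mult; [auto|].
    apply (cont3_t (fun _ => 1)), continuous_const. }
  assert (CYs : forall t x y, t < T -> cont3 (fun t _ y => Ys t y) t x y).
  { intros t x y Ht; apply cont3_mult; [apply cont3_y | auto]. }
  assert (Cc : forall c t x y, cont3 (fun _ _ _ => c) t x y).
  { intros c t x y; apply (cont3_t (fun _ => c)), continuous_const. }
  assert (Cg : forall g, (forall X Y, continuity_2d_pt g X Y) -> forall t x y, t < T ->
    cont3 (fun t x y => g (Xs t x) (Ys t y)) t x y).
  { intros g Hg t x y Ht.
    apply (cont3_comp2 g (fun t x _ => Xs t x) (fun t _ y => Ys t y)); auto. }
  split; [|split; [|split]].
  - apply cont3_before; intros t x y Ht.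
    apply cont3_mult; [auto|]. apply cont3_plus; [apply cont3_plus|].
    + apply cont3_mult; auto.
    + apply cont3_mult; [apply cont3_mult|]; auto.
    + apply cont3_mult; [apply cont3_mult|]; auto.
  - apply cont3_before; intros t x y Ht.
    apply cont3_mult; [apply cont3_mult|]; auto.
  - apply cont3_before; intros t x y Ht.
    apply cont3_mult; [apply cont3_mult|]; auto.
  - intros t x y Ht Hy.
    assert (Rt := Hr t Ht).
    assert (Cux : forall z, continuous (fun y' => / r t * / r t * PX (Xs t x) (Ys t y')) z).
    { intros z. apply (continuous_scal_r (K := R_AbsRing) (V := R_NormedModule) (/ r t * / r t)
        (fun y' => PX (Xs t x) (Ys t y'))).
      apply (continuous_comp (fun y' => Ys t y') (PX (Xs t x))).
      - apply (continuous_scal_l (K := R_AbsRing) (V := R_NormedModule) (fun y => y) (r t)).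
        apply continuous_id.
      - apply continuity_2d_snd, CX. }
    assert (Eux : forall a b, ex_RInt (fun y' => / r t * / r t * PX (Xs t x) (Ys t y')) a b).
    { intros a b; apply (ex_RInt_continuous (V := R_CompleteNormedModule)); intros; apply Cux. }
    assert (Ev : v t x y = - ((/ r t) ^ 3 * RInt (PX (Xs t x)) 0 (Ys t y))).
    { unfold v; f_equal.
      assert (HX : ex_RInt (PX (Xs t x)) (r t * 0 + 0) (r t * y + 0)).
      { apply (ex_RInt_continuous (V := R_CompleteNormedModule)).
        intros; apply continuity_2d_snd, CX. }
      assert (H := RInt_comp_lin (V := R_CompleteNormedModule) (PX (Xs t x)) (r t) 0 0 y HX).
      replace (r t * 0 + 0) with 0 in H by ring.
      replace (r t * y + 0) with (Ys t y) in H by (unfold Ys; ring).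
      rewrite <- H.
      rewrite <- (RInt_scal (V := R_CompleteNormedModule) _ 0 y ((/ r t) ^ 3)).
      - apply RInt_ext; intros z _; unfold scal; simpl; unfold mult; simpl; req.
        unfold Ys; replace (r t * z + 0) with (z * r t) by ring. field; lra.
      - apply (ex_RInt_continuous (V := R_CompleteNormedModule)); intros z _.
        apply (continuous_scal_r (K := R_AbsRing) (V := R_NormedModule) (r t)
          (fun y' => PX (Xs t x) (r t * y' + 0))).
        apply (continuous_comp (fun y' => r t * y' + 0) (PX (Xs t x))).
        + apply (ex_derive_continuous (V := R_NormedModule)); auto_derive; trivial.
        + apply continuity_2d_snd, CX. }
    destruct (HP (Xs t x) (Ys t y) I) as [DX1 DY1].
    split; [|split; [|split; [|split; [|split; [|split; [|split]]]]]].
    + apply is_derive_ext_loc with (fun t => r t * P (Xs t x) (Ys t y)).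
      { assert (HT : 0 < T - t) by lra; exists (mkposreal _ HT); intros t' Ht'.
        apply Rabs_def2 in Ht'; simpl in Ht'; unfold minus, plus, opp in Ht'; simpl in Ht'.
        symmetry; apply self_similar_sqrt; lra. }
      assert (DF := partials_differentiable all2 P PX PY (Xs t x) (Ys t y) open2_all2 HP I (CX _ _)).
      assert (DXs : is_derive (fun t => Xs t x) t (x * (3 * / (2 * r t ^ 3) * (/ r t) ^ 2))).
      { apply is_derive_scal.
        replace (3 * / (2 * r t ^ 3) * (/ r t) ^ 2) with
          (INR 3 * / (2 * r t ^ 3) * (/ r t) ^ pred 3) by (simpl; ring).
        apply (is_derive_pow (fun t => / r t) 3 t (/ (2 * r t ^ 3))), Di, Ht. }
      assert (DYs : is_derive (fun t => Ys t y) t (y * (- / (2 * r t)))).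
      { apply is_derive_scal, Dr, Ht. }
      apply is_derive_Reals in DXs; apply is_derive_Reals in DYs.
      assert (DC := derivable_pt_lim_comp_2d P (fun t => Xs t x) (fun t => Ys t y) t _ _ _ _ DF DXs DYs).
      apply is_derive_Reals in DC.
      assert (DM := is_derive_mult r (fun t => P (Xs t x) (Ys t y)) t _ _ (Dr t Ht) DC
        (fun n m => Rmult_comm n m)).
      match type of DM with is_derive _ _ ?l =>
        match goal with |- is_derive _ _ ?l' => replace l' with l; [exact DM|] end end.
      unfold plus, mult; simpl. unfold Xs, Ys; field; lra.
    + apply is_derive_ext with (fun x => r t * P (Xs t x) (Ys t y)).
      { intros; symmetry; apply self_similar_sqrt, Ht. }
      replace (/ r t * / r t * PX (Xs t x) (Ys t y)) with
        (r t * ((/ r t) ^ 3 * PX (Xs t x) (Ys t y))) by (field; lra).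
      apply is_derive_scal.
      apply (is_derive_comp (fun X => P X (Ys t y)) (fun x => Xs t x)); [exact DX1|].
      unfold Xs; auto_derive; trivial; ring.
    + apply is_derive_is_half; [exact Hy|].
      apply is_derive_ext with (fun y => r t * P (Xs t x) (Ys t y)).
      { intros; symmetry; apply self_similar_sqrt, Ht. }
      replace (r t * r t * PY (Xs t x) (Ys t y)) with
        (r t * (r t * PY (Xs t x) (Ys t y))) by ring.
      apply is_derive_scal.
      apply (is_derive_comp (P (Xs t x)) (fun y => Ys t y)); [exact DY1|].
      unfold Ys; auto_derive; trivial; ring.
    + apply Eux.
    + apply is_derive_is_half; [exact Hy|].
      apply Rderive_opp.
      apply (is_derive_RInt (V := R_NormedModule) (fun y' => / r t * / r t * PX (Xs t x) (Ys t y')) _ 0).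
      * apply filter_forall; intros b; apply (RInt_correct (V := R_CompleteNormedModule)), Eux.
      * apply Cux.
    + rewrite Ev, self_similar_sqrt by assumption; change (sqrt (T - t)) with (r t).
      change (x * (/ r t) ^ 3) with (Xs t x); change (y * r t) with (Ys t y).
      assert (E := pde (Xs t x) (Ys t y) ltac:(unfold Ys; apply Rmult_le_pos; lra)).
      apply (f_equal (Rmult (/ r t))) in E; rewrite Rmult_0_r in E.
      etransitivity; [|exact E].
      field; lra.
    + ring.
    + unfold v; rewrite RInt_point; unfold zero; simpl; ring.
Qed.

Lemma A_pde_opp X Y I : I = - A_I X Y ->
  - (- A X Y) / 2 + 3 / 2 * X * (- A_X X Y) - Y / 2 * (- A_Y X Y) +
  (- A X Y) * (- A_X X Y) - I * (- A_Y X Y) = 0.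
Proof. intros ->; rewrite <- (A_pde X Y); field. Qed.

Lemma Theta'_bar_prandtl T : prandtl_solution T (self_similar T Theta'_bar).
Proof.
  replace Theta'_bar with (fun q => (fun X Y => - A X Y) (fst q) (snd q)).
  2: { apply functional_extensionality; intros [X Y]; symmetry; apply Theta'_bar_eq. }
  apply (profile_prandtl (fun X Y => - A X Y) (fun X Y => - A_X X Y) (fun X Y => - A_Y X Y)).
  - intros X Y _; destruct (partials_A X Y I); split;
      apply Rderive_opp; assumption.
  - intros; apply continuity_2d_pt_opp, continuity_A_X.
  - intros; apply continuity_2d_pt_opp, continuity_A_Y.
  - intros X Y _; apply A_pde_opp.
    apply (is_RInt_unique (V := R_CompleteNormedModule)), (is_RInt_opp (V := R_NormedModule)), RInt_A_X.
Qed.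

Lemma Theta'_prandtl T : prandtl_solution T (self_similar T Theta').
Proof.
  replace Theta' with (fun q => cut A (fst q) (snd q)).
  2: { apply functional_extensionality; intros [X Y]; symmetry; apply Theta'_cut. }
  apply (profile_prandtl (cut A) (cut A_X) (cut A_Y)).
  - apply partials_cut_A.
  - apply continuity_cut_A_X.
  - apply continuity_cut_A_Y.
  - intros X Y HY; destruct (Rle_lt_dec Y (2 * Ystar' X)) as [H | H].
    + assert (CS : forall y, 0 <= y <= Y -> closed_strip (X, y)) by (intros; split; simpl; lra).
      rewrite !cut_closed by auto using A_vanish, A_X_vanish, A_Y_vanish with real.
      apply A_pde_opp.
      apply (is_RInt_unique (V := R_CompleteNormedModule)).
      apply is_RInt_ext with (fun y => - A_X X y).
      * rewrite Rmin_left, Rmax_right by assumption; intros y Hy.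
        symmetry; apply cut_closed; [apply A_X_vanish | apply CS; lra].
      * apply (is_RInt_opp (V := R_NormedModule)), RInt_A_X.
    + assert (N : ~ strip (X, Y)) by (intros [_ H']; simpl in H'; lra).
      rewrite !(cut_out _ X Y N); field.
Qed.

(** * Expansions *)

Lemma Ystar'_opp X : Ystar' (- X) = Ystar' X.
Proof. rewrite !Ystar'_Kfun, Kfun_opp_X; reflexivity. Qed.

Lemma phi_opp_X X Y : phi (- X) Y = phi X Y.
Proof. apply phi_unique; rewrite Kfun_opp_X; apply Kfun_phi. Qed.

Lemma wroot_opp_X X p : wroot (- X) p = wroot X p.
Proof. unfold wroot; f_equal; ring. Qed.

Lemma wroot_opp_p X p : wroot X (- p) = wroot X p.
Proof. unfold wroot; rewrite cos_neg; reflexivity. Qed.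

Lemma A_opp X Y : A (- X) Y = - A X Y.
Proof. unfold A, afun; rewrite phi_opp_X, wroot_opp_X; ring. Qed.

Lemma Theta'_odd X Y : Theta' (- X, Y) = - Theta' (X, Y).
Proof.
  rewrite !Theta'_cut; unfold cut; rewrite Ystar'_opp.
  destruct (Rlt_dec 0 Y); [destruct (Rlt_dec Y (2 * Ystar' X))|]; try ring.
  rewrite A_opp; ring.
Qed.

Lemma Theta'_symmetric X Y : Rabs Y < Ystar' X ->
  Theta' (X, Ystar' X + Y) = Theta' (X, Ystar' X - Y).
Proof.
  intros H; apply Rabs_def2 in H.
  rewrite !Theta'_closed by (split; simpl; lra).
  assert (E : phi X (Ystar' X + Y) = - phi X (Ystar' X - Y)).
  { apply phi_unique; rewrite Kfun_opp, Kfun_phi, Kfun_top; ring. }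
  unfold A, afun; rewrite E, wroot_opp_p, cos_neg; reflexivity.
Qed.

Lemma cos_phi_pos X Y : strip (X, Y) -> 0 < cos (phi X Y).
Proof. intros H; apply strip_phi in H; apply cos_gt_0; lra. Qed.

Lemma Theta'_sign X Y : strip (X, Y) ->
  exists k, 0 < k /\ Theta' (X, Y) = - (X * k).
Proof.
  intros H; exists (cos (phi X Y) ^ 2 * wroot X (phi X Y)); split.
  - apply Rmult_lt_0_compat; [apply pow_lt, cos_phi_pos, H | apply wroot_bounds].
  - rewrite Theta'_cut, cut_in by assumption; unfold A, afun; ring.
Qed.

Lemma Theta'_pos X Y : X < 0 -> 0 < Y < 2 * Ystar' X -> 0 < Theta' (X, Y).
Proof. intros HX HY; destruct (Theta'_sign X Y HY) as (k & Hk & ->); nra. Qed.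

Lemma Theta'_neg X Y : 0 < X -> 0 < Y < 2 * Ystar' X -> Theta' (X, Y) < 0.
Proof. intros HX HY; destruct (Theta'_sign X Y HY) as (k & Hk & ->); nra. Qed.

(** * The critical set and the trace on the axis *)

Lemma critical_set_cut X Y : critical_set (X, Y) <-> 0 <= Y /\ cut A_Y X Y = 0.
Proof.
  unfold critical_set, half_plane, is_dY; simpl; split; intros [H1 H2]; split; auto.
  - apply (is_derive_half_unique (fun y => Theta' (X, y)) Y); auto using Theta'_dY.
  - apply is_derive_is_half; [assumption|]. rewrite <- H2; apply Theta'_dY.
Qed.

Lemma strip_dec X Y : strip (X, Y) \/ ~ strip (X, Y).
Proof.
  unfold strip; simpl; destruct (Rlt_dec 0 Y); [destruct (Rlt_dec Y (2 * Ystar' X))|]; lra.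
Qed.

Lemma critical_set_eq q : critical_set q <-> S1 q \/ S2 q.
Proof.
  destruct q as [X Y]; rewrite critical_set_cut.
  unfold S1, S2, half_plane; simpl; assert (HP := Ystar'_pos X).
  assert (Hpi := PI_RGT_0); split.
  - intros [H1 H2]; destruct (strip_dec X Y) as [H | H].
    + left; split; [assumption|]. rewrite cut_in in H2 by assumption.
      assert (Hc := cos_phi_pos X Y H); assert (Hw := wroot_bounds X (phi X Y)).
      destruct (Req_dec X 0) as [HX | HX]; [left; assumption|right].
      apply strip_phi in H.
      assert (Hs : sin (phi X Y) = 0).
      { unfold A_Y, afun_Y in H2.
        assert (E : X * (cos (phi X Y) * wroot X (phi X Y)) * sin (phi X Y) = 0) by lra.
        apply Rmult_integral in E; destruct E as [E | E]; [|assumption].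
        apply Rmult_integral in E; destruct E as [E | E]; [lra|].
        apply Rmult_integral in E; lra. }
      assert (Hp : phi X Y = 0).
      { destruct (Rtotal_order (phi X Y) 0) as [L | [L | L]]; [|assumption|].
        - assert (G := sin_lt_0_var (phi X Y)); lra.
        - assert (G := sin_gt_0 (phi X Y)); lra. }
      rewrite <- (Kfun_phi X Y), Hp; apply Kfun_mid.
    + right; split; [assumption|]. unfold strip in H; simpl in H; lra.
  - intros [[H1 H2] | [H1 H2]]; split; try assumption.
    + destruct (strip_dec X Y) as [H | H]; [|apply cut_out; assumption].
      rewrite cut_in by assumption. unfold A_Y, afun_Y; destruct H2 as [-> | ->]; [ring|].
      rewrite phi_mid, sin_0; ring.
    + apply cut_out; intros [H3 H4]; simpl in *; lra.
Qed.

Lemma Theta'_crest X : Theta' (X, Ystar' X) = Psi1 X.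
Proof.
  assert (H := Ystar'_pos X).
  rewrite Theta'_closed by (split; simpl; lra).
  unfold A, afun, wroot; rewrite phi_mid, cos_0, Psi1_qroot.
  replace (X ^ 2 * 1 ^ 6) with (X ^ 2) by ring; ring.
Qed.

Lemma phi_0_l Y : phi 0 Y = Y / 2 - PI / 2.
Proof. apply phi_unique; rewrite Kfun_0; field. Qed.

Lemma Ystar'_0 : Ystar' 0 = PI.
Proof. rewrite Ystar'_Kfun, Kfun_0; field. Qed.

Lemma dens_0 p : dens 0 p = 1.
Proof. assert (H := dens_eq 0 p); ring_simplify in H; exact H. Qed.

Lemma cos_shift y : cos (y - PI / 2) = sin y.
Proof. rewrite cos_minus, cos_PI2, sin_PI2; ring. Qed.

Lemma A_X_0 Y : A_X 0 Y = sin (Y / 2) ^ 2.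
Proof. unfold A_X, afun_X; rewrite phi_0_l, cos_shift, dens_0; ring. Qed.

Lemma Theta'_dX_axis Y : 0 <= Y ->
  is_dX Theta' (0, Y) (- sin (Y / 2) ^ 2 * indicator 0 (2 * PI) Y).
Proof.
  intros HY; replace (- sin (Y / 2) ^ 2 * indicator 0 (2 * PI) Y) with (cut A_X 0 Y);
    [apply Theta'_dX|].
  unfold indicator; destruct (Rle_dec 0 Y); [|lra]; destruct (Rle_dec Y (2 * PI)).
  - rewrite cut_closed, A_X_0; [ring | apply A_X_vanish|].
    split; simpl; [assumption | rewrite Ystar'_0; assumption].
  - rewrite cut_out; [ring|]. intros [_ H]; simpl in H; rewrite Ystar'_0 in H; lra.
Qed.

(** On the critical set the X-derivative is - sin^2 (Y/2) on the axis, - dens X 0 on the crest and 0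
    outside the strip; all of these are at least -1, the value at (0, PI). *)
Lemma minimum_at_crest : critical_set (0, PI) /\
  exists m, is_dX Theta' (0, PI) m /\
    forall q l, critical_set q -> is_dX Theta' q l -> m <= l.
Proof.
  assert (Hpi := PI_RGT_0).
  split.
  - apply critical_set_eq; left; split; [unfold half_plane; simpl; lra | left; reflexivity].
  - exists (cut A_X 0 PI); split; [apply Theta'_dX|].
    assert (Hm : cut A_X 0 PI = -1).
    { rewrite cut_in by (split; simpl; rewrite ?Ystar'_0; lra).
      rewrite A_X_0, sin_PI2; ring. }
    rewrite Hm; intros [X Y] l Hq Hl.
    assert (E : l = cut A_X X Y).
    { unfold is_dX in Hl; simpl in Hl.
      rewrite <- (is_derive_unique _ _ _ Hl); apply is_derive_unique, (Theta'_dX X Y). }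
    rewrite E; destruct (strip_dec X Y) as [H | H].
    + rewrite cut_in by assumption; apply critical_set_eq in Hq.
      destruct Hq as [[_ [HX | HY]] | [_ [HY | HY]]]; cbn [fst snd] in *.
      * subst X; rewrite A_X_0. assert (B := SIN_bound (Y / 2)); nra.
      * rewrite HY; unfold A_X, afun_X; rewrite phi_mid, sin_0, cos_0.
        assert (B := dens_bounds X 0); lra.
      * destruct H as [H _]; simpl in H; lra.
      * destruct H as [_ H]; simpl in H; lra.
    + rewrite cut_out by assumption; lra.
Qed.

(** * Expansion in powers of X *)

(** The integral of sin^6 from 0 to y, called J in the comment on [trace3]. *)
Definition Jf (y : R) : R :=
  5 / 16 * y - cos y * (sin y ^ 5 / 6 + 5 / 24 * sin y ^ 3 + 5 / 16 * sin y).

Lemma is_derive_Jf y : is_derive Jf y (sin y ^ 6).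
Proof.
  unfold Jf; auto_derive; [trivial|].
  assert (H := sin2_cos2 y); unfold Rsqr in H.
  assert (E : cos y * cos y = 1 - sin y * sin y) by lra.
  set (s := sin y) in *; set (c := cos y) in *. simpl pred. simpl INR.
  match goal with |- ?l = ?r => transitivity (5 / 16 + s * (s ^ 5 / 6 + 5 / 24 * s ^ 3 + 5 / 16 * s) -
    (c * c) * (5 * s ^ 4 / 6 + 15 / 24 * s ^ 2 + 5 / 16)) end; [field | rewrite E; field].
Qed.

Lemma Jf_0 : Jf 0 = 0.
Proof. unfold Jf; rewrite sin_0; field. Qed.

Lemma sin6_bounds y : 0 <= sin y ^ 6 <= 1.
Proof.
  assert (H := SIN_bound y). replace (sin y ^ 6) with ((sin y ^ 2) ^ 3) by ring.
  assert (0 <= sin y ^ 2 <= 1) by nra.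
  split; [apply pow_le; lra|]. rewrite <- (pow1 3); apply pow_incr; lra.
Qed.

Lemma lipschitz_of_derive (f df : R -> R) M a b :
  (forall t, is_derive f t (df t)) -> (forall t, Rabs (df t) <= M) ->
  Rabs (f b - f a) <= M * Rabs (b - a).
Proof.
  intros H B; destruct (MVT_derive f df a b) as (c & _ & E); auto.
  rewrite E, Rabs_mult; apply Rmult_le_compat_r; auto using Rabs_pos.
Qed.

Lemma Jf_lipschitz a b : Rabs (Jf b - Jf a) <= Rabs (b - a).
Proof.
  rewrite <- (Rmult_1_l (Rabs (b - a))).
  apply (lipschitz_of_derive Jf (fun y => sin y ^ 6)); [apply is_derive_Jf|].
  intros t; rewrite Rabs_pos_eq; apply sin6_bounds.
Qed.

Lemma qroot_expansion Z : 0 <= Z -> Rabs (qroot Z - (1 - Z)) <= 3 * Z ^ 2.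
Proof.
  intros HZ; assert (H := qroot_quadratic Z 0 HZ (Rle_refl 0)).
  assert (Q0 : qroot 0 = 1) by (unfold qroot; destruct (Rle_dec 0 0); lra).
  unfold qslope in H; rewrite Q0 in H.
  replace (qroot Z - (1 - Z)) with
    (qroot Z - 1 - - 1 ^ 3 * / (1 + 3 * 0 * 1 ^ 2) * (Z - 0)) by field.
  eapply Rle_trans; [exact H|]. apply Req_le; ring.
Qed.

Lemma qslope_expansion Z : 0 <= Z -> Rabs (qslope Z - (1 - 3 * Z)) <= 15 * Z ^ 2.
Proof.
  intros HZ; assert (E := qroot_eq Z HZ); assert (E' := qslope_eq Z HZ).
  assert (B := qroot_bounds Z HZ); assert (B' := qslope_bounds Z HZ).
  assert (P : 0 < / (1 + 3 * Z)) by (apply Rinv_0_lt_compat; lra).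
  set (q := qroot Z) in *; set (e := qslope Z) in *.
  replace (e - (1 - 3 * Z)) with (3 * Z * (1 - q ^ 2 * e)).
  2: { transitivity (3 * Z + e - e * (1 + 3 * Z * q ^ 2)); [ring | rewrite E'; ring]. }
  assert (Q2 : 0 <= q ^ 2 <= 1) by nra.
  assert (Q3 : 0 <= q ^ 3 <= 1) by nra.
  assert (H1 : 0 <= 1 - q ^ 2 * e) by nra.
  (* The bound 5 Z is 2 Z from 1 - q^2 plus 3 Z from 1 - e. *)
  assert (H2 : 1 - q ^ 2 * e <= 5 * Z).
  { assert (1 - e <= 3 * Z) by nra.
    assert (1 - q <= Z) by nra. nra. }
  rewrite Rabs_pos_eq by (apply Rmult_le_pos; lra).
  replace (15 * Z ^ 2) with (3 * Z * (5 * Z)) by ring.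
  apply Rmult_le_compat_l; lra.
Qed.

(** Integrates dens = 1 - 3 X^2 cos^6 p + O(X^4) from -PI/2, where the shift by PI/2 turns cos^6
    into sin^6. The bound is valid for all X and p. *)
Lemma Kfun_expansion X p :
  Rabs (Kfun X p - 2 * (p + PI / 2) + 6 * X ^ 2 * Jf (p + PI / 2)) <=
  30 * X ^ 4 * Rabs (p + PI / 2).
Proof.
  assert (H := lipschitz_of_derive
    (fun p => Kfun X p - 2 * (p + PI / 2) + 6 * X ^ 2 * Jf (p + PI / 2))
    (fun p => 2 * dens X p - 2 + 6 * X ^ 2 * sin (p + PI / 2) ^ 6) (30 * X ^ 4) (- (PI / 2)) p).
  cbv beta in H; rewrite Kfun_start in H.
  replace (- (PI / 2) + PI / 2) with 0 in H by ring; rewrite Jf_0 in H.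
  replace (p - - (PI / 2)) with (p + PI / 2) in H by ring.
  replace (Kfun X p - 2 * (p + PI / 2) + 6 * X ^ 2 * Jf (p + PI / 2)) with
    (Kfun X p - 2 * (p + PI / 2) + 6 * X ^ 2 * Jf (p + PI / 2) -
     (0 - 2 * 0 + 6 * X ^ 2 * 0)) by ring.
  apply H.
  - intros t; apply Rderive_plus.
    + apply Rderive_minus; [apply is_derive_Kfun|].
      auto_derive; trivial; ring.
    + replace (6 * X ^ 2 * sin (t + PI / 2) ^ 6) with
        (6 * X ^ 2 * (1 * sin (t + PI / 2) ^ 6)) by ring.
      apply is_derive_scal, (is_derive_comp Jf (fun t => t + PI / 2)); [apply is_derive_Jf|].
      auto_derive; trivial.
  - intros t. replace (sin (t + PI / 2)) with (cos t) by (rewrite sin_plus, cos_PI2, sin_PI2; ring).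
    assert (E := qslope_expansion _ (Zarg_nonneg X t)); fold (dens X t) in E.
    replace (2 * dens X t - 2 + 6 * X ^ 2 * cos t ^ 6) with
      (2 * (dens X t - (1 - 3 * (X ^ 2 * cos t ^ 6)))) by ring.
    rewrite Rabs_mult, (Rabs_pos_eq 2) by lra.
    apply Rle_trans with (30 * (X ^ 2 * cos t ^ 6) ^ 2); [lra|].
    rewrite Rpow_mult_distr; replace ((X ^ 2) ^ 2) with (X ^ 4) by ring.
    assert (C := cos6_le t).
    assert ((cos t ^ 6) ^ 2 <= 1) by nra.
    assert (0 <= X ^ 4) by (replace (X ^ 4) with ((X ^ 2) ^ 2) by ring; apply pow2_ge_0).
    nra.
Qed.

Lemma Jf_PI : Jf PI = 5 / 16 * PI.
Proof. unfold Jf; rewrite sin_PI; field. Qed.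

Lemma Ystar'_expansion :
  bigO (locally 0) (fun X => Ystar' X - (PI - 15 / 16 * PI * X ^ 2)) (fun X => X ^ 4).
Proof.
  exists (15 * PI); apply filter_forall; intros X.
  assert (H := Kfun_expansion X (PI / 2)); assert (Hpi := PI_RGT_0).
  replace (PI / 2 + PI / 2) with PI in H by field.
  rewrite Jf_PI, Kfun_top, (Rabs_pos_eq PI) in H by lra.
  assert (0 <= X ^ 4) by (replace (X ^ 4) with ((X ^ 2) ^ 2) by ring; apply pow2_ge_0).
  rewrite (Rabs_pos_eq (X ^ 4)) by assumption.
  replace (Ystar' X - (PI - 15 / 16 * PI * X ^ 2)) with
    ((2 * Ystar' X - 2 * PI + 6 * X ^ 2 * (5 / 16 * PI)) * / 2) by field.
  rewrite Rabs_mult, (Rabs_pos_eq (/ 2)) by lra. lra.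
Qed.

Lemma second_order_bound (f f' f'' : R -> R) M a b :
  (forall t, is_derive f t (f' t)) -> (forall t, is_derive f' t (f'' t)) ->
  (forall t, Rabs (f'' t) <= M) ->
  Rabs (f b - f a - f' a * (b - a)) <= M * (b - a) ^ 2.
Proof.
  intros H1 H2 B.
  destruct (MVT_derive f f' a b) as (c & Hc & E); auto.
  assert (HM : 0 <= M) by (eapply Rle_trans; [apply Rabs_pos | apply (B 0)]).
  replace (f b - f a - f' a * (b - a)) with ((f' c - f' a) * (b - a)) by lra.
  rewrite Rabs_mult, <- (pow2_abs (b - a)).
  replace (M * Rabs (b - a) ^ 2) with (M * Rabs (b - a) * Rabs (b - a)) by ring.
  apply Rmult_le_compat_r; [apply Rabs_pos|].
  eapply Rle_trans; [apply (lipschitz_of_derive f' f'' M); assumption|].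
  apply Rmult_le_compat_l; [assumption|].
  unfold Rmin, Rmax in Hc; destruct (Rle_dec a b); unfold Rabs; repeat destruct Rcase_abs; lra.
Qed.

Definition wfun (X Y : R) : R := cos (phi X Y) ^ 2 * wroot X (phi X Y).

Lemma A_wfun X Y : A X Y = X * wfun X Y.
Proof. unfold A, afun, wfun; ring. Qed.

(** The coefficient of X^3 in Theta' at Y = 2 y. *)
Definition third (y : R) : R := sin y ^ 8 - 6 * sin y * cos y * Jf y.

(* With [y = p + PI / 2], invert [Y = 2 y - 6 X^2 Jf y + O(X^4)] and insert the
   result into [sin^2 y (1 - X^2 sin^6 y)]. *)
Lemma wfun_expansion : exists C, forall X Y, Rabs X <= 1 -> 0 <= Y <= 2 * PI ->
  Rabs (wfun X Y - sin (Y / 2) ^ 2 + X ^ 2 * third (Y / 2)) <= C * X ^ 4.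
Proof.
  assert (Hpi := PI_RGT_0).
  (* Here y <= 4 PI and |X| <= 1. [C1] bounds |y - Y/2| / X^2: 3 * 4 PI from the term in [Jf] plus
     15 * 4 PI from the remainder. [C2] bounds the next error: 3 [C1] from replacing Jf y by Jf
     (Y/2), and 60 PI again from the remainder. *)
  set (C1 := 72 * PI). set (C2 := 3 * C1 + 60 * PI).
  exists (3 + 8 * C1 + C2 + 2 * C1 ^ 2); intros X Y HX HY.
  assert (X2 : 0 <= X ^ 2 <= 1).
  { rewrite <- (pow2_abs X); assert (H := Rabs_pos X); nra. }
  assert (X4 : X ^ 4 = X ^ 2 * X ^ 2) by ring.
  assert (X4' : 0 <= X ^ 4 <= X ^ 2) by nra.
  set (p := phi X Y). set (y := p + PI / 2).
  assert (Ec : cos p = sin y).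
  { unfold y; rewrite sin_plus, cos_PI2, sin_PI2; ring. }
  assert (HK := Kfun_expansion X p); unfold p in HK at 1; rewrite Kfun_phi in HK.
  fold p y in HK.
  (* Since |X| <= 1, the density is at least 1/4, hence Y >= y/2. *)
  assert (Hy : 0 <= y <= 4 * PI).
  { assert (Hp : - (PI / 2) <= p).
    { destruct (Rle_or_lt (- (PI / 2)) p); [assumption|].
      assert (G := Kfun_lt X p (- (PI / 2)) H); rewrite Kfun_start in G.
      unfold p in G; rewrite Kfun_phi in G; lra. }
    split; [unfold y; lra|].
    destruct (Kfun_incr X (- (PI / 2)) p Hp) as [G _].
    rewrite Kfun_start in G; unfold p in G at 2; rewrite Kfun_phi in G.
    replace (p - - (PI / 2)) with y in G by (unfold y; ring).
    assert (2 / (1 + 3 * X ^ 2) * y >= / 2 * y).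
    { apply Rle_ge, Rmult_le_compat_r; [unfold y; lra|].
      apply Rmult_le_reg_r with (1 + 3 * X ^ 2); [lra|].
      unfold Rdiv; rewrite Rmult_assoc, Rinv_l by lra; lra. }
    lra. }
  rewrite (Rabs_pos_eq y) in HK by lra.
  assert (HJ : Rabs (Jf y) <= y).
  { assert (G := Jf_lipschitz 0 y); rewrite Jf_0, !Rminus_0_r, (Rabs_pos_eq y) in G by lra; exact G. }
  apply Rabs_le_between in HK; apply Rabs_le_between in HJ.
  assert (D1 : Rabs (y - Y / 2) <= C1 * X ^ 2).
  { apply Rabs_le. unfold C1.
    assert (X ^ 4 * y <= X ^ 2 * (4 * PI)) by (apply Rmult_le_compat; lra).
    assert (- (X ^ 2 * (4 * PI)) <= X ^ 2 * Jf y <= X ^ 2 * (4 * PI)).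
    { split; [|apply Rmult_le_compat_l; lra].
      replace (- (X ^ 2 * (4 * PI))) with (X ^ 2 * - (4 * PI)) by ring.
      apply Rmult_le_compat_l; lra. }
    lra. }
  assert (DJ := Jf_lipschitz (Y / 2) y).
  assert (D2 : Rabs (y - Y / 2 - 3 * X ^ 2 * Jf (Y / 2)) <= C2 * X ^ 4).
  { replace (y - Y / 2 - 3 * X ^ 2 * Jf (Y / 2)) with
      (3 * X ^ 2 * (Jf y - Jf (Y / 2)) + (- / 2) * (Y - 2 * y + 6 * X ^ 2 * Jf y)) by field.
    eapply Rle_trans; [apply Rabs_triang|]; rewrite !Rabs_mult, Rabs_Ropp.
    rewrite (Rabs_pos_eq 3), (Rabs_pos_eq (X ^ 2)), (Rabs_pos_eq (/ 2)) by lra.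
    assert (B1 : 3 * X ^ 2 * Rabs (Jf y - Jf (Y / 2)) <= 3 * X ^ 2 * (C1 * X ^ 2)).
    { apply Rmult_le_compat_l; lra. }
    assert (B2 : Rabs (Y - 2 * y + 6 * X ^ 2 * Jf y) <= 30 * X ^ 4 * (4 * PI)).
    { apply Rle_trans with (30 * X ^ 4 * y); [apply Rabs_le; lra|].
      apply Rmult_le_compat_l; lra. }
    unfold C2; rewrite X4 in *; lra. }
  assert (D3 : Rabs (sin y ^ 2 - sin (Y / 2) ^ 2 -
      2 * sin (Y / 2) * cos (Y / 2) * (y - Y / 2)) <= 2 * (y - Y / 2) ^ 2).
  { apply (second_order_bound (fun y => sin y ^ 2) (fun y => 2 * sin y * cos y)
      (fun y => 2 * (cos y ^ 2 - sin y ^ 2))).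
    - intros t; auto_derive; trivial; ring.
    - intros t; auto_derive; trivial; ring.
    - intros t; assert (S := sin2_cos2 t); unfold Rsqr in S.
      assert (P1 := pow2_ge_0 (sin t)); assert (P2 := pow2_ge_0 (cos t)).
      apply Rabs_le; split; nra. }
  assert (D4 : Rabs (sin y ^ 8 - sin (Y / 2) ^ 8) <= 8 * Rabs (y - Y / 2)).
  { apply (lipschitz_of_derive (fun y => sin y ^ 8) (fun y => 8 * sin y ^ 7 * cos y)).
    - intros t; auto_derive; trivial; ring.
    - intros t; assert (S := SIN_bound t); assert (T := COS_bound t).
      rewrite !Rabs_mult, (Rabs_pos_eq 8), <- RPow_abs by lra.
      assert (Rabs (sin t) ^ 7 <= 1).
      { rewrite <- (pow1 7); apply pow_incr; split; [apply Rabs_pos | apply Rabs_le; lra]. }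
      assert (Rabs (cos t) <= 1) by (apply Rabs_le; lra).
      assert (0 <= Rabs (sin t) ^ 7) by (apply pow_le, Rabs_pos).
      assert (0 <= Rabs (cos t)) by apply Rabs_pos. nra. }
  assert (D5 : Rabs (wfun X Y - sin y ^ 2 + X ^ 2 * sin y ^ 8) <= 3 * X ^ 4).
  { assert (G := qroot_expansion _ (Zarg_nonneg X p)); fold (wroot X p) in G.
    unfold wfun; fold p; rewrite Ec in *.
    replace (sin y ^ 2 * wroot X p - sin y ^ 2 + X ^ 2 * sin y ^ 8) with
      (sin y ^ 2 * (wroot X p - (1 - X ^ 2 * sin y ^ 6))) by ring.
    assert (S := SIN_bound y). assert (S2 : 0 <= sin y ^ 2 <= 1) by nra.
    rewrite Rabs_mult, (Rabs_pos_eq (sin y ^ 2)) by lra.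
    assert (S6 := sin6_bounds y).
    assert ((X ^ 2 * sin y ^ 6) ^ 2 <= X ^ 4).
    { rewrite Rpow_mult_distr; replace ((X ^ 2) ^ 2) with (X ^ 4) by ring.
      assert ((sin y ^ 6) ^ 2 <= 1) by nra. nra. }
    assert (0 <= Rabs (wroot X p - (1 - X ^ 2 * sin y ^ 6))) by apply Rabs_pos.
    nra. }
  assert (HA : X ^ 2 * (8 * Rabs (y - Y / 2)) <= 8 * C1 * X ^ 4).
  { rewrite X4; replace (8 * C1 * (X ^ 2 * X ^ 2)) with (X ^ 2 * (8 * (C1 * X ^ 2))) by ring.
    apply Rmult_le_compat_l; lra. }
  assert (HB : (y - Y / 2) ^ 2 <= C1 ^ 2 * X ^ 4).
  { rewrite <- (pow2_abs (y - Y / 2)).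
    replace (C1 ^ 2 * X ^ 4) with ((C1 * X ^ 2) ^ 2) by ring.
    apply pow_incr; split; [apply Rabs_pos | assumption]. }
  assert (HS : Rabs (2 * sin (Y / 2) * cos (Y / 2)) <= 1).
  { assert (S := sin2_cos2 (Y / 2)); unfold Rsqr in S.
    assert (P1 := pow2_ge_0 (sin (Y / 2) - cos (Y / 2))).
    assert (P2 := pow2_ge_0 (sin (Y / 2) + cos (Y / 2))). apply Rabs_le; split; nra. }
  replace (wfun X Y - sin (Y / 2) ^ 2 + X ^ 2 * third (Y / 2)) with
    ((wfun X Y - sin y ^ 2 + X ^ 2 * sin y ^ 8) +
     (sin y ^ 2 - sin (Y / 2) ^ 2 - 2 * sin (Y / 2) * cos (Y / 2) * (y - Y / 2)) +
     2 * sin (Y / 2) * cos (Y / 2) * (y - Y / 2 - 3 * X ^ 2 * Jf (Y / 2)) +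
     - (X ^ 2 * (sin y ^ 8 - sin (Y / 2) ^ 8))) by (unfold third; ring).
  assert (E3 : Rabs (2 * sin (Y / 2) * cos (Y / 2) * (y - Y / 2 - 3 * X ^ 2 * Jf (Y / 2))) <=
    C2 * X ^ 4).
  { rewrite Rabs_mult, <- (Rmult_1_l (C2 * X ^ 4)).
    apply Rmult_le_compat; auto using Rabs_pos. }
  assert (E4 : Rabs (- (X ^ 2 * (sin y ^ 8 - sin (Y / 2) ^ 8))) <= 8 * C1 * X ^ 4).
  { rewrite Rabs_Ropp, Rabs_mult, (Rabs_pos_eq (X ^ 2)) by lra.
    eapply Rle_trans; [|exact HA]. apply Rmult_le_compat_l; lra. }
  eapply Rle_trans; [apply Rabs_triang|].
  eapply Rle_trans; [apply Rplus_le_compat_r, Rabs_triang|].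
  eapply Rle_trans; [apply Rplus_le_compat_r, Rplus_le_compat_r, Rabs_triang|].
  lra.
Qed.

(** * Expansion at the crest *)

Lemma sub_sin_bound t : Rabs (t - sin t) <= Rabs t ^ 3.
Proof.
  destruct (MVT_derive (fun t => t - sin t) (fun t => 1 - cos t) 0 t)
    as (c & Hc & E).
  { intros u _; auto_derive; trivial; ring. }
  cbv beta in E; rewrite sin_0 in E; replace (t - sin t) with ((1 - cos c) * t) by lra.
  assert (Hct : Rabs c <= Rabs t).
  { unfold Rmin, Rmax in Hc; destruct (Rle_dec 0 t); unfold Rabs; repeat destruct Rcase_abs; lra. }
  assert (L : Rabs (sin (c / 2)) <= Rabs (c / 2)).
  { assert (G := lipschitz_of_derive sin cos 1 0 (c / 2)). rewrite sin_0, !Rminus_0_r, Rmult_1_l in G.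
    apply G; [intros; apply is_derive_Reals, derivable_pt_lim_sin|].
    intros u; apply Rabs_le, COS_bound. }
  assert (Ec : 1 - cos c = 2 * sin (c / 2) ^ 2).
  { replace c with (2 * (c / 2)) at 1 by field. rewrite cos_2a_sin; ring. }
  rewrite Ec, <- (pow2_abs (sin (c / 2))).
  assert (P0 := Rabs_pos (sin (c / 2))); assert (P1 := Rabs_pos c); assert (P2 := Rabs_pos t).
  unfold Rdiv in L; rewrite Rabs_mult, (Rabs_pos_eq (/ 2)) in L by lra.
  assert (B : 2 * Rabs (sin (c / 2)) ^ 2 <= Rabs t ^ 2) by (unfold Rdiv; nra).
  rewrite Rabs_mult, Rabs_pos_eq by (apply Rmult_le_pos; [lra | apply pow2_ge_0]).
  replace (Rabs t ^ 3) with (Rabs t ^ 2 * Rabs t) by ring.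
  apply Rmult_le_compat_r; assumption.
Qed.

Lemma sin_abs_le t : Rabs (sin t) <= Rabs t.
Proof.
  assert (G := lipschitz_of_derive sin cos 1 0 t). rewrite sin_0, !Rminus_0_r, Rmult_1_l in G.
  apply G; [intros; apply is_derive_Reals, derivable_pt_lim_sin|].
  intros u; apply Rabs_le, COS_bound.
Qed.

Lemma Ystar'_near X : PI - 15 / 16 * PI * X ^ 2 - 15 * PI * X ^ 4 <= Ystar' X.
Proof.
  assert (H := Kfun_expansion X (PI / 2)); assert (Hpi := PI_RGT_0).
  replace (PI / 2 + PI / 2) with PI in H by field.
  rewrite Jf_PI, Kfun_top, (Rabs_pos_eq PI) in H by lra.
  apply Rabs_le_between in H; lra.
Qed.

Lemma crest_factor_expansion Y : Rabs Y <= 1 ->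
  Rabs (cos (Y / 2) ^ 2 - (1 - Y ^ 2 / 4)) <= Y ^ 4.
Proof.
  intros HY.
  assert (B1 := sub_sin_bound (Y / 2)); assert (B2 := sin_abs_le (Y / 2)).
  assert (S := sin2_cos2 (Y / 2)); unfold Rsqr in S.
  replace (cos (Y / 2) ^ 2 - (1 - Y ^ 2 / 4)) with
    ((Y / 2 - sin (Y / 2)) * (Y / 2 + sin (Y / 2))).
  2: { transitivity ((Y / 2) ^ 2 - (sin (Y / 2) * sin (Y / 2) + cos (Y / 2) * cos (Y / 2)) +
         cos (Y / 2) ^ 2); [ring | rewrite S; field]. }
  rewrite Rabs_mult.
  assert (B3 : Rabs (Y / 2 + sin (Y / 2)) <= 2 * Rabs (Y / 2)).
  { eapply Rle_trans; [apply Rabs_triang|]; lra. }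
  replace (Y ^ 4) with (Rabs Y ^ 4).
  2: { replace (Rabs Y ^ 4) with ((Rabs Y ^ 2) ^ 2) by ring; rewrite pow2_abs; ring. }
  assert (E : Rabs (Y / 2) = Rabs Y / 2).
  { unfold Rdiv; rewrite Rabs_mult, (Rabs_pos_eq (/ 2)); lra. }
  rewrite E in *. assert (P := Rabs_pos Y).
  apply Rle_trans with ((Rabs Y / 2) ^ 3 * (2 * (Rabs Y / 2))).
  - apply Rmult_le_compat; auto using Rabs_pos.
  - assert (0 <= Rabs Y ^ 4) by (apply pow_le; assumption). nra.
Qed.

(** Around y = PI/2 the second term of [third] is 3 sin Y times [Jf], and Jf (PI/2) = 5/32 PI. This
    is the origin of the coefficient 15/32 PI of the cross term in [crest_expansion]. *)
Lemma third_crest Y : Rabs Y <= 1 ->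
  Rabs (third ((PI + Y) / 2) - (1 + 15 / 32 * PI * Y)) <= (8 + 5 * PI) * Y ^ 2.
Proof.
  intros HY; assert (Hpi := PI_RGT_0).
  replace ((PI + Y) / 2) with (PI / 2 + Y / 2) by field; unfold third.
  assert (Es : sin (PI / 2 + Y / 2) = cos (Y / 2)) by (rewrite sin_plus, sin_PI2, cos_PI2; ring).
  assert (Ec : cos (PI / 2 + Y / 2) = - sin (Y / 2)) by (rewrite cos_plus, sin_PI2, cos_PI2; ring).
  rewrite Es, Ec.
  assert (EJ : Jf (PI / 2) = 5 / 32 * PI) by (unfold Jf; rewrite cos_PI2; field).
  assert (DJ := Jf_lipschitz (PI / 2) (PI / 2 + Y / 2)); rewrite EJ in DJ.
  replace (PI / 2 + Y / 2 - PI / 2) with (Y / 2) in DJ by ring.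
  set (J := Jf (PI / 2 + Y / 2)) in *.
  assert (E : Rabs (Y / 2) = Rabs Y / 2).
  { unfold Rdiv; rewrite Rabs_mult, (Rabs_pos_eq (/ 2)); lra. }
  assert (P := Rabs_pos Y).
  assert (S1' : sin Y = 2 * sin (Y / 2) * cos (Y / 2)).
  { replace Y with (2 * (Y / 2)) at 1 by field; apply sin_2a. }
  replace (cos (Y / 2) ^ 8 - 6 * cos (Y / 2) * - sin (Y / 2) * J - (1 + 15 / 32 * PI * Y)) with
    ((cos (Y / 2) ^ 8 - 1) + 3 * (sin Y * (J - 5 / 32 * PI)) + - (15 / 32 * PI * (Y - sin Y)))
    by (rewrite S1'; field).
  assert (B1 := sub_sin_bound Y); assert (B2 := sin_abs_le Y).
  assert (Y2 : Y ^ 2 = Rabs Y * Rabs Y) by (rewrite <- pow2_abs; ring).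
  assert (T1 : Rabs (cos (Y / 2) ^ 8 - 1) <= 4 * Y ^ 2).
  { assert (S := sin2_cos2 (Y / 2)); unfold Rsqr in S.
    assert (B3 := sin_abs_le (Y / 2)); rewrite E in B3.
    assert (Hs : 0 <= sin (Y / 2) ^ 2 <= Y ^ 2).
    { split; [apply pow2_ge_0|]. rewrite <- pow2_abs, Y2.
      assert (Q := Rabs_pos (sin (Y / 2))); nra. }
    replace (cos (Y / 2) ^ 8) with ((cos (Y / 2) ^ 2) ^ 4) by ring.
    replace (cos (Y / 2) ^ 2) with (1 - sin (Y / 2) ^ 2) by (rewrite <- S; ring).
    set (u := sin (Y / 2) ^ 2) in *.
    assert (Hu : u <= 1) by (assert (Q := SIN_bound (Y / 2)); unfold u; nra).
    replace ((1 - u) ^ 4 - 1) with (- (u * (1 + (1 - u) + (1 - u) ^ 2 + (1 - u) ^ 3))) by ring.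
    assert (0 <= (1 - u) ^ 2 <= 1) by nra. assert (0 <= (1 - u) ^ 3 <= 1) by nra.
    rewrite Rabs_Ropp, Rabs_pos_eq by nra. nra. }
  assert (T2 : Rabs (3 * (sin Y * (J - 5 / 32 * PI))) <= 3 * Y ^ 2).
  { rewrite !Rabs_mult, (Rabs_pos_eq 3), Y2 by lra. rewrite E in DJ.
    apply Rmult_le_compat_l; [lra|]. apply Rmult_le_compat; auto using Rabs_pos; lra. }
  assert (T3 : Rabs (- (15 / 32 * PI * (Y - sin Y))) <= PI * Y ^ 2).
  { rewrite Rabs_Ropp, Rabs_mult, (Rabs_pos_eq (15 / 32 * PI)) by lra.
    assert (Rabs Y ^ 3 <= Y ^ 2) by (rewrite Y2; simpl; nra).
    assert (0 <= Y ^ 2) by apply pow2_ge_0.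
    assert (Rabs (Y - sin Y) <= Y ^ 2) by lra.
    assert (0 <= Rabs (Y - sin Y)) by apply Rabs_pos. nra. }
  assert (0 <= Y ^ 2) by apply pow2_ge_0.
  eapply Rle_trans; [apply Rabs_triang|].
  eapply Rle_trans; [apply Rplus_le_compat_r, Rabs_triang|]. nra.
Qed.

Lemma Theta'_crest_expansion :
  bigO (locally ((0, 0) : R * R))
    (fun q => Theta' (fst q, PI + snd q) - crest_expansion (fst q) (snd q))
    (fun q => Rabs (fst q) ^ 5 + Rabs (snd q) ^ 4 * Rabs (fst q)).
Proof.
  assert (Hpi := PI_RGT_0); assert (Hpi4 := PI_4).
  assert (Hpi2 : 2 < PI) by (assert (G := PI2_1); lra).
  destruct wfun_expansion as [C HC].
  (* [Rabs C] accounts for [wfun_expansion], 1 for the factor cos^2 (Y/2) and 8 + 5 PI for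
     [third_crest]. *)
  exists (Rabs C + 9 + 5 * PI).
  assert (Hd : 0 < 1 / 8) by lra.
  exists (mkposreal _ Hd); intros [X Y] [HX HY].
  assert (BX : Rabs X < 1 / 8) by (rewrite <- (Rminus_0_r X); exact HX).
  assert (BY : Rabs Y < 1 / 8) by (rewrite <- (Rminus_0_r Y); exact HY).
  clear HX HY; cbv beta iota delta [fst snd].
  assert (PX := Rabs_pos X); assert (PY := Rabs_pos Y).
  assert (X2 : X ^ 2 = Rabs X * Rabs X) by (rewrite <- pow2_abs; ring).
  assert (Y2 : Y ^ 2 = Rabs Y * Rabs Y) by (rewrite <- pow2_abs; ring).
  assert (X2b : 0 <= X ^ 2 <= 1 / 64) by nra.
  assert (X4b : 0 <= X ^ 4 <= 1 / 4096) by (replace (X ^ 4) with (X ^ 2 * X ^ 2) by ring; nra).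
  assert (BY' := Rabs_def2 _ _ BY).
  rewrite Theta'_closed.
  (* For such small X and Y the point (X, PI + Y) stays below the upper boundary, by the lower bound
     on [Ystar']. *)
  2: { assert (G := Ystar'_near X); split; simpl fst; simpl snd; nra. }
  specialize (HC X (PI + Y) ltac:(lra) ltac:(lra)).
  assert (HT := third_crest Y ltac:(lra)).
  assert (HF := crest_factor_expansion Y ltac:(lra)).
  assert (Es : sin ((PI + Y) / 2) = cos (Y / 2)).
  { replace ((PI + Y) / 2) with (PI / 2 + Y / 2) by field.
    rewrite sin_plus, sin_PI2, cos_PI2; ring. }
  rewrite Es in HC. set (th := third ((PI + Y) / 2)) in *.
  rewrite A_wfun; unfold crest_expansion.
  replace (- (X * wfun X (PI + Y)) - (- X + X ^ 3 + Y ^ 2 / 4 * X + 15 / 32 * PI * X ^ 3 * Y)) with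
    (- (X * ((wfun X (PI + Y) - cos (Y / 2) ^ 2 + X ^ 2 * th) +
      (cos (Y / 2) ^ 2 - (1 - Y ^ 2 / 4)) + - (X ^ 2 * (th - (1 + 15 / 32 * PI * Y)))))) by field.
  rewrite Rabs_Ropp, Rabs_mult.
  assert (X4 : X ^ 4 = Rabs X ^ 4).
  { replace (Rabs X ^ 4) with ((Rabs X ^ 2) ^ 2) by ring; rewrite pow2_abs; ring. }
  assert (Y4 : Y ^ 4 = Rabs Y ^ 4).
  { replace (Rabs Y ^ 4) with ((Rabs Y ^ 2) ^ 2) by ring; rewrite pow2_abs; ring. }
  replace (Rabs X ^ 5 + Rabs Y ^ 4 * Rabs X) with (Rabs X * (X ^ 4 + Y ^ 4))
    by (rewrite X4, Y4; ring).
  assert (Y4b : 0 <= Y ^ 4) by (replace (Y ^ 4) with ((Y ^ 2) ^ 2) by ring; apply pow2_ge_0).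
  rewrite (Rabs_pos_eq (Rabs X * (X ^ 4 + Y ^ 4))) by (apply Rmult_le_pos; lra).
  replace ((Rabs C + 9 + 5 * PI) * (Rabs X * (X ^ 4 + Y ^ 4))) with
    (Rabs X * ((Rabs C + 9 + 5 * PI) * (X ^ 4 + Y ^ 4))) by ring.
  apply Rmult_le_compat_l; [assumption|].
  (* The error of order X^3 Y^2 is absorbed by 2 X^2 Y^2 <= X^4 + Y^4. *)
  assert (HM : X ^ 2 * Rabs (th - (1 + 15 / 32 * PI * Y)) <= (8 + 5 * PI) * (X ^ 4 + Y ^ 4)).
  { apply Rle_trans with (X ^ 2 * ((8 + 5 * PI) * Y ^ 2)).
    - apply Rmult_le_compat_l; lra.
    - replace (X ^ 2 * ((8 + 5 * PI) * Y ^ 2)) with ((8 + 5 * PI) * (X ^ 2 * Y ^ 2)) by ring.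
      apply Rmult_le_compat_l; [lra|].
      assert (Q := pow2_ge_0 (X ^ 2 - Y ^ 2)). assert (Q1 := pow2_ge_0 X).
      assert (Q2 := pow2_ge_0 Y). nra. }
  assert (HC' : C * X ^ 4 <= Rabs C * X ^ 4).
  { apply Rmult_le_compat_r; [lra | apply Rle_abs]. }
  eapply Rle_trans; [apply Rabs_triang|].
  eapply Rle_trans; [apply Rplus_le_compat_r, Rabs_triang|].
  rewrite Rabs_Ropp, (Rabs_mult (X ^ 2)), (Rabs_pos_eq (X ^ 2)) by lra.
  assert (0 <= Rabs C * Y ^ 4) by (apply Rmult_le_pos; [apply Rabs_pos | assumption]).
  nra.
Qed.

(** * The third derivative on the axis *)

Lemma is_derive_n_chain (g : nat -> R -> R) :
  (forall n x, is_derive (g n) x (g (S n) x)) ->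
  forall n x, is_derive_n (g 0%nat) n x (g n x).
Proof.
  intros H; induction n as [|n IH]; intros x; [reflexivity|].
  simpl; apply is_derive_ext with (g n); [|apply H].
  intros t; symmetry; apply is_derive_n_unique, IH.
Qed.

(* The third finite difference of step [y] kills quadratic polynomials. *)
Lemma third_derivative_of_bound (g : nat -> R -> R) c1 c3 C M :
  (forall n x, is_derive (g n) x (g (S n) x)) ->
  (forall x, 0 <= x <= 1 -> Rabs (g 4%nat x) <= M) ->
  (forall x, Rabs x <= 1 -> Rabs (g 0%nat x - (c1 * x + c3 * x ^ 3)) <= C * x ^ 4) ->
  g 3%nat 0 = 6 * c3.
Proof.
  intros Hd HM HC.
  assert (Hn := is_derive_n_chain g Hd).
  set (a := fun k => g k 0).
  assert (HM0 : 0 <= M) by (eapply Rle_trans; [apply Rabs_pos | apply (HM 0); lra]).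
  assert (HC0 : 0 <= C).
  { assert (G := HC 1 ltac:(rewrite Rabs_R1; lra)).
    assert (G' := Rabs_pos (g 0%nat 1 - (c1 * 1 + c3 * 1 ^ 3))). lra. }
  assert (T : forall y, 0 <= y <= 1 ->
    Rabs (g 0%nat y - (a 0%nat + a 1%nat * y + a 2%nat / 2 * y ^ 2 + a 3%nat / 6 * y ^ 3)) <= M * y ^ 4).
  { intros y Hy; destruct (Req_dec y 0) as [-> | Hn0].
    { unfold a; match goal with |- Rabs ?t <= _ => replace t with 0 by field end.
      rewrite Rabs_R0; apply Rmult_le_pos; [assumption | apply pow_le; lra]. }
    destruct (Taylor_Lagrange (g 0%nat) 3 0 y ltac:(lra)) as (z & Hz & E).
    { intros t _ k _; destruct k; [exact I|]; eexists; apply (Hn (S k) t). }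
    cbn [sum_f_R0] in E.
    rewrite !(fun k x => is_derive_n_unique _ _ _ _ (Hn k x)) in E.
    simpl fact in E; simpl INR in E.
    assert (E' : g 0%nat y - (a 0%nat + a 1%nat * y + a 2%nat / 2 * y ^ 2 + a 3%nat / 6 * y ^ 3) =
      y ^ 4 / 24 * g 4%nat z).
    { rewrite E; unfold a; field. }
    rewrite E', Rabs_mult, Rabs_pos_eq.
    2: { apply Rdiv_le_0_compat; [apply pow_le; lra | lra]. }
    assert (B := HM z ltac:(lra)).
    assert (0 <= y ^ 4) by (apply pow_le; lra).
    assert (0 <= Rabs (g 4%nat z)) by apply Rabs_pos. nra. }
  set (D := fun y => a 0%nat + (a 1%nat - c1) * y + a 2%nat / 2 * y ^ 2 + (a 3%nat / 6 - c3) * y ^ 3).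
  assert (B : forall y, 0 <= y <= 1 -> Rabs (D y) <= (M + C) * y ^ 4).
  { intros y Hy; assert (H1 := T y Hy); assert (H2 := HC y ltac:(rewrite Rabs_pos_eq; lra)).
    replace (D y) with (- (g 0%nat y - (a 0%nat + a 1%nat * y + a 2%nat / 2 * y ^ 2 + a 3%nat / 6 * y ^ 3))
      + (g 0%nat y - (c1 * y + c3 * y ^ 3))) by (unfold D; ring).
    eapply Rle_trans; [apply Rabs_triang|]; rewrite Rabs_Ropp; lra. }
  destruct (Req_dec (a 3%nat / 6 - c3) 0) as [E | E]; [unfold a in E; lra|]; exfalso.
  set (u := Rabs (a 3%nat / 6 - c3)).
  assert (Hu : 0 < u) by (apply Rabs_pos_lt; assumption).
  (* So small that 132 (M + C) y < 6 u; the bound 1/3 keeps 3 y in the interval where the estimates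
     hold. *)
  set (y := Rmin (1 / 3) (u / (100 * (M + C + 1)))).
  assert (Hy : 0 < y).
  { apply Rmin_pos; [lra|]; apply Rdiv_lt_0_compat; lra. }
  assert (Hy1 : y <= 1 / 3) by apply Rmin_l.
  assert (Hy2 : 100 * (M + C + 1) * y <= u).
  { apply Rle_trans with (100 * (M + C + 1) * (u / (100 * (M + C + 1)))).
    - apply Rmult_le_compat_l; [lra | apply Rmin_r].
    - apply Req_le; field; lra. }
  assert (B0 := B 0 ltac:(lra)); assert (B1 := B y ltac:(lra)).
  assert (B2 := B (2 * y) ltac:(lra)); assert (B3 := B (3 * y) ltac:(lra)).
  assert (Eq : D (3 * y) - 3 * D (2 * y) + 3 * D y - D 0 = 6 * (a 3%nat / 6 - c3) * y ^ 3).
  { unfold D; field. }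
  apply Rabs_le_between in B0; apply Rabs_le_between in B1.
  apply Rabs_le_between in B2; apply Rabs_le_between in B3.
  (* 132 = 81 + 3 * 16 + 3, from the fourth powers of 3 y, 2 y and y. *)
  assert (Bd : Rabs (D (3 * y) - 3 * D (2 * y) + 3 * D y - D 0) <= (M + C) * y ^ 4 * 132).
  { apply Rabs_le; replace ((2 * y) ^ 4) with (16 * y ^ 4) in * by ring.
    replace ((3 * y) ^ 4) with (81 * y ^ 4) in * by ring.
    replace (0 ^ 4) with 0 in * by ring. lra. }
  assert (Y3 : 0 < y ^ 3) by (apply pow_lt; assumption).
  rewrite Eq, !Rabs_mult, (Rabs_pos_eq 6), (Rabs_pos_eq (y ^ 3)) in Bd by lra.
  fold u in Bd.
  assert (Bd' : (6 * u) * y ^ 3 <= (132 * (M + C) * y) * y ^ 3) by (simpl in *; lra).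
  apply Rmult_le_reg_r in Bd'; [|assumption].
  assert (0 <= (M + C) * y) by (apply Rmult_le_pos; lra). nra.
Qed.

Lemma A_chain Y n x :
  is_derive (fun X => mixed A n 0 X Y) x (mixed A (S n) 0 x Y).
Proof.
  destruct (AN_mixed (box (x - 1) (x + 1) (Y - 1) (Y + 1)) A (open2_box _ _ _ _) (AN_A _ _ _ _))
    as (_ & _ & _ & _ & _ & _ & D & _).
  apply D, box_around.
Qed.

(** The expansion of [wfun] is only an estimate for each X and cannot be differentiated. Since [A]
    is smooth in X with bounded fourth derivative, the estimate nevertheless determines the third
    derivative. *)
Lemma A_third Y : 0 <= Y <= 2 * PI -> mixed A 3 0 0 Y = - (6 * third (Y / 2)).
Proof.
  intros HY; destruct wfun_expansion as [C HC].
  destruct (AN_mixed (box (-1) 2 (Y - 1) (Y + 1)) A (open2_box _ _ _ _) (AN_A _ _ _ _))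
    as (_ & _ & _ & _ & AM & _).
  destruct (AN_bounded _ _ (open2_box _ _ _ _) (AM 4%nat 0%nat)) as (M & _ & HM).
  replace (- (6 * third (Y / 2))) with (6 * - third (Y / 2)) by ring.
  apply (third_derivative_of_bound (fun n X => mixed A n 0 X Y) (sin (Y / 2) ^ 2)
    (- third (Y / 2)) (Rabs C) M).
  - apply A_chain.
  - intros x Hx; apply HM; split; lra.
  - intros X HX; change (mixed A 0 0 X Y) with (A X Y); rewrite A_wfun.
    replace (X * wfun X Y - (sin (Y / 2) ^ 2 * X + - third (Y / 2) * X ^ 3)) with
      (X * (wfun X Y - sin (Y / 2) ^ 2 + X ^ 2 * third (Y / 2))) by ring.
    rewrite Rabs_mult; specialize (HC X Y HX HY).
    assert (0 <= X ^ 4) by (replace (X ^ 4) with ((X ^ 2) ^ 2) by ring; apply pow2_ge_0).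
    apply Rle_trans with (1 * (C * X ^ 4)).
    + apply Rmult_le_compat; auto using Rabs_pos.
    + rewrite Rmult_1_l; apply Rmult_le_compat_r; [assumption | apply Rle_abs].
Qed.

(** Both denominators are multiples of d = 7 - 6 sin^2 (Y/2): cos^2 + 1/6 = d/6 and 3 cos^2 + 1/2 =
    d/2. Over the common denominator the numerator is divisible by d, so no fraction remains. *)
Lemma trace3_third Y : 0 <= Y <= 2 * PI -> trace3 Y = 6 * third (Y / 2).
Proof.
  intros HY; unfold trace3, indicator.
  destruct (Rle_dec 0 Y); [|lra]; destruct (Rle_dec Y (2 * PI)); [|lra].
  unfold third, Jf; set (y := Y / 2).
  replace Y with (2 * y) by (unfold y; field).
  rewrite (sin_2a (2 * y)), (cos_2a y), sin_2a.
  assert (S := sin2_cos2 y); unfold Rsqr in S.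
  set (s := sin y) in *; set (c := cos y) in *.
  assert (C2 : c ^ 2 = 1 - s ^ 2) by (simpl; lra).
  assert (Hc : 0 <= c ^ 2) by apply pow2_ge_0.
  rewrite C2 in Hc |- *.
  replace (c * c) with (1 - s ^ 2) by (simpl; lra).
  set (d := 7 - 6 * s ^ 2). assert (Hd : 1 <= d) by (unfold d; lra).
  transitivity (6 * (1 / 576 * (576 * s ^ 8 / d - 1080 * y * s * c +
    c ^ 2 * (320 * s ^ 2 - 24 * s ^ 2 * (1 - s ^ 2 - s * s) + 5488 * s ^ 2 / d)))).
  { unfold d; field; unfold d in Hd; lra. }
  transitivity (6 * (s ^ 8 - 15 / 8 * y * s * c +
    6 * s * (1 - s ^ 2) * (s ^ 5 / 6 + 5 / 24 * s ^ 3 + 5 / 16 * s))).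
  2: { rewrite <- C2; field. }
  rewrite C2; unfold d; field; unfold d in Hd; lra.
Qed.

Lemma strip_near_axis Y : 0 < Y < 2 * PI -> locally 0 (fun X => strip (X, Y)).
Proof.
  intros HY; apply (locally_2d_fst (fun X Y => strip (X, Y))).
  assert (H : - (PI / 2) < phi 0 Y < PI / 2) by (rewrite phi_0_l; lra).
  apply locally_2d_impl with (2 := locally_phi_lt 0 Y _ (proj2 H)).
  apply locally_2d_impl with (2 := locally_phi_gt 0 Y _ (proj1 H)).
  apply locally_2d_forall; intros x y H1 H2; rewrite strip_phi; lra.
Qed.

Lemma Ystar'_le_PI X : Ystar' X <= PI.
Proof.
  assert (Hpi := PI_RGT_0).
  destruct (Kfun_incr X (- (PI / 2)) (PI / 2)) as [_ H]; [lra|].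
  rewrite Kfun_start, Kfun_top in H; lra.
Qed.

Lemma third_0 : third 0 = 0.
Proof. unfold third; rewrite sin_0; ring. Qed.

Lemma third_PI : third PI = 0.
Proof. unfold third; rewrite sin_PI; ring. Qed.

Lemma Theta'_third_derivative Y : 0 <= Y ->
  has_derive_n (fun X => Theta' (X, Y)) 3 0 (trace3 Y).
Proof.
  intros HY; assert (Hpi := PI_RGT_0).
  assert (Loc : forall (g : nat -> R -> R), (forall n x, is_derive (g n) x (g (S n) x)) ->
    locally 0 (fun X => g 0%nat X = Theta' (X, Y)) ->
    has_derive_n (fun X => Theta' (X, Y)) 3 0 (g 3%nat 0)).
  { intros g Hg HE; assert (Hn := is_derive_n_chain g Hg); split.
    - apply locally_locally in HE; apply filter_imp with (2 := HE); intros z Hz k _.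
      apply ex_derive_n_ext_loc with (1 := Hz).
      destruct k; [exact I|]; eexists; apply (Hn (S k) z).
    - apply is_derive_n_ext_loc with (1 := HE); apply Hn. }
  (* Covers Y = 0 and Y >= 2 PI: since [Ystar'] is at most PI, the whole horizontal line then misses
     the strip and the profile vanishes along it. *)
  assert (Zero : (forall X, ~ strip (X, Y)) -> trace3 Y = 0 ->
    has_derive_n (fun X => Theta' (X, Y)) 3 0 (trace3 Y)).
  { intros HS ->; apply (Loc (fun _ _ => 0)).
    - intros; apply Rderive_const.
    - apply filter_forall; intros X; rewrite Theta'_cut, cut_out; auto. }
  destruct (Rle_lt_or_eq_dec 0 Y HY) as [H0 | <-].
  - destruct (Rlt_le_dec Y (2 * PI)) as [H1 | H1].
    + replace (trace3 Y) with (- mixed A 3 0 0 Y).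
      2: { rewrite A_third, trace3_third by lra; ring. }
      apply (Loc (fun n X => - mixed A n 0 X Y)).
      * intros n x; apply Rderive_opp, A_chain.
      * apply filter_imp with (2 := strip_near_axis Y ltac:(lra)); intros X HX.
        rewrite Theta'_cut, cut_in by assumption; reflexivity.
    + apply Zero.
      * intros X [_ H]; simpl in H; assert (G := Ystar'_le_PI X); lra.
      * destruct (Rle_lt_or_eq_dec _ _ H1) as [H2 | <-].
        -- unfold trace3, indicator; destruct (Rle_dec 0 Y); [|lra].
           destruct (Rle_dec Y (2 * PI)); [lra | ring].
        -- rewrite trace3_third by lra; replace (2 * PI / 2) with PI by field.
           rewrite third_PI; ring.
  - apply Zero.
    + intros X [H _]; simpl in H; lra.
    + rewrite trace3_third by lra; replace (0 / 2) with 0 by field; rewrite third_0; ring.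
Qed.

Lemma Derive_n_Theta' Y : 0 <= Y <= 2 * PI ->
  Derive_n (fun X => Theta' (X, Y)) 3 0 = 6 * third (Y / 2).
Proof.
  intros HY; rewrite <- trace3_third by assumption.
  apply is_derive_n_unique, Theta'_third_derivative; lra.
Qed.

Lemma strict_pos_of_derive (f df : R -> R) y : 0 < y -> f 0 = 0 ->
  (forall t, is_derive f t (df t)) -> (forall t, 0 < t < y -> 0 < df t) -> 0 < f y.
Proof.
  intros Hy H0 Hd Hp; destruct (MVT_cor2 f df 0 y Hy) as (c & E & Hc).
  { intros; apply is_derive_Reals, Hd. }
  specialize (Hp c Hc); rewrite H0 in E; nra.
Qed.

Lemma Jf_pos y : 0 < y < PI -> 0 < Jf y.
Proof.
  intros Hy; apply strict_pos_of_derive with (fun y => sin y ^ 6); [lra | apply Jf_0 | apply is_derive_Jf|].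
  intros t Ht; apply pow_lt, sin_gt_0; lra.
Qed.

(** After division by sin y > 0 the remaining factor sin^7 - 6 cos Jf vanishes at 0 and has
    derivative sin^6 cos + 6 sin Jf, positive up to PI/2. Beyond PI/2 the cosine is negative and
    both terms are positive. *)
Lemma third_pos y : 0 < y < PI -> 0 < third y.
Proof.
  intros Hy; assert (HJ := Jf_pos y Hy).
  assert (Hs : 0 < sin y) by (apply sin_gt_0; lra).
  replace (third y) with (sin y * (sin y ^ 7 - 6 * cos y * Jf y)) by (unfold third; ring).
  apply Rmult_lt_0_compat; [assumption|].
  destruct (Rle_lt_dec y (PI / 2)) as [H | H].
  - apply (strict_pos_of_derive (fun y => sin y ^ 7 - 6 * cos y * Jf y)
      (fun y => sin y ^ 6 * cos y + 6 * sin y * Jf y)); [lra | rewrite sin_0, Jf_0; ring | |].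
    + intros t; replace (sin t ^ 6 * cos t + 6 * sin t * Jf t) with
        (7 * sin t ^ 6 * cos t - ((- (6 * sin t)) * Jf t + 6 * cos t * sin t ^ 6)) by ring.
      apply Rderive_minus.
      * auto_derive; trivial; ring.
      * apply (is_derive_mult (fun t => 6 * cos t) Jf); [|apply is_derive_Jf|intros; apply Rmult_comm].
        auto_derive; trivial; ring.
    + intros t Ht; assert (0 < Jf t) by (apply Jf_pos; lra).
      assert (0 < sin t) by (apply sin_gt_0; lra).
      assert (0 < cos t) by (apply cos_gt_0; lra).
      apply Rplus_lt_0_compat; repeat apply Rmult_lt_0_compat; try apply pow_lt; lra.
  - assert (cos y < 0) by (apply cos_lt_0; lra).
    assert (0 < sin y ^ 7) by (apply pow_lt; assumption). nra.
Qed.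

Lemma Theta'_third_pos Y : 0 < Y < 2 * PI ->
  0 < Derive_n (fun X => Theta' (X, Y)) 3 0.
Proof.
  intros HY; rewrite Derive_n_Theta' by lra.
  assert (H := third_pos (Y / 2) ltac:(lra)); lra.
Qed.

Lemma Theta'_third_bottom : exists c, 0 < c /\
  bigO (at_right 0) (fun Y => Derive_n (fun X => Theta' (X, Y)) 3 0 - c * Y ^ 8)
    (fun Y => Y ^ 10).
Proof.
  assert (Hpi2 : 2 < PI) by (assert (G := PI2_1); lra).
  (* With y = Y/2, Jf y is close to y^7/7, hence [third] to y^8 - 6/7 y^8 = y^8/7; then 6 / (7 *
     2^8) = 3/896. *)
  exists (3 / 896); split; [lra|].
  exists 1000, (mkposreal 1 Rlt_0_1); intros Y HB HY.
  assert (HY1 : Y < 1).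
  { assert (G : Rabs (Y - 0) < 1) by exact HB; rewrite Rminus_0_r in G; apply Rabs_def2 in G; lra. }
  rewrite Derive_n_Theta' by lra; set (y := Y / 2).
  replace Y with (2 * y) by (unfold y; field).
  assert (Hy : 0 < y < 1 / 2) by (unfold y; lra).
  assert (SB : forall t, 0 <= t <= 1 / 2 -> 0 <= sin t <= t /\ t - sin t <= t ^ 3).
  { intros t Ht; assert (0 <= sin t) by (apply sin_ge_0; lra).
    assert (B1 := sin_abs_le t); assert (B2 := sub_sin_bound t).
    rewrite !Rabs_pos_eq in B1 by lra. rewrite (Rabs_pos_eq t) in B2 by lra.
    assert (B3 := Rle_abs (t - sin t)). lra. }
  assert (PB : forall n t, 0 <= t <= 1 / 2 -> 0 <= t ^ n - sin t ^ n <= INR n * t ^ (n + 2)).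
  { induction n as [|n IH]; intros t Ht; [simpl; lra|].
    destruct (SB t Ht) as [[S1 S2] S3]; destruct (IH t Ht) as [I1 I2].
    rewrite S_INR. replace (t ^ S n - sin t ^ S n) with
      (t * (t ^ n - sin t ^ n) + (t - sin t) * sin t ^ n) by (simpl; ring).
    assert (P0 : 0 <= sin t ^ n <= t ^ n).
    { split; [apply pow_le; assumption | apply pow_incr; lra]. }
    assert (Q1 : (t - sin t) * sin t ^ n <= t ^ 3 * t ^ n) by (apply Rmult_le_compat; lra).
    assert (Q2 : t * (t ^ n - sin t ^ n) <= t * (INR n * t ^ (n + 2))).
    { apply Rmult_le_compat_l; lra. }
    assert (Q3 : 0 <= (t - sin t) * sin t ^ n) by (apply Rmult_le_pos; lra).
    assert (Q4 : 0 <= t * (t ^ n - sin t ^ n)) by (apply Rmult_le_pos; lra).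
    replace ((INR n + 1) * t ^ (S n + 2)) with (t * (INR n * t ^ (n + 2)) + t ^ 3 * t ^ n).
    2: { rewrite !pow_add; simpl; ring. }
    lra. }
  assert (HJ : Rabs (Jf y - y ^ 7 / 7) <= 6 * y ^ 9).
  { destruct (MVT_cor2 (fun t => Jf t - t ^ 7 / 7) (fun t => sin t ^ 6 - t ^ 6) 0 y ltac:(lra))
      as (c & E & Hc).
    { intros t _; apply is_derive_Reals, Rderive_minus;
        [apply is_derive_Jf | auto_derive; trivial; field]. }
    rewrite Jf_0 in E. replace (Jf y - y ^ 7 / 7) with ((sin c ^ 6 - c ^ 6) * y) by lra.
    rewrite Rabs_mult, (Rabs_pos_eq y) by lra.
    destruct (PB 6%nat c ltac:(lra)) as [B1 B2]; simpl INR in B2.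
    replace (6 * y ^ 9) with (6 * y ^ 8 * y) by ring.
    apply Rmult_le_compat_r; [lra|].
    assert (c ^ 8 <= y ^ 8) by (apply pow_incr; lra).
    simpl Nat.add in B2. rewrite Rabs_minus_sym, Rabs_pos_eq by lra. lra. }
  destruct (PB 8%nat y ltac:(lra)) as [B1 B2]; simpl INR in B2; simpl Nat.add in B2.
  assert (Hsc : Rabs (sin y * cos y - y) <= 4 * y ^ 3).
  { assert (G := sub_sin_bound (2 * y)); rewrite sin_2a in G.
    rewrite (Rabs_pos_eq (2 * y)) in G by lra.
    replace (sin y * cos y - y) with (- / 2 * (2 * y - 2 * sin y * cos y)) by field.
    rewrite Rabs_mult, Rabs_Ropp, Rabs_pos_eq by lra. simpl in *; lra. }
  assert (P9 : 0 <= y ^ 9) by (apply pow_le; lra).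
  assert (P7 : 0 <= y ^ 7) by (apply pow_le; lra).
  assert (P10 : 0 <= y ^ 10) by (apply pow_le; lra).
  assert (HJ2 : Rabs (Jf y) <= 2 * y ^ 7).
  { replace (Jf y) with ((Jf y - y ^ 7 / 7) + y ^ 7 / 7) by ring.
    eapply Rle_trans; [apply Rabs_triang|]. rewrite (Rabs_pos_eq (y ^ 7 / 7)) by lra.
    assert (y ^ 9 <= y ^ 7 / 4).
    { replace (y ^ 9) with (y ^ 2 * y ^ 7) by ring. assert (y ^ 2 <= 1 / 4) by nra. nra. }
    lra. }
  unfold third.
  replace (6 * (sin y ^ 8 - 6 * sin y * cos y * Jf y) - 3 / 896 * (2 * y) ^ 8) with
    (- 6 * (y ^ 8 - sin y ^ 8) + (- 36) * ((sin y * cos y - y) * Jf y) +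
     (- 36) * (y * (Jf y - y ^ 7 / 7))) by field.
  eapply Rle_trans; [apply Rabs_triang|].
  eapply Rle_trans; [apply Rplus_le_compat_r, Rabs_triang|].
  rewrite !Rabs_mult, (Rabs_left (-6)), (Rabs_left (-36)), (Rabs_pos_eq y),
    (Rabs_pos_eq (y ^ 8 - sin y ^ 8)) by lra.
  assert (F1 : Rabs (sin y * cos y - y) * Rabs (Jf y) <= 4 * y ^ 3 * (2 * y ^ 7)).
  { apply Rmult_le_compat; auto using Rabs_pos. }
  assert (F2 : y * Rabs (Jf y - y ^ 7 / 7) <= y * (6 * y ^ 9)).
  { apply Rmult_le_compat_l; lra. }
  rewrite (Rabs_pos_eq ((2 * y) ^ 10)) by (apply pow_le; lra).
  replace ((2 * y) ^ 10) with (1024 * y ^ 10) by ring.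
  replace (4 * y ^ 3 * (2 * y ^ 7)) with (8 * y ^ 10) in F1 by ring.
  replace (y * (6 * y ^ 9)) with (6 * y ^ 10) in F2 by ring.
  lra.
Qed.

Lemma Theta'_third_top : exists c', 0 < c' /\
  bigO (at_right 0)
    (fun Y => Derive_n (fun X => Theta' (X, 2 * PI - Y)) 3 0 - c' * Y)
    (fun Y => Y ^ 2).
Proof.
  assert (Hpi2 : 2 < PI) by (assert (G := PI2_1); lra). assert (Hpi4 := PI_4).
  (* With y = Y/2, third (PI - y) is close to 6 y Jf PI = 15/8 PI y; multiplied by 6 this is 45/8 PI
     Y. *)
  exists (45 / 8 * PI); split; [lra|].
  exists 1000, (mkposreal 1 Rlt_0_1); intros Y HB HY.
  assert (HY1 : Y < 1).
  { assert (G : Rabs (Y - 0) < 1) by exact HB; rewrite Rminus_0_r in G; apply Rabs_def2 in G; lra. }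
  rewrite Derive_n_Theta' by lra.
  set (y := Y / 2). replace Y with (2 * y) by (unfold y; field).
  assert (Hy : 0 < y < 1 / 2) by (unfold y; lra).
  replace ((2 * PI - 2 * y) / 2) with (PI - y) by field.
  assert (Es : sin (PI - y) = sin y) by apply sin_PI_x.
  assert (Ec : cos (PI - y) = - cos y) by (rewrite cos_minus, cos_PI, sin_PI; ring).
  assert (EJ : Jf (PI - y) = 5 / 16 * PI - Jf y) by (unfold Jf; rewrite Es, Ec; field).
  unfold third; rewrite Es, Ec, EJ.
  assert (G := sub_sin_bound (2 * y)); rewrite sin_2a in G.
  rewrite (Rabs_pos_eq (2 * y)) in G by lra.
  assert (HJ := Jf_lipschitz 0 y); rewrite Jf_0, !Rminus_0_r, (Rabs_pos_eq y) in HJ by lra.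
  assert (B := sin_abs_le y); rewrite (Rabs_pos_eq y) in B by lra.
  assert (Y3 : (2 * y) ^ 3 <= 4 * y ^ 2) by (simpl; nra).
  assert (H8 : Rabs (sin y ^ 8) <= y ^ 2).
  { rewrite <- RPow_abs. apply Rle_trans with (y ^ 8).
    - apply pow_incr; split; [apply Rabs_pos | assumption].
    - replace (y ^ 8) with (y ^ 6 * y ^ 2) by ring.
      assert (y ^ 6 <= 1) by (rewrite <- (pow1 6); apply pow_incr; lra).
      assert (0 <= y ^ 2) by apply pow2_ge_0. nra. }
  assert (Hsc : Rabs (sin y * cos y) <= y).
  { rewrite Rabs_mult; assert (Rabs (cos y) <= 1) by (apply Rabs_le, COS_bound).
    assert (Q := Rabs_pos (sin y)); assert (Q' := Rabs_pos (cos y)); nra. }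
  replace (6 * (sin y ^ 8 - 6 * sin y * - cos y * (5 / 16 * PI - Jf y)) - 45 / 8 * PI * (2 * y)) with
    (6 * sin y ^ 8 + (- (45 / 8 * PI)) * (2 * y - 2 * sin y * cos y) +
     (- 36) * ((sin y * cos y) * Jf y)) by field.
  eapply Rle_trans; [apply Rabs_triang|].
  eapply Rle_trans; [apply Rplus_le_compat_r, Rabs_triang|].
  rewrite (Rabs_mult 6), (Rabs_mult (- (45 / 8 * PI))), (Rabs_mult (- 36)), (Rabs_mult (sin y * cos y)),
    (Rabs_Ropp (45 / 8 * PI)), (Rabs_left (-36)), (Rabs_pos_eq 6), (Rabs_pos_eq (45 / 8 * PI)) by lra.
  assert (F1 : Rabs (sin y * cos y) * Rabs (Jf y) <= y * y).
  { apply Rmult_le_compat; auto using Rabs_pos. }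
  assert (P2 : 0 <= y ^ 2) by apply pow2_ge_0.
  assert (F2 : 45 / 8 * PI * Rabs (2 * y - 2 * sin y * cos y) <= 45 / 8 * 4 * (4 * y ^ 2)).
  { apply Rmult_le_compat; auto using Rabs_pos; lra. }
  rewrite (Rabs_pos_eq ((2 * y) ^ 2)) by apply pow2_ge_0.
  replace (y * y) with (y ^ 2) in F1 by ring. replace ((2 * y) ^ 2) with (4 * y ^ 2) by ring.
  lra.
Qed.

(** * Behaviour at infinity *)

(* After the scaling [X = r^3], [b = r u], the density becomes
   [hroot (r^-2 + u^2) / r^2], where [r^-2] is a small perturbation. *)
Definition oroot (s : R) : R := epsilon (inhabits 0) (fun w => w ^ 3 + w * s = 1).

Definition hroot (s : R) : R := / (s + 3 * oroot s ^ 2).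

Lemma oroot_eq s : 0 <= s -> oroot s ^ 3 + oroot s * s = 1.
Proof.
  intros Hs; unfold oroot; apply epsilon_spec.
  destruct (IVT_gen (fun w => w ^ 3 + w * s) 0 1 1) as (w & _ & Hw).
  - intros w; apply derivable_continuous_pt; exists (3 * w ^ 2 + s).
    apply is_derive_Reals; auto_derive; trivial; ring.
  - rewrite Rmin_left, Rmax_right; lra.
  - exists w; exact Hw.
Qed.

Lemma oroot_unique s w : 0 <= s -> w ^ 3 + w * s = 1 -> oroot s = w.
Proof.
  intros Hs H; assert (E := oroot_eq s Hs); set (v := oroot s) in *.
  assert (P : (v - w) * (v ^ 2 + v * w + w ^ 2 + s) = 0) by (ring_simplify; nra).
  apply Rmult_integral in P; destruct P as [P | P]; [lra|].
  assert (v ^ 2 + v * w + w ^ 2 = (v + w / 2) ^ 2 + 3 / 4 * w ^ 2) by field.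
  assert (H1 := pow2_ge_0 (v + w / 2)); assert (H2 := pow2_ge_0 w).
  assert (w ^ 2 = 0) by lra. assert (w = 0) by nra. subst w; lra.
Qed.

Lemma oroot_bounds s : 0 <= s -> 0 < oroot s <= 1.
Proof.
  intros Hs; assert (E := oroot_eq s Hs); set (v := oroot s) in *.
  assert (0 < v).
  { destruct (Rlt_or_le 0 v); [assumption|].
    assert (v ^ 3 <= 0) by nra. nra. }
  split; [assumption|]. destruct (Rle_or_lt v 1); [assumption|].
  assert (1 < v ^ 3) by (simpl; nra). nra.
Qed.

Lemma hroot_den s : 0 <= s -> (1 + s) / 2 <= s + 3 * oroot s ^ 2.
Proof.
  intros Hs; assert (E := oroot_eq s Hs); assert (B := oroot_bounds s Hs).
  set (v := oroot s) in *. assert (H := pow2_ge_0 v).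
  destruct (Rle_or_lt 1 s); [lra|].
  assert (1 / 2 <= v).
  { destruct (Rle_or_lt (1 / 2) v); [assumption|].
    assert (v ^ 3 <= 1 / 8) by (simpl; nra). nra. }
  nra.
Qed.

Lemma hroot_bounds s : 0 <= s -> 0 < hroot s <= 2 / (1 + s).
Proof.
  intros Hs; assert (D := hroot_den s Hs); unfold hroot; split.
  - apply Rinv_0_lt_compat; lra.
  - replace (2 / (1 + s)) with (/ ((1 + s) / 2)) by (field; lra).
    apply Rinv_le_contravar; lra.
Qed.

(** Both factors [hroot] are kept on the right: with s1 = e + u^2 and s2 = u^2 their product decays
    like 1 / (1 + u^2) at least, so the perturbation e costs O(e) after integration, uniformly in
    the upper limit. *)
Lemma hroot_lipschitz s1 s2 : 0 <= s1 -> 0 <= s2 ->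
  Rabs (hroot s1 - hroot s2) <= 4 * Rabs (s1 - s2) * (hroot s1 * hroot s2).
Proof.
  intros H1 H2; assert (E1 := oroot_eq s1 H1); assert (E2 := oroot_eq s2 H2).
  assert (B1 := oroot_bounds s1 H1); assert (B2 := oroot_bounds s2 H2).
  assert (D1 := hroot_den s1 H1); assert (D2 := hroot_den s2 H2).
  assert (P1 := hroot_bounds s1 H1); assert (P2 := hroot_bounds s2 H2).
  unfold hroot in *; set (v := oroot s1) in *; set (w := oroot s2) in *.
  set (S := v ^ 2 + v * w + w ^ 2 + s1).
  assert (HS : 0 < S) by (unfold S; nra).
  assert (Q : v ^ 2 - w ^ 2 = - (s1 - s2) * (w * (v + w) / S)).
  { apply Rmult_eq_reg_r with S; [|lra].
    transitivity (- (s1 - s2) * (w * (v + w))); [|field; lra].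
    transitivity ((v + w) * ((v - w) * S)); [ring|].
    replace ((v - w) * S) with (- (s1 - s2) * w) by (unfold S; nra). ring. }
  assert (HQ : 0 <= w * (v + w) / S <= 1).
  { split; [apply Rdiv_le_0_compat; nra|].
    apply Rmult_le_reg_r with S; [assumption|].
    unfold Rdiv; rewrite Rmult_assoc, Rinv_l by lra. unfold S; nra. }
  replace (/ (s1 + 3 * v ^ 2) - / (s2 + 3 * w ^ 2)) with
    (- (s1 - s2 + 3 * (v ^ 2 - w ^ 2)) * (/ (s1 + 3 * v ^ 2) * / (s2 + 3 * w ^ 2)))
    by (field; lra).
  rewrite Rabs_mult, (Rabs_pos_eq (/ _ * / _)) by (apply Rmult_le_pos; lra).
  apply Rmult_le_compat_r; [apply Rmult_le_pos; lra|].
  rewrite Rabs_Ropp, Q. set (k := w * (v + w) / S) in *.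
  replace (s1 - s2 + 3 * (- (s1 - s2) * k)) with ((1 - 3 * k) * (s1 - s2)) by ring.
  rewrite Rabs_mult; apply Rmult_le_compat_r; [apply Rabs_pos|].
  apply Rabs_le; lra.
Qed.

(** The integral starts at 0, the midpoint of an even integrand, so that for e = r^-2 its limit at
    infinity is r * Ystar' (r^3) / 2. The case e = 0 provides the leading coefficient. *)
Definition Gfun (e g : R) : R := RInt (fun u => hroot (e + u ^ 2)) 0 g.

Lemma sq_shift_nonneg e u : 0 <= e -> 0 <= e + u ^ 2.
Proof. assert (H := pow2_ge_0 u); lra. Qed.

Lemma continuous_hroot_sq e u : 0 <= e -> continuous (fun u => hroot (e + u ^ 2)) u.
Proof.
  intros He; apply continuity_pt_filterlim.
  intros eps Heps.
  assert (D : continuity_pt (fun t => t ^ 2) u).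
  { apply derivable_continuous_pt; exists (2 * u); apply is_derive_Reals; auto_derive; trivial; ring. }
  destruct (D (eps / 16) ltac:(lra)) as (d & Hd & HD).
  exists d; split; [exact Hd|]; intros t Ht; specialize (HD t Ht).
  simpl in *; unfold Rdist in *.
  change (t * (t * 1)) with (t ^ 2) in *; change (u * (u * 1)) with (u ^ 2) in *.
  eapply Rle_lt_trans; [apply hroot_lipschitz; apply sq_shift_nonneg, He|].
  assert (B : forall v, 0 < hroot (e + v ^ 2) <= 2).
  { intros v; assert (Hv := sq_shift_nonneg e v He); destruct (hroot_bounds _ Hv) as [B1 B2].
    split; [assumption|]. eapply Rle_trans; [exact B2|].
    apply Rmult_le_reg_r with (1 + (e + v ^ 2)); [lra|].
    unfold Rdiv; rewrite Rmult_assoc, Rinv_l by lra; lra. }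
  replace (e + t ^ 2 - (e + u ^ 2)) with (t ^ 2 - u ^ 2) by ring.
  assert (Bt := B t); assert (Bu := B u).
  assert (hroot (e + t ^ 2) * hroot (e + u ^ 2) <= 2 * 2) by (apply Rmult_le_compat; lra).
  assert (0 <= Rabs (t ^ 2 - u ^ 2)) by apply Rabs_pos. nra.
Qed.

Lemma ex_RInt_hroot e a b : 0 <= e -> ex_RInt (fun u => hroot (e + u ^ 2)) a b.
Proof.
  intros He; apply (ex_RInt_continuous (V := R_CompleteNormedModule)).
  intros; apply continuous_hroot_sq, He.
Qed.

Lemma is_derive_Gfun e g : 0 <= e -> is_derive (Gfun e) g (hroot (e + g ^ 2)).
Proof.
  intros He; apply (is_derive_RInt (V := R_NormedModule) (fun u => hroot (e + u ^ 2)) _ 0).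
  - apply filter_forall; intros b; apply (RInt_correct (V := R_CompleteNormedModule)), ex_RInt_hroot, He.
  - apply continuous_hroot_sq, He.
Qed.

Lemma Gfun_0 e : Gfun e 0 = 0.
Proof. unfold Gfun; rewrite RInt_point; reflexivity. Qed.

Lemma abs_le_atan (f df : R -> R) M g : f 0 = 0 ->
  (forall t, is_derive f t (df t)) -> (forall t, Rabs (df t) <= M / (1 + t ^ 2)) ->
  0 <= g -> Rabs (f g) <= M * atan g.
Proof.
  intros H0 Hd B Hg.
  assert (Pos : forall t, 0 < 1 + t ^ 2) by (intros t; assert (H := pow2_ge_0 t); lra).
  assert (Da : forall t, is_derive (fun t => M * atan t) t (M / (1 + t ^ 2))).
  { intros t; unfold Rdiv; apply is_derive_scal, is_derive_Reals, derivable_pt_lim_atan. }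
  apply Rabs_le; split.
  - destruct (MVT_derive (fun t => f t + M * atan t) (fun t => df t + M / (1 + t ^ 2))
      0 g) as (c & _ & E).
    { intros t _; apply Rderive_plus; auto. }
    cbv beta in E; rewrite H0, atan_0 in E.
    assert (Bc := B c); apply Rabs_le_between in Bc. nra.
  - destruct (MVT_derive (fun t => M * atan t - f t) (fun t => M / (1 + t ^ 2) - df t)
      0 g) as (c & _ & E).
    { intros t _; apply Rderive_minus; auto. }
    cbv beta in E; rewrite H0, atan_0 in E.
    assert (Bc := B c); apply Rabs_le_between in Bc. nra.
Qed.

Lemma Gfun_perturbation e g : 0 <= e -> 0 <= g ->
  Rabs (Gfun e g - Gfun 0 g) <= 8 * PI * e.
Proof.
  intros He Hg.
  apply Rle_trans with (16 * e * atan g).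
  - apply (abs_le_atan (fun g => Gfun e g - Gfun 0 g)
      (fun u => hroot (e + u ^ 2) - hroot (0 + u ^ 2))); [| | |assumption].
    + rewrite !Gfun_0; ring.
    + intros t; apply Rderive_minus; apply is_derive_Gfun; lra.
    + intros t; assert (H1 := sq_shift_nonneg e t He).
      assert (H2 := sq_shift_nonneg 0 t (Rle_refl 0)).
      eapply Rle_trans; [apply hroot_lipschitz; assumption|].
      destruct (hroot_bounds _ H1) as [A1 A2]; destruct (hroot_bounds _ H2) as [A3 A4].
      replace (e + t ^ 2 - (0 + t ^ 2)) with e by ring. rewrite (Rabs_pos_eq e) by assumption.
      assert (A5 : hroot (e + t ^ 2) <= 2).
      { eapply Rle_trans; [exact A2|]. apply Rmult_le_reg_r with (1 + (e + t ^ 2)); [lra|].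
        unfold Rdiv; rewrite Rmult_assoc, Rinv_l by lra; lra. }
      replace (1 + (0 + t ^ 2)) with (1 + t ^ 2) in A4 by ring.
      assert (A6 : hroot (e + t ^ 2) * hroot (0 + t ^ 2) <= 2 * (2 / (1 + t ^ 2))).
      { apply Rmult_le_compat; lra. }
      replace (16 * e / (1 + t ^ 2)) with (4 * e * (2 * (2 / (1 + t ^ 2)))) by (unfold Rdiv; ring).
      apply Rmult_le_compat_l; lra.
  - assert (B := atan_bound g). assert (e * atan g <= e * (PI / 2)).
    { apply Rmult_le_compat_l; lra. }
    lra.
Qed.

Lemma Gfun_incr a b : a <= b -> Gfun 0 a <= Gfun 0 b.
Proof.
  intros H; destruct (MVT_derive (Gfun 0) (fun u => hroot (0 + u ^ 2)) a b)
    as (c & _ & E).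
  { intros t _; apply is_derive_Gfun; lra. }
  assert (B := hroot_bounds _ (sq_shift_nonneg 0 c (Rle_refl 0))). nra.
Qed.

Lemma Gfun_lim : exists L, filterlim (Gfun 0) (Rbar_locally p_infty) (locally L).
Proof.
  assert (Hpi := PI_RGT_0).
  assert (UB : forall g, 0 <= g -> Gfun 0 g <= PI).
  { intros g Hg; eapply Rle_trans; [apply Rle_abs|].
    apply Rle_trans with (2 * atan g).
    - apply abs_le_atan with (fun u => hroot (0 + u ^ 2)); auto using Gfun_0.
      + intros; apply is_derive_Gfun; lra.
      + intros t; destruct (hroot_bounds _ (sq_shift_nonneg 0 t (Rle_refl 0))) as [A1 A2].
        rewrite Rabs_pos_eq by lra. rewrite Rplus_0_l in *; exact A2.
    - assert (B := atan_bound g); lra. }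
  destruct (completeness (fun v => exists g, 0 <= g /\ v = Gfun 0 g)) as [L [HL1 HL2]].
  - exists PI; intros v (g & Hg & ->); auto.
  - exists (Gfun 0 0), 0; split; [lra | reflexivity].
  - exists L; intros P [eps HP].
    assert (He := cond_pos eps).
    destruct (classic (exists g, 0 <= g /\ L - eps < Gfun 0 g)) as [(g & Hg & Hl) | N].
    + exists g; intros t Ht; apply HP.
      assert (H1 := Gfun_incr g t ltac:(lra)).
      assert (H2 : Gfun 0 t <= L) by (apply HL1; exists t; split; [lra | reflexivity]).
      change (Rabs (Gfun 0 t - L) < eps); apply Rabs_def1; lra.
    + exfalso. assert (H : L <= L - eps); [|lra].
      apply HL2; intros v (g & Hg & ->). destruct (Rle_or_lt (Gfun 0 g) (L - eps)); [assumption|].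
      exfalso; apply N; exists g; split; assumption.
Qed.

(** The point is oroot s = a / r, where a solves a^3 + a (1 + b^2) = r^3. The right-hand side, with
    its [+ 0], has the shape produced by the affine change of variables [RInt_comp_lin]. *)
Lemma density_scaling r b : 0 < r ->
  density (r ^ 3) b = / r * (/ r * hroot (/ r ^ 2 + (/ r * b + 0) ^ 2)).
Proof.
  intros Hr; assert (Hb := pow2_ge_0 b).
  assert (Hr2 : 0 < r ^ 2) by (apply pow_lt; assumption).
  set (s := / r ^ 2 + (/ r * b + 0) ^ 2).
  assert (Es : s = (1 + b ^ 2) / r ^ 2) by (unfold s; field; lra).
  assert (Hs : 0 <= s).
  { rewrite Es; apply Rdiv_le_0_compat; lra. }
  set (a := afun (r ^ 3) (atan b)).
  assert (Ha := wroot_eq (r ^ 3) (atan b)). assert (C := cos_atan2 b).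
  set (c := cos (atan b)) in *; set (w := wroot (r ^ 3) (atan b)) in *.
  assert (Eo : oroot s = a / r).
  { apply oroot_unique; [assumption|]. rewrite Es.
    transitivity ((a ^ 3 + a * (1 + b ^ 2)) / r ^ 3); [field; lra|].
    replace (a ^ 3 + a * (1 + b ^ 2)) with (r ^ 3); [field; lra|].
    unfold a, afun; fold c w.
    assert (C' : (1 + b ^ 2) * c ^ 2 = 1) by (rewrite C; field; lra).
    transitivity (r ^ 3 * (((1 + b ^ 2) * c ^ 2) * w + (r ^ 3) ^ 2 * c ^ 6 * w ^ 3)); [|ring].
    rewrite C', Rmult_1_l, Ha; ring. }
  rewrite density_eq; unfold hroot; rewrite Eo, Es.
  assert (De := dens_eq (r ^ 3) (atan b)); fold c w in De.
  replace (3 * ((r ^ 3) ^ 2 * c ^ 6) * w ^ 2) with (3 * a ^ 2 * c ^ 2) in De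
    by (unfold a, afun; fold c w; ring).
  rewrite C in De.
  assert (Ha2 := pow2_ge_0 a).
  assert (Ed : dens (r ^ 3) (atan b) = (1 + b ^ 2) / (1 + b ^ 2 + 3 * a ^ 2)).
  { apply Rmult_eq_reg_r with (1 + 3 * a ^ 2 * / (1 + b ^ 2)).
    - rewrite De; field; lra.
    - apply Rgt_not_eq. assert (0 <= 3 * a ^ 2 * / (1 + b ^ 2)); [|lra].
      apply Rmult_le_pos; [lra|]; left; apply Rinv_0_lt_compat; lra. }
  rewrite Ed; field. split; [|split; lra]. 
  replace (1 + b ^ 2 + 3 * a ^ 2) with (1 + b ^ 2 + 3 * a ^ 2) by ring; lra.
Qed.

Lemma Gfun_density r b : 0 < r ->
  Gfun (/ r ^ 2) (/ r * b) = r * (Kfun (r ^ 3) (atan b) / 2 - Ystar' (r ^ 3) / 2).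
Proof.
  intros Hr; assert (He : 0 <= / r ^ 2).
  { left; apply Rinv_0_lt_compat, pow_lt; assumption. }
  assert (H := RInt_comp_lin (V := R_CompleteNormedModule) (fun u => hroot (/ r ^ 2 + u ^ 2))
    (/ r) 0 0 b (ex_RInt_hroot _ _ _ He)).
  replace (/ r * 0 + 0) with 0 in H by ring; replace (/ r * b + 0) with (/ r * b) in H by ring.
  unfold Gfun; rewrite <- H.
  apply (is_RInt_unique (V := R_CompleteNormedModule)).
  apply is_RInt_ext with (fun t => r * density (r ^ 3) t).
  { intros t _; rewrite density_scaling by assumption.
    unfold scal; simpl; unfold mult; simpl; req. field; lra. }
  apply (is_RInt_scal (V := R_NormedModule) (density (r ^ 3)) 0 b r).
  replace (Kfun (r ^ 3) (atan b) / 2 - Ystar' (r ^ 3) / 2) with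
    (Kfun (r ^ 3) (atan b) / 2 - Kfun (r ^ 3) (atan 0) / 2)
    by (rewrite atan_0, Kfun_mid; reflexivity).
  apply (is_RInt_derive (V := R_CompleteNormedModule) (fun b => Kfun (r ^ 3) (atan b) / 2)).
  - intros; apply density_antiderivative.
  - intros; apply continuous_density.
Qed.

Lemma Gfun_lim_r r : 0 < r ->
  filterlim (Gfun (/ r ^ 2)) (Rbar_locally p_infty) (locally (r * (Ystar' (r ^ 3) / 2))).
Proof.
  intros Hr.
  assert (H : filterlim (fun b => r * (Kfun (r ^ 3) (atan b) / 2 - Ystar' (r ^ 3) / 2))
    (Rbar_locally p_infty) (locally (r * (Ystar' (r ^ 3) / 2)))).
  { apply (filterlim_comp _ _ _ atan (fun p => r * (Kfun (r ^ 3) p / 2 - Ystar' (r ^ 3) / 2))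
      _ (locally (PI / 2))); [apply atan_lim_p|].
    replace (r * (Ystar' (r ^ 3) / 2)) with
      (r * (Kfun (r ^ 3) (PI / 2) / 2 - Ystar' (r ^ 3) / 2)) by (rewrite Kfun_top; field).
    apply (ex_derive_continuous (V := R_NormedModule)
      (fun p => r * (Kfun (r ^ 3) p / 2 - Ystar' (r ^ 3) / 2))).
    auto_derive. eexists; apply is_derive_Kfun. }
  apply filterlim_ext with (fun g => r * (Kfun (r ^ 3) (atan (r * g)) / 2 - Ystar' (r ^ 3) / 2)).
  { intros g; rewrite <- Gfun_density by assumption; f_equal; field; lra. }
  apply (filterlim_comp _ _ _ (fun g => r * g)
    (fun b => r * (Kfun (r ^ 3) (atan b) / 2 - Ystar' (r ^ 3) / 2)) _ (Rbar_locally p_infty));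
    [|exact H].
  intros P [M HM]; exists (M / r); intros t Ht; apply HM.
  apply Rmult_lt_reg_r with (/ r); [apply Rinv_0_lt_compat; assumption|].
  replace (r * t * / r) with t by (field; lra). exact Ht.
Qed.

(** The bound of [Gfun_perturbation] does not depend on the upper limit g, so it survives as g tends
    to infinity. *)
Lemma Ystar'_Gfun r L : 0 < r ->
  filterlim (Gfun 0) (Rbar_locally p_infty) (locally L) ->
  Rabs (r * (Ystar' (r ^ 3) / 2) - L) <= 8 * PI * / r ^ 2.
Proof.
  intros Hr HL; assert (HG := Gfun_lim_r r Hr); set (l := r * (Ystar' (r ^ 3) / 2)) in *.
  assert (He : 0 <= / r ^ 2).
  { left; apply Rinv_0_lt_compat, pow_lt; assumption. }
  apply le_epsilon; intros eps Heps.
  assert (He2 : 0 < eps / 2) by lra.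
  assert (F1 := HL _ (locally_ball L (mkposreal _ He2))).
  assert (F2 := HG _ (locally_ball l (mkposreal _ He2))).
  assert (F3 : Rbar_locally p_infty (fun t => 0 < t)) by (exists 0; auto).
  unfold filtermap in F1, F2.
  destruct (filter_ex _ (filter_and _ _ F1 (filter_and _ _ F2 F3))) as (t & B1 & B2 & Ht).
  assert (B1' : Rabs (Gfun 0 t - L) < eps / 2) by exact B1.
  assert (B2' : Rabs (Gfun (/ r ^ 2) t - l) < eps / 2) by exact B2.
  assert (B3 := Gfun_perturbation _ t He ltac:(lra)).
  replace (l - L) with (- (Gfun (/ r ^ 2) t - l) + (Gfun (/ r ^ 2) t - Gfun 0 t) + (Gfun 0 t - L))
    by ring.
  eapply Rle_trans; [apply Rabs_triang|].
  eapply Rle_trans; [apply Rplus_le_compat_r, Rabs_triang|].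
  rewrite Rabs_Ropp; lra.
Qed.

(* The substitution [t = oroot (u^2) ^ 3] turns the integral of [hroot (u^2)] into a
   Beta integral. *)
Definition bcoord (t : R) : R := sqrt (1 - t) * Rpower t (- (1 / 6)).

Lemma Rpower_sixth t : 0 < t -> Rpower t (1 / 6) ^ 6 = t.
Proof.
  intros Ht; rewrite <- Rpower_pow by apply exp_pos.
  rewrite Rpower_mult; replace (1 / 6 * INR 6) with 1 by (simpl; field).
  apply Rpower_1; assumption.
Qed.

(** All powers become rational in rho = t^(1/6) and s = sqrt (1 - t): [bcoord t] is s / rho, the
    root [oroot] there is rho^2 and [hroot] is rho^2 / (1 + 2 rho^6). The factor is negative because
    [bcoord] decreases from infinity to 0 as t runs from 0 to 1. *)
Lemma Beta_antiderivative t : 0 < t < 1 ->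
  is_derive (fun t => -6 * Gfun 0 (bcoord t)) t
    (Rpower t (1 / 6 - 1) * Rpower (1 - t) (1 / 2 - 1)).
Proof.
  intros Ht; set (rho := Rpower t (1 / 6)).
  assert (Hrho : 0 < rho) by apply exp_pos.
  assert (E6 : rho ^ 6 = t) by (apply Rpower_sixth; lra).
  assert (Hs : 0 < sqrt (1 - t)) by (apply sqrt_lt_R0; lra).
  assert (Es : sqrt (1 - t) ^ 2 = 1 - rho ^ 6).
  { rewrite E6, <- Rsqr_pow2, Rsqr_sqrt; lra. }
  assert (Ei : Rpower t (- (1 / 6)) = / rho) by apply Rpower_Ropp.
  assert (E7 : Rpower t (- (1 / 6) - 1) = / rho * / rho ^ 6).
  { unfold Rminus; rewrite Rpower_plus, Ei, Rpower_Ropp, Rpower_1, E6 by lra; reflexivity. }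
  assert (E5 : Rpower t (1 / 6 - 1) = rho * / rho ^ 6).
  { unfold Rminus; rewrite Rpower_plus, Rpower_Ropp, Rpower_1, E6 by lra; reflexivity. }
  assert (E2 : Rpower (1 - t) (1 / 2 - 1) = / sqrt (1 - t)).
  { replace (1 / 2 - 1) with (- / 2) by field; rewrite Rpower_Ropp, Rpower_sqrt by lra; reflexivity. }
  set (s := sqrt (1 - t)) in *.
  assert (Db : is_derive bcoord t (- / (2 * s) * / rho + s * (- (1 / 6) * (/ rho * / rho ^ 6)))).
  { rewrite <- E7, <- Ei.
    apply (is_derive_mult (fun t => sqrt (1 - t)) (fun t => Rpower t (- (1 / 6))));
      [| |intros; apply Rmult_comm].
    - auto_derive; [lra|]. change (1 + - t) with (1 - t); fold s; field; lra.
    - apply is_derive_Reals, derivable_pt_lim_power; lra. }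
  assert (Eo : oroot (0 + bcoord t ^ 2) = rho ^ 2).
  { apply oroot_unique; [apply sq_shift_nonneg; lra|].
    unfold bcoord; fold s; rewrite Ei, Rpow_mult_distr, Es. field; lra. }
  assert (R6 : 0 < rho ^ 6) by (apply pow_lt; assumption).
  replace (Rpower t (1 / 6 - 1) * Rpower (1 - t) (1 / 2 - 1)) with
    (-6 * ((- / (2 * s) * / rho + s * (- (1 / 6) * (/ rho * / rho ^ 6))) *
      hroot (0 + bcoord t ^ 2))).
  - apply is_derive_scal, (is_derive_comp (Gfun 0) bcoord); [apply is_derive_Gfun; lra | exact Db].
  - unfold hroot; rewrite Eo, E5, E2; unfold bcoord; fold s; rewrite Ei, Rpow_mult_distr, Es.
    replace (0 + (1 - rho ^ 6) * (/ rho) ^ 2 + 3 * (rho ^ 2) ^ 2) with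
      ((1 + 2 * rho ^ 6) / rho ^ 2) by (field; lra).
    replace (- / (2 * s) * / rho + s * (- (1 / 6) * (/ rho * / rho ^ 6))) with
      (- (3 * rho ^ 6 + s ^ 2) * / (6 * s * rho ^ 7)) by (field; lra).
    rewrite Es; field; repeat split; lra.
Qed.

Lemma Beta_value L : filterlim (Gfun 0) (Rbar_locally p_infty) (locally L) ->
  Beta (1 / 6) (1 / 2) = 6 * L.
Proof.
  intros HL; unfold Beta; apply is_RInt_gen_unique.
  (* The end t = 1 contributes Gfun 0 0 = 0, and t = 0 corresponds to the upper limit infinity,
     hence to L. *)
  replace (6 * L) with (-6 * Gfun 0 (bcoord 1) - -6 * L).
  2: { unfold bcoord; rewrite Rminus_diag, sqrt_0, Rmult_0_l, Gfun_0; ring. }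
  apply is_RInt_gen_antiderivative with (fun t => -6 * Gfun 0 (bcoord t)).
  - apply at_right_proper_filter.
  - apply at_left_proper_filter.
  - apply (Filter_prod _ _ _ (fun a => 0 < a < 1) (fun b => 0 < b < 1)).
    + exists (mkposreal 1 Rlt_0_1); intros a Ha H0; split; [exact H0|].
      assert (G : Rabs (a - 0) < 1) by exact Ha; rewrite Rminus_0_r in G; apply Rabs_def2 in G; lra.
    + exists (mkposreal 1 Rlt_0_1); intros b Hb H0; split; [|exact H0].
      assert (G : Rabs (b - 1) < 1) by exact Hb; apply Rabs_def2 in G; lra.
    + intros a b Ha Hb t Ht; simpl in Ht.
      assert (H : 0 < t < 1) by (unfold Rmin, Rmax in Ht; destruct (Rle_dec a b); lra).
      split; [apply Beta_antiderivative, H|].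
      apply (continuous_mult (K := R_AbsRing) (fun t => Rpower t (1 / 6 - 1))
        (fun t => Rpower (1 - t) (1 / 2 - 1)));
        apply (ex_derive_continuous (V := R_NormedModule)).
      * eexists; apply is_derive_Reals, derivable_pt_lim_power; lra.
      * eexists; apply (is_derive_comp (fun t => Rpower t (1 / 2 - 1)) (fun t => 1 - t)).
        -- apply is_derive_Reals, derivable_pt_lim_power; lra.
        -- auto_derive; trivial.
  - apply (filterlim_comp _ _ _ (fun t => Gfun 0 (bcoord t)) (fun v => -6 * v) _ (locally L)).
    2: { apply (ex_derive_continuous (V := R_NormedModule) (fun v => -6 * v)); auto_derive; trivial. }
    apply (filterlim_comp _ _ _ bcoord (Gfun 0) _ (Rbar_locally p_infty)); [|exact HL].
    intros P [M HM].
    (* For t < k^6 the factor t^(-1/6) exceeds 2 (|M| + 1), while sqrt (1 - t) is at least 1/2. *)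
    set (k := / (2 * (Rabs M + 1))).
    assert (HM0 := Rabs_pos M).
    assert (Hk : 0 < k) by (apply Rinv_0_lt_compat; lra).
    assert (Hk1 : k * (2 * (Rabs M + 1)) = 1) by (apply Rinv_l; lra).
    assert (Hd : 0 < Rmin (1 / 2) (k ^ 6)) by (apply Rmin_pos; [lra | apply pow_lt; assumption]).
    exists (mkposreal _ Hd); simpl; intros t Ht H0; apply HM.
    assert (G : Rabs (t - 0) < Rmin (1 / 2) (k ^ 6)) by exact Ht.
    rewrite Rminus_0_r, (Rabs_pos_eq t) in G by lra.
    apply Rmin_Rgt_l in G; destruct G as [G1 G2]; unfold Rgt in *.
    unfold bcoord; rewrite Rpower_Ropp; set (rho := Rpower t (1 / 6)).
    assert (Hrho : 0 < rho) by apply exp_pos.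
    assert (E6 : rho ^ 6 = t) by (apply Rpower_sixth; lra).
    assert (Hrk : rho < k).
    { destruct (Rlt_or_le rho k); [assumption|].
      assert (k ^ 6 <= rho ^ 6) by (apply pow_incr; lra). lra. }
    assert (Hs : 1 / 2 <= sqrt (1 - t)).
    { rewrite <- (sqrt_pow2 (1 / 2)) by lra. apply sqrt_le_1_alt. simpl; lra. }
    assert (Hi : / k < / rho) by (apply Rinv_lt_contravar; [apply Rmult_lt_0_compat|]; assumption).
    assert (Hik : / k = 2 * (Rabs M + 1)) by (unfold k; rewrite Rinv_inv; reflexivity).
    assert (HMa := Rle_abs M). nra.
  - cut (continuous (fun t => -6 * Gfun 0 (bcoord t)) 1).
    { intros H P HP; destruct (H P HP) as [e He]; exists e; intros t Ht _; apply He, Ht. }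
    apply (continuous_comp (fun t => Gfun 0 (bcoord t)) (fun v => -6 * v)).
    2: { apply (ex_derive_continuous (V := R_NormedModule) (fun v => -6 * v)); auto_derive; trivial. }
    apply (continuous_comp bcoord (Gfun 0)).
    2: { eapply continuous_of_derive, is_derive_Gfun; lra. }
    apply (continuous_mult (K := R_AbsRing) (fun t => sqrt (1 - t)) (fun t => Rpower t (- (1 / 6)))).
    + apply (continuous_comp (fun t => 1 - t) sqrt).
      * apply (ex_derive_continuous (V := R_NormedModule)); auto_derive; trivial.
      * apply continuity_pt_filterlim, continuity_pt_sqrt; lra.
    + apply (ex_derive_continuous (V := R_NormedModule)); eexists.
      apply is_derive_Reals, derivable_pt_lim_power; lra.
Qed.

(** With X = r^3 and Beta (1/6) (1/2) = 6 L the leading term is 2 L / r, and the estimate is that of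
    [Ystar'_Gfun] multiplied by 2 / r. *)
Lemma Ystar'_infinity X : 0 < X ->
  Rabs (Ystar' X - Beta (1 / 6) (1 / 2) / 3 * Rpower X (- (1 / 3))) <= 16 * PI * / X.
Proof.
  intros HX; destruct Gfun_lim as [L HL]; rewrite (Beta_value L HL), Rpower_Ropp.
  set (r := Rpower X (1 / 3)).
  assert (Hr : 0 < r) by apply exp_pos.
  assert (E3 : X = r ^ 3).
  { unfold r; rewrite <- Rpower_pow by apply exp_pos.
    rewrite Rpower_mult; replace (1 / 3 * INR 3) with 1 by (simpl; field).
    symmetry; apply Rpower_1; assumption. }
  assert (B := Ystar'_Gfun r L Hr HL); rewrite <- E3 in B.
  replace (Ystar' X - 6 * L / 3 * / r) with (2 * / r * (r * (Ystar' X / 2) - L)) by (field; lra).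
  assert (Hi : 0 < / r) by (apply Rinv_0_lt_compat; assumption).
  rewrite Rabs_mult, (Rabs_pos_eq (2 * / r)) by lra.
  replace (16 * PI * / X) with (2 * / r * (8 * PI * / r ^ 2)) by (rewrite E3; field; lra).
  apply Rmult_le_compat_l; lra.
Qed.

Lemma Ystar'_p_infty :
  bigO (Rbar_locally p_infty)
    (fun X => Ystar' X - Beta (1 / 6) (1 / 2) / 3 * Rpower (Rabs X) (- (1 / 3)))
    (fun X => / Rabs X).
Proof.
  exists (16 * PI), 0; intros X HX.
  assert (Hi : 0 < / X) by (apply Rinv_0_lt_compat; assumption).
  rewrite (Rabs_pos_eq X), (Rabs_pos_eq (/ X)) by lra.
  apply Ystar'_infinity; assumption.
Qed.

Lemma Ystar'_m_infty :
  bigO (Rbar_locally m_infty)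
    (fun X => Ystar' X - Beta (1 / 6) (1 / 2) / 3 * Rpower (Rabs X) (- (1 / 3)))
    (fun X => / Rabs X).
Proof.
  exists (16 * PI), 0; intros X HX.
  assert (Hi : 0 < / - X) by (apply Rinv_0_lt_compat; lra).
  rewrite (Rabs_left X), (Rabs_pos_eq (/ - X)), <- Ystar'_opp by lra.
  apply Ystar'_infinity; lra.
Qed.

Theorem proposition2 :
  (* (i) *)
  (analytic_diffeo_onto strip Phi' Phi'_inv /\
   volume_preserving Phi' /\
   analytic Ystar' /\
   bigO (locally 0) (fun X => Ystar' X - (PI - 15 / 16 * PI * X ^ 2))
     (fun X => X ^ 4) /\
   bigO (Rbar_locally p_infty)
     (fun X => Ystar' X - Beta (1 / 6) (1 / 2) / 3 * Rpower (Rabs X) (- (1 / 3)))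
     (fun X => / Rabs X) /\
   bigO (Rbar_locally m_infty)
     (fun X => Ystar' X - Beta (1 / 6) (1 / 2) / 3 * Rpower (Rabs X) (- (1 / 3)))
     (fun X => / Rabs X)) /\
  (* (ii) *)
  (forall T : R, prandtl_solution T (self_similar T Theta')) /\
  (* (iii) *)
  (C1_half_plane Theta' /\
   analytic2_on closed_strip Theta' /\
   analytic2_on half_plane Theta'_bar /\
   (forall T : R, prandtl_solution T (self_similar T Theta'_bar))) /\
  (* (iv) *)
  ((forall X Y : R, 0 <= Y -> Theta' (- X, Y) = - Theta' (X, Y)) /\
   (forall X Y : R, Rabs Y < Ystar' X ->
      Theta' (X, Ystar' X + Y) = Theta' (X, Ystar' X - Y)) /\
   (forall X Y : R, X < 0 -> 0 < Y < 2 * Ystar' X -> 0 < Theta' (X, Y)) /\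
   (forall X Y : R, 0 < X -> 0 < Y < 2 * Ystar' X -> Theta' (X, Y) < 0)) /\
  (* (v) *)
  ((forall q : R * R, critical_set q <-> S1 q \/ S2 q) /\
   (forall X : R, Theta' (X, Ystar' X) = Psi1 X) /\
   (critical_set (0, PI) /\
    exists m : R, is_dX Theta' (0, PI) m /\
      forall (q : R * R) (l : R),
        critical_set q -> is_dX Theta' q l -> m <= l) /\
   bigO (locally ((0, 0) : R * R))
     (fun q => Theta' (fst q, PI + snd q) - crest_expansion (fst q) (snd q))
     (fun q => Rabs (fst q) ^ 5 + Rabs (snd q) ^ 4 * Rabs (fst q))) /\
  (* (vi) *)
  (forall Y : R, 0 <= Y ->
     is_dX Theta' (0, Y) (- sin (Y / 2) ^ 2 * indicator 0 (2 * PI) Y)) /\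
  (* (vii) *)
  ((forall Y : R, 0 <= Y ->
      has_derive_n (fun X => Theta' (X, Y)) 3 0 (trace3 Y)) /\
   (forall Y : R, 0 < Y < 2 * PI ->
      0 < Derive_n (fun X => Theta' (X, Y)) 3 0) /\
   (exists c : R, 0 < c /\
      bigO (at_right 0)
        (fun Y => Derive_n (fun X => Theta' (X, Y)) 3 0 - c * Y ^ 8)
        (fun Y => Y ^ 10)) /\
   (exists c' : R, 0 < c' /\
      bigO (at_right 0)
        (fun Y => Derive_n (fun X => Theta' (X, 2 * PI - Y)) 3 0 - c' * Y)
        (fun Y => Y ^ 2))).
Proof.
  split; [|split; [|split; [|split; [|split; [|split]]]]].
  - repeat split; try apply Phi'_diffeo.
    + apply Phi'_volume.
    + apply Ystar'_analytic.
    + apply Ystar'_expansion.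
    + apply Ystar'_p_infty.
    + apply Ystar'_m_infty.
  - apply Theta'_prandtl.
  - split; [apply Theta'_C1|]; split; [apply Theta'_analytic|].
    split; [apply Theta'_bar_analytic | apply Theta'_bar_prandtl].
  - split; [intros; apply Theta'_odd|]; split; [apply Theta'_symmetric|].
    split; [apply Theta'_pos | apply Theta'_neg].
  - split; [apply critical_set_eq|]; split; [apply Theta'_crest|].
    split; [apply minimum_at_crest | apply Theta'_crest_expansion].
  - apply Theta'_dX_axis.
  - split; [apply Theta'_third_derivative|]; split; [apply Theta'_third_pos|].
    split; [apply Theta'_third_bottom | apply Theta'_third_top].
Qed.
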